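(* Fix $\varepsilon>0$. Let $K_1,K_{-1}\subseteq[N]$ be disjoint, $K=K_1\cup K_{-1}$, $k=|K|$, $x_{\pm1}=\mathbb{1}_{K_1}-\mathbb{1}_{K_{-1}}$, let $A\in\mathbb{R}^{m\times N}$ be a Gaussian matrix and $b=Ax_{\pm1}$. Let $$\Delta_{\pm\mathrm{ter}}(k)=\inf_{\tau\ge0}\Big[k\int_{-\infty}^{\tau}(u-\tau)^2\phi(u)\,du+2(N-k)\int_{\tau}^{\infty}(u-\tau)^2\phi(u)\,du\Big],\quad \phi(u)=(2\pi)^{-1/2}e^{-u^2/2}.$$ If $m\ge\Delta_{\pm\mathrm{ter}}(k)+\sqrt{8\log(4/\varepsilon)N}$, then with probability larger than $1-\varepsilon$, $x_{\pm1}$ is the unique solution of $\min\|x\|_1$ subject to $Ax=b$ and $x\in[-1,1]^N$.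
   Context: $\mathbb{1}_S$ has entries $1$ on $S$, $0$ elsewhere. A Gaussian matrix is $A=m^{-1/2}[a_{ij}]$ with $a_{ij}$ i.i.d. standard normal. $\log$ is the natural logarithm. *)

(* Defs.v *)
From HB Require Import structures.
From mathcomp Require Import all_boot all_order all_algebra.
From mathcomp Require Import all_classical all_reals all_analysis.
Set Implicit Arguments. Unset Strict Implicit. Unset Printing Implicit Defensive.
Import Order.TTheory GRing.Theory Num.Theory.
Import numFieldNormedType.Exports.
Local Open Scope classical_set_scope.
Local Open Scope ring_scope.

Definition phi {R : realType} (u : R) : R :=
  (Num.sqrt (pi *+ 2))^-1 * expR (- (u ^+ 2) / 2).

Definition Delta_pm_ter {R : realType} (N k : nat) : \bar R :=
  ereal_inf [set
    ((k%:R)%:E * (\int[lebesgue_measure]_(u in `]-oo, tau]) ((u - tau) ^+ 2 * phi u)%:E)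
     + ((2 * (N%:R - k%:R))%:E
         * (\int[lebesgue_measure]_(u in `[tau, +oo[) ((u - tau) ^+ 2 * phi u)%:E)))%E
    | tau in `[0, +oo[%classic].

Definition mutually_independent {R : realType} {d : measure_display}
  {T : measurableType d} (P : probability T R) (I : finType) (X : I -> T -> R) : Prop :=
  forall B : I -> set R, (forall i, measurable (B i)) ->
    P [set w | forall i, B i (X i w)] = (\prod_(i : I) P (X i @^-1` B i))%E.

Definition std_normal_rv {R : realType} {d : measure_display}
  {T : measurableType d} (P : probability T R) (X : T -> R) : Prop :=
  measurable_fun setT X /\
  forall B : set R, measurable B -> P (X @^-1` B) = normal_prob 0 1 B.

Definition gauss_mx {R : realType} {T : Type} (m N : nat)
  (a : 'I_m * 'I_N -> T -> R) (w : T) : 'M[R]_(m, N) :=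
  \matrix_(i < m, j < N) ((Num.sqrt (m%:R))^-1 * a (i, j) w).

Definition l1norm {R : realType} (N : nat) (x : 'cV[R]_N) : R :=
  \sum_(j < N) `|x j 0|.

Definition xpm1 {R : realType} (N : nat) (K1 Km1 : {set 'I_N}) : 'cV[R]_N :=
  \col_(j < N) ((j \in K1)%:R - (j \in Km1)%:R).

Definition feasible {R : realType} (m N : nat) (A : 'M[R]_(m, N)) (b : 'cV[R]_m)
  (x : 'cV[R]_N) : Prop :=
  A *m x = b /\ forall j, -1 <= x j 0 <= 1.

Definition unique_l1_box_solution {R : realType} (m N : nat) (A : 'M[R]_(m, N))
  (b : 'cV[R]_m) (x0 : 'cV[R]_N) : Prop :=
  feasible A b x0 /\
  forall x, feasible A b x -> l1norm x0 <= l1norm x /\ (l1norm x = l1norm x0 -> x = x0).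

(* Main.v *)
(* Let [C] be the cone of directions [v] along which neither the box constraint
   nor the l1 norm gets worse at [x0]; [x0] is the unique solution as soon as
   [ker A] meets [C] only in [0].  When [m > N] the kernel is almost surely
   trivial.  When [m <= N] we follow Gordon's escape through a mesh, in exponential form.
   For a finite net of unit vectors [x] of [C], Gaussian interpolation compares
   [- |A x| + gamma] with [<g, x> - |h|] through the functional
   [(\sum_x expR (a (w x - r x))) ^ b], which with [a b = s] fixed and [b] small is
   nearly [expR (s max_x (w x - r x))]; the gain is a factor [expR (s ^+ 2 / 2)].
   The variable [<g, x>] is bounded by the distance of [g] to the polar cone,
   i.e. by the root of a sum of squared thresholds whose mean is
   [Delta_pm_ter N k] at the optimal threshold, and [|h|] by an estimate of
   [E expR (- s |h|)].
   With [s = sqrt (2 ln (4 / eps))] the hypothesis on [m] makes the probability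
   that [|A x|] is small for some [x] of the net at most [eps / 4]; another
   [eps / 4] pays for replacing [C] by the net. *)
Require Import Defs.
From HB Require Import structures.
From mathcomp Require Import all_boot all_order all_algebra.
From mathcomp Require Import all_classical all_reals all_analysis.
From mathcomp Require Import measurable_realfun ring lra.
Import Order.TTheory GRing.Theory Num.Theory.
Import numFieldNormedType.Exports.
Local Open Scope classical_set_scope.
Local Open Scope ring_scope.
Set Implicit Arguments.
Unset Strict Implicit.
Unset Printing Implicit Defensive.

(** The square root in the hypothesis on [m] equals [2 * s * sqrt N]. When [m <= N], dividing the
    gap [m - Delta >= 2 * s * sqrt N] by [sqrt m + sqrt Delta <= 2 * sqrt N] gives
    [sqrt m - sqrt Delta >= s]; this is the reason for the case split. All estimates are Laplace
    transforms at the one parameter [s], so no concentration inequality enters. The exponent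
    collects [- s ^+ 2 / 2] from the comparison, [s ^+ 2 / 4 - s * sqrt (m - 1)] from [|h|] and
    [s ^+ 2 / 2 + s * sqrt Delta] from [<g, x>]. Up to errors this is at most [- 3 * s ^+ 2 / 4],
    that is [- 3 / 2] times [ln (4 / eps)], and a third of it is left to absorb the errors. The
    constants are chosen in the order [s], the smoothing [zeta] of the norm, a bound [B] on the
    entries of [A], the net, and last [b]. The size of the net enters only through [b * ln #|J|], so
    the net may be as fine as the bound [B] requires and its cardinality is never estimated. *)

Section iid_families.
Context {R : realType}.
Notation gauss := (normal_prob (0 : R) 1).

(** * Finite families of independent standard normal variables *)

Definition iid_normal {d} {T : measurableType d} (P : probability T R)
    (I : finType) (X : I -> T -> R) : Prop :=
  (forall i, std_normal_rv P (X i)) /\ mutually_independent P X.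

(** Tuples carry the product sigma-algebra on which laws are compared; [vec] and [coord] translate
    between them and families indexed by [I]. *)
Definition vec {T : Type} {I : finType} (X : I -> T -> R) (w : T) :
    #|I|.-tuple R := [tuple X (enum_val i) w | i < #|I|].

Definition coord {I : finType} (i : I) (t : #|I|.-tuple R) : R :=
  tnth t (enum_rank i).

Lemma coord_vec {T : Type} {I : finType} (X : I -> T -> R) i w :
  coord i (vec X w) = X i w.
Proof. by rewrite /coord tnth_mktuple enum_rankK. Qed.

Lemma measurable_coord {I : finType} (i : I) :
  measurable_fun setT (@coord I i).
Proof. exact: measurable_tnth. Qed.

Lemma measurable_vec {d} {T : measurableType d} {I : finType} (X : I -> T -> R) :
  (forall i, measurable_fun setT (X i)) -> measurable_fun setT (vec X).
Proof.
move=> mX; apply/measurable_fun_tnthP => i.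
rewrite (_ : _ \o _ = X (enum_val i))//.
by apply/funext => w /=; rewrite tnth_mktuple.
Qed.

Definition box {I : finType} (B : I -> set R) : set (#|I|.-tuple R) :=
  [set t | forall i, B i (coord i t)].

Lemma measurable_box {I : finType} (B : I -> set R) :
  (forall i, measurable (B i)) -> measurable (box B).
Proof.
move=> mB.
rewrite (_ : box B = \bigcap_(i in [set: I]) (coord i @^-1` B i)); last first.
  by apply/seteqP; split => [t Bt i _|t Bt i]; [exact: Bt|exact: Bt].
apply: fin_bigcap_measurable => [|i _]; first exact: finite_finset.
by rewrite -[X in measurable X]setTI; exact: measurable_coord.
Qed.

(** Boxes are stable under intersection and generate the sigma-algebra of tuples, and independence
    with normal marginals fixes the measure of every box. A family may therefore be exchanged for
    any copy built on a more convenient space. *)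
Lemma law_unique {d d'} {T : measurableType d} {T' : measurableType d'}
    (P : probability T R) (P' : probability T' R) (I : finType)
    (X : I -> T -> R) (X' : I -> T' -> R) (C : set (#|I|.-tuple R)) :
  iid_normal P X -> iid_normal P' X' -> measurable C ->
  P (vec X @^-1` C) = P' (vec X' @^-1` C).
Proof.
move=> [NX IX] [NX' IX'] mC.
have mX : measurable_fun setT (vec X).
  by apply: measurable_vec => i; have [] := NX i.
have mX' : measurable_fun setT (vec X').
  by apply: measurable_vec => i; have [] := NX' i.
pose mf := [the {mfun T >-> #|I|.-tuple R} of mfun_Sub (mem_set mX)].
pose mf' := [the {mfun T' >-> #|I|.-tuple R} of mfun_Sub (mem_set mX')].
pose G := [set box B | B in [set B : I -> set R | forall i, measurable (B i)]].
pose m1 := [the probability _ _ of distribution P mf].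
pose m2 := [the probability _ _ of distribution P' mf'].
suff : m1 C = m2 C by [].
apply: (measure_unique G (fun=> setT)) => //.
- apply/seteqP; split => A.
    apply: smallest_sub; first exact: smallest_sigma_algebra.
    rewrite -bigcup_seq => D [i _ /= [B mB <-]].
    apply: sub_sigma_algebra.
    exists (fun j => if j == enum_val i then B else setT) => /=.
      by move=> j; case: ifP.
    rewrite setTI; apply/seteqP; split => t /=.
      by move=> /(_ (enum_val i)); rewrite eqxx /coord enum_valK.
    by move=> Bt j; case: eqP => // ->; rewrite /coord enum_valK.
  apply: smallest_sub; first exact: sigma_algebra_measurable.
  by move=> D [B mB <-]; exact: measurable_box.
- move=> _ _ [B mB <-] [B' mB' <-].
  exists (fun i => B i `&` B' i); first by move=> i; exact: measurableI.
  by apply/seteqP; split => t /= => [H|[H H'] i]; split => // i; case: (H i).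
- move=> _; exists (fun=> setT) => //.
  by apply/seteqP; split.
- by rewrite bigcup_const.
- move=> _ [B mB <-].
  rewrite /= /distribution /pushforward /=.
  have -> : vec X @^-1` box B = [set w | forall i, B i (X i w)].
    by apply/seteqP; split => w /= H i; have := H i; rewrite coord_vec.
  have -> : vec X' @^-1` box B = [set w | forall i, B i (X' i w)].
    by apply/seteqP; split => w /= H i; have := H i; rewrite coord_vec.
  rewrite IX// IX'//; apply: eq_bigr => i _.
  by rewrite (NX i).2// (NX' i).2.
- by move=> _; rewrite ltey_eq fin_num_measure.
Qed.

Lemma law_ge0_integral {d d'} {T : measurableType d} {T' : measurableType d'}
    (P : probability T R) (P' : probability T' R) (I : finType)
    (X : I -> T -> R) (X' : I -> T' -> R) (F : #|I|.-tuple R -> \bar R) :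
  iid_normal P X -> iid_normal P' X' -> measurable_fun [set: #|I|.-tuple R] F ->
  (forall t, 0 <= F t)%E ->
  (\int[P]_w F (vec X w) = \int[P']_w F (vec X' w))%E.
Proof.
move=> iX iX' mF F0.
have mX : measurable_fun setT (vec X).
  by apply: measurable_vec => i; have [] := iX.1 i.
have mX' : measurable_fun setT (vec X').
  by apply: measurable_vec => i; have [] := iX'.1 i.
pose mf := [the {mfun T >-> #|I|.-tuple R} of mfun_Sub (mem_set mX)].
pose mf' := [the {mfun T' >-> #|I|.-tuple R} of mfun_Sub (mem_set mX')].
have <- := ge0_integral_distribution (P := P) mf mF F0.
have <- := ge0_integral_distribution (P := P') mf' mF F0.
apply: eq_measure_integral => A mA _.
exact: (law_unique iX iX' mA).
Qed.

Lemma iid_reindex {d} {T : measurableType d} (P : probability T R)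
    (I J : finType) (X : I -> T -> R) (f : J -> I) :
  injective f -> iid_normal P X -> iid_normal P (X \o f).
Proof.
move=> fI [NX IX]; split => [j|]; first exact: NX.
move=> B mB.
(* Indices outside the image of [f] receive the whole line, an event of probability one, so that the
   independence of the full family [X] applies. *)
pose B' i := if [pick j | f j == i] is Some j then B j else setT.
have B'f j : B' (f j) = B j.
  rewrite /B'; case: pickP => [j' /eqP/fI -> //|/(_ j)].
  by rewrite eqxx.
have B'n i : i \notin codom f -> B' i = setT.
  move=> ni; rewrite /B'; case: pickP => // j /eqP fj.
  by move: ni; rewrite -fj codom_f.
have mB' i : measurable (B' i) by rewrite /B'; case: pickP.
have -> : [set w | forall i, B i ((X \o f) i w)] =
          [set w | forall i, B' i (X i w)].
  apply/seteqP; split => w /= H i; last by have := H (f i); rewrite B'f.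
  have [/codomP[j ->]|ni] := boolP (i \in codom f); last by rewrite B'n.
  by rewrite B'f; exact: H.
rewrite IX// (bigID (fun i => i \in codom f))/= [X in (_ * X)%E]big1 ?mule1.
  rewrite (eq_bigl (fun i => i \in f @: [set: J]%SET)); last first.
    by move=> i; apply/codomP/imsetP => [[j ->]|[j _ ->]]; exists j.
  rewrite big_imset/=; last by move=> ? ? _ _; exact: fI.
  by rewrite (eq_bigl predT) => [|j]; [apply: eq_bigr => j _; rewrite B'f|rewrite inE].
by move=> i ni; rewrite B'n// preimage_setT probability_setT.
Qed.

Lemma iid_sum {d d'} {T : measurableType d} {T' : measurableType d'}
    (P : probability T R) (P' : probability T' R) (I J : finType)
    (X : I -> T -> R) (Y : J -> T' -> R) :
  iid_normal P X -> iid_normal P' Y ->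
  iid_normal (P \x P')%E (fun (k : I + J) w =>
    match k with inl i => X i w.1 | inr j => Y j w.2 end).
Proof.
move=> [NX IX] [NY IY].
have fstE i B : measurable B ->
    (P \x P')%E ((fun w => X i w.1) @^-1` B) = P (X i @^-1` B).
  move=> mB.
  have -> : (fun w : T * T' => X i w.1) @^-1` B = (X i @^-1` B) `*` setT.
    by apply/seteqP; split => [w|w []].
  rewrite product_measure1E//; last first.
    by rewrite -[X in measurable X]setTI; exact: (NX i).1.
  by rewrite [X in (_ * X)%E]probability_setT mule1.
have sndE j B : measurable B ->
    (P \x P')%E ((fun w => Y j w.2) @^-1` B) = P' (Y j @^-1` B).
  move=> mB.
  have -> : (fun w : T * T' => Y j w.2) @^-1` B = setT `*` (Y j @^-1` B).
    by apply/seteqP; split => [w|w []].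
  rewrite product_measure1E//; last first.
    by rewrite -[X in measurable X]setTI; exact: (NY j).1.
  by rewrite [X in (X * _)%E]probability_setT mul1e.
have mP1 i (B : set R) : measurable B -> measurable (X i @^-1` B).
  by move=> mB; rewrite -[X in measurable X]setTI; exact: (NX i).1.
have mP2 i (B : set R) : measurable B -> measurable (Y i @^-1` B).
  by move=> mB; rewrite -[X in measurable X]setTI; exact: (NY i).1.
split.
  case=> [i|j]; split.
  - by apply: measurableT_comp => //; exact: (NX i).1.
  - by move=> B mB; exact: etrans (fstE i _ mB) ((NX i).2 _ mB).
  - by apply: measurableT_comp => //; exact: (NY j).1.
  - by move=> B mB; exact: etrans (sndE j _ mB) ((NY j).2 _ mB).
move=> B mB.
pose XB := [set w | forall i, B (inl i) (X i w)].
pose YB := [set w | forall j, B (inr j) (Y j w)].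
have -> : [set w | forall i, B i (match i with
    | inl i => X i w.1 | inr j => Y j w.2 end)] = XB `*` YB.
  apply/seteqP; split => [w H|w [H1 H2] [i|j]].
  - by split => [i|j]; [exact: (H (inl i))|exact: (H (inr j))].
  - exact: H1.
  - exact: H2.
have mXB : measurable XB.
  rewrite (_ : XB = \bigcap_(i in [set: I]) (X i @^-1` B (inl i))).
    by apply: fin_bigcap_measurable => [|i _]; [exact: finite_finset|exact: mP1].
  by apply/seteqP; split => [t Bt i _|t Bt i]; exact: Bt.
have mYB : measurable YB.
  rewrite (_ : YB = \bigcap_(i in [set: J]) (Y i @^-1` B (inr i))).
    by apply: fin_bigcap_measurable => [|i _]; [exact: finite_finset|exact: mP2].
  by apply/seteqP; split => [t Bt i _|t Bt i]; exact: Bt.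
have PXB : P XB = (\prod_i P (X i @^-1` B (inl i)))%E.
  by apply: (IX (B \o inl)) => i; exact: mB.
have PYB : P' YB = (\prod_j P' (Y j @^-1` B (inr j)))%E.
  by apply: (IY (B \o inr)) => j; exact: mB.
rewrite [LHS](product_measure1E _ _ mXB mYB) big_sumType/=.
transitivity (P XB * P' YB)%E => //; rewrite PXB PYB.
congr (_ * _)%E; apply: eq_bigr => k _.
  exact: esym (fstE k _ (mB (inl k))).
exact: esym (sndE k _ (mB (inr k))).
Qed.

Lemma iid_gauss_unit : iid_normal gauss (fun _ : unit => @idfun R).
Proof.
split=> [i|B mB]; first by split => [|B mB]; [exact: measurable_id|].
have -> : [set w | forall i : unit, B i w] = B tt.
  by apply/seteqP; split => [w /(_ tt)|w H []].
by rewrite (big_pred1 tt) => [|[]].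
Qed.

Lemma iid_snoc {d} {T : measurableType d} (P : probability T R)
    (I : finType) (X : I -> T -> R) : iid_normal P X ->
  iid_normal (P \x gauss)%E (fun (k : option I) w =>
    if k is Some i then X i w.1 else w.2).
Proof.
move=> iX; have := iid_sum iX iid_gauss_unit.
pose f (k : option I) : I + unit := if k is Some i then inl i else inr tt.
have fI : injective f by move=> [i|] [j|] //= [->].
move=> /(iid_reindex fI).
rewrite (_ : (_ \o f) = (fun (k : option I) w =>
  if k is Some i then X i w.1 else w.2))//.
by apply/funext => -[].
Qed.

Lemma exists_iid_ord (n : nat) : exists (d : measure_display)
  (T : measurableType d) (P : probability T R) (X : 'I_n -> T -> R),
  iid_normal P X.
Proof.
elim: n => [|n [d [T [P [X iX]]]]].
  exists _, _, gauss, (fun _ => idfun); split=> [[]//|B mB].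
  rewrite big_ord0 (_ : [set _ | _] = setT) ?probability_setT//.
  by apply/seteqP; split => // w _ [].
exists _, _, (P \x gauss)%E, ((fun (k : option 'I_n) w =>
    if k is Some i then X i w.1 else w.2) \o unlift ord0).
apply: iid_reindex (iid_snoc iX) => i j.
case: (unliftP ord0 i) => [i' ->|->]; case: (unliftP ord0 j) => [j' ->|->] //=.
by move=> [->].
Qed.

Lemma exists_iid (I : finType) : exists (d : measure_display)
  (T : measurableType d) (P : probability T R) (X : I -> T -> R),
  iid_normal P X.
Proof.
have [d [T [P [X iX]]]] := exists_iid_ord #|I|.
by exists d, T, P, (X \o enum_rank); apply: iid_reindex iX; exact: enum_rank_inj.
Qed.

(** The variable of index [i] now lives on a factor of its own, so Fubini integrates it with all
    other variables frozen. Both integration by parts and the determinant argument start from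
    this. *)
Lemma iid_resample {d} {T : measurableType d} (P : probability T R)
    (I : finType) (X : I -> T -> R) (i : I) : iid_normal P X ->
  iid_normal (P \x gauss)%E (fun j w => if j == i then w.2 else X j w.1).
Proof.
move=> iX; have := iid_snoc iX.
pose f (j : I) := if j == i then None else Some j.
have fI : injective f.
  by move=> j k; rewrite /f; case: eqP => [->|]; case: eqP => // _ _ [].
move=> /(iid_reindex fI).
rewrite (_ : (_ \o f) = (fun j w => if j == i then w.2 else X j w.1))//.
by apply/funext => j; rewrite /f /=; case: eqP.
Qed.

(** The integral depends on the law only, so the variable of index [ord0] can be moved to a separate
    factor; Tonelli splits it off and the induction continues. *)
Lemma iid_prod_expectation_ord (n : nat) {d} {T : measurableType d}
    (P : probability T R) (X : 'I_n -> T -> R) (f : 'I_n -> R -> R) :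
  iid_normal P X -> (forall i, measurable_fun setT (f i)) ->
  (forall i x, 0 <= f i x) ->
  (\int[P]_w (\prod_i f i (X i w))%:E = \prod_i \int[gauss]_x (f i x)%:E)%E.
Proof.
elim: n d T P X f => [|n IH] d T P X f iX mf f0.
  rewrite big_ord0; under eq_integral do rewrite big_ord0.
  by rewrite integral_cst//= mul1e [LHS]probability_setT.
have iX' : iid_normal P (X \o lift ord0) by exact: iid_reindex lift_inj iX.
pose Y (k : option 'I_n) (w : T * R) :=
  if k is Some i then (X \o lift ord0) i w.1 else w.2.
have uI : injective (unlift (@ord0 n)).
  move=> i j; case: (unliftP ord0 i) => [i' ->|->];
    case: (unliftP ord0 j) => [j' ->|->] //=.
  by move=> [->].
have iY : iid_normal (P \x gauss)%E (Y \o unlift ord0).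
  exact: iid_reindex uI (iid_snoc iX').
pose F (t : #|'I_n.+1|.-tuple R) := (\prod_i f i (coord i t))%:E.
have mF : measurable_fun [set: #|'I_n.+1|.-tuple R] F.
  apply/measurable_EFinP; apply: measurable_prod => i _.
  by apply: measurableT_comp => //; exact: measurable_coord.
have F0 t : (0 <= F t)%E by rewrite lee_fin prodr_ge0.
transitivity (\int[P]_w F (vec X w))%E.
  apply: eq_integral => w _; congr EFin; apply: eq_bigr => i _.
  by rewrite coord_vec.
rewrite (law_ge0_integral iX iY mF F0).
transitivity (\int[(P \x gauss)%E]_z ((\prod_i f (lift ord0 i)
    ((X \o lift ord0) i z.1)) * f ord0 z.2)%:E)%E.
  apply: eq_integral => z _; rewrite /F big_ord_recl mulrC !coord_vec.
  congr (_ * _)%:E; last by rewrite /= /Y unlift_none.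
  by apply: eq_bigr => i _; rewrite coord_vec /Y /= liftK.
have mX i : measurable_fun setT (X i) by have [] := iX.1 i.
rewrite fubini_tonelli1/=; last 2 first.
- apply/measurable_EFinP; apply: measurable_funM.
    apply: measurable_prod => i _; apply: measurableT_comp => //.
    by apply: measurableT_comp => //; exact: mX.
  by apply: measurableT_comp; [exact: mf|exact: measurable_snd].
- by move=> z; rewrite lee_fin mulr_ge0// prodr_ge0.
rewrite big_ord_recl muleC -(IH _ _ _ _ (f \o lift ord0) iX') => [|i|i x]; last 2 first.
- exact: mf.
- exact: f0.
rewrite /fubini_F /=.
under eq_integral => w _.
  under eq_integral do rewrite EFinM.
  rewrite ge0_integralZl//=; last 3 first.
  - by apply/measurable_EFinP; exact: mf.
  - by move=> x _; rewrite lee_fin.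
  - by rewrite lee_fin prodr_ge0.
  over.
rewrite ge0_integralZr//=.
- apply/measurable_EFinP; apply: measurable_prod => i _.
  by apply: measurableT_comp => //; exact: mX.
- by move=> w _; rewrite lee_fin prodr_ge0.
- by apply: integral_ge0 => x _; rewrite lee_fin.
Qed.

Lemma iid_prod_expectation {d} {T : measurableType d} (P : probability T R)
    (I : finType) (X : I -> T -> R) (f : I -> R -> R) :
  iid_normal P X -> (forall i, measurable_fun setT (f i)) ->
  (forall i x, 0 <= f i x) ->
  (\int[P]_w (\prod_i f i (X i w))%:E = \prod_i \int[gauss]_x (f i x)%:E)%E.
Proof.
move=> iX mf f0.
have iX' : iid_normal P (X \o @enum_val I predT).
  by apply: iid_reindex iX; exact: enum_val_inj.
have vb : bijective (@enum_val I predT).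
  by exists enum_rank => i; [exact: enum_valK|exact: enum_rankK].
rewrite (reindex (@enum_val I predT))/=; last exact: onW_bij.
rewrite -(iid_prod_expectation_ord (f := f \o @enum_val I predT) iX'); last 2 first.
- by move=> i; exact: mf.
- by move=> i x; exact: f0.
apply: eq_integral => w _; congr EFin.
by rewrite (reindex (@enum_val I predT))//=; exact: onW_bij.
Qed.

End iid_families.

(** * The Gaussian measure on the line and Stein's identity *)

Section gaussian_line.
Context {R : realType}.
Notation gauss := (normal_prob (0 : R) 1).
Notation mu := (@lebesgue_measure R).
Notation pdf := (normal_pdf (0 : R) 1).

(** The Radon-Nikodym derivative of the Gaussian measure and [pdf] have equal integrals over every
    measurable set, hence agree almost everywhere. *)
Lemma gauss_ge0_integral (f : R -> \bar R) (E : set R) : measurable E ->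
  measurable_fun E f -> (forall x, 0 <= f x)%E ->
  (\int[gauss]_(x in E) f x = \int[mu]_(x in E) (f x * (pdf x)%:E))%E.
Proof.
move=> mE mf f0.
have dom : gauss `<< mu by exact: normal_prob_dominates.
rewrite -(Radon_Nikodym_SigmaFinite.change_of_variables dom)//.
have iRN := Radon_Nikodym_SigmaFinite.f_integrable dom.
apply: ae_eq_integral => //.
- apply: emeasurable_funM => //; apply: measurable_funTS.
  exact: measurable_int iRN.
- apply: emeasurable_funM => //; apply: measurable_funTS.
  by apply/measurable_EFinP; exact: measurable_normal_pdf.
- apply: ae_eqe_mul2l.
  apply: integral_ae_eq => //.
  + exact: integrableS iRN.
  + by apply/measurable_EFinP/measurable_funTS; exact: measurable_normal_pdf.
  + by move=> A AE mA; rewrite -Radon_Nikodym_SigmaFinite.f_integral.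
Qed.

Lemma integrable_gauss_exp_sqr (k : R) : k < 1 / 2 ->
  gauss.-integrable setT (fun x => (expR (k * x ^+ 2))%:E).
Proof.
move=> k2; have m : measurable_fun setT (fun x : R => expR (k * x ^+ 2)).
  by apply: measurableT_comp => //; apply: measurable_funM => //; exact: measurable_funX.
apply/integrableP; split; first exact/measurable_EFinP.
rewrite gauss_ge0_integral//; last by apply: measurableT_comp => //; exact/measurable_EFinP.
(* The standard deviation for which [expR (k * x ^+ 2) * pdf x] is a constant multiple of a centred
   normal density. *)
pose s := (Num.sqrt (1 - 2 * k))^-1.
have k0 : 0 < 1 - 2 * k by lra.
have s0 : s != 0 by rewrite invr_neq0// gt_eqF// sqrtr_gt0.
have ps : 0 < normal_peak s by exact: normal_peak_gt0.
have -> : (\int[mu]_x (`|(expR (k * x ^+ 2))%:E| * (pdf x)%:E) =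
    \int[mu]_x ((normal_peak 1 / normal_peak s)%:E * (normal_pdf 0 s x)%:E))%E.
  apply: eq_integral => x _; rewrite gee0_abs ?lee_fin ?expR_ge0// -!EFinM; congr EFin.
  rewrite (normal_pdfE 0 (oner_neq0 R)) (normal_pdfE 0 s0) [RHS]mulrA divfK ?gt_eqF// mulrCA.
  congr (_ * _).
  rewrite /normal_fun -expRD; congr expR.
  rewrite subr0 expr1n /s exprVn sqr_sqrtr ?ltW// -[in RHS]mulr_natr invfM invrK.
  by rewrite mulr2n; field.
rewrite integralZl//; last exact: integrable_normal_pdf.
by rewrite integral_normal_pdf mule1 ltry.
Qed.

Lemma integrable_gauss_le (f : R -> R) (C k : R) : k < 1 / 2 ->
  measurable_fun setT f -> (forall x, `|f x| <= C * expR (k * x ^+ 2)) ->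
  gauss.-integrable setT (EFin \o f).
Proof.
move=> k2 mf fC.
apply: le_integrable (integrableZl measurableT C (integrable_gauss_exp_sqr k2)) => //.
  exact/measurable_EFinP.
by move=> x _ /=; rewrite lee_fin (le_trans (fC x))// ler_norm.
Qed.

Lemma gauss_integral (f : R -> R) : measurable_fun setT f ->
  gauss.-integrable setT (EFin \o f) ->
  mu.-integrable setT (fun x => (f x * pdf x)%:E) /\
  (\int[gauss]_x (f x)%:E = \int[mu]_x (f x * pdf x)%:E)%E.
Proof.
move=> mf /integrableP[_ fi].
have mfp : measurable_fun setT (fun x => (f x * pdf x)%:E).
  by apply/measurable_EFinP/measurable_funM => //; exact: measurable_normal_pdf.
have iM : mu.-integrable setT (fun x => (f x * pdf x)%:E).
  apply/integrableP; split=> //; move: fi; rewrite gauss_ge0_integral//; last first.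
    by apply: measurableT_comp => //; exact/measurable_EFinP.
  congr (_ < _)%E; apply: eq_integral => x _.
  by rewrite /= -EFinM normrM (ger0_norm (normal_pdf_ge0 _ _ _)).
split=> //; rewrite integralE [RHS]integralE.
congr (_ - _)%E; rewrite gauss_ge0_integral//.
- apply: eq_integral => x _; rewrite !funeposE -!EFin_max -EFinM.
  by rewrite maxr_pMl ?normal_pdf_ge0// mul0r.
- by apply: measurable_funepos; exact/measurable_EFinP.
- apply: eq_integral => x _; rewrite !funenegE -!EFinN -!EFin_max -EFinM.
  by rewrite maxr_pMl ?normal_pdf_ge0// mul0r mulNr.
- by apply: measurable_funeneg; exact/measurable_EFinP.
Qed.

Lemma gauss_pdfE : pdf = (fun x : R => normal_peak 1 * expR (- 2^-1 * x ^+ 2)).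
Proof.
rewrite (normal_pdfE 0 (oner_neq0 R)); apply/funext => y; congr (_ * expR _).
by rewrite subr0 expr1n mulNr -mulr_natr mul1r mulrC mulNr.
Qed.

Lemma is_derive_gauss_pdf (x : R) : is_derive x (1 : R) pdf (- x * pdf x).
Proof.
rewrite gauss_pdfE; apply: is_derive_eq.
by rewrite /GRing.scale/=; field.
Qed.

(** These are the boundary terms of integration by parts; the condition on squares covers the
    sequences [n] and [- n] together. Since [k < 1 / 2], the product decays like a Gaussian, and a
    harmonic majorant is enough. *)
Lemma gauss_pdf_tail (k C : R) (h : R -> R) : k < 1 / 2 ->
  (forall x, `|h x| <= C * expR (k * x ^+ 2)) ->
  forall u : nat -> R, (forall n, u n ^+ 2 = n%:R ^+ 2) ->
  h (u n) * pdf (u n) @[n --> \oo] --> (0 : R).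
Proof.
move=> k2 hC u un.
apply: norm_cvg0.
pose c := 1 / 2 - k; have c0 : 0 < c by rewrite /c; lra.
have C0 : 0 <= C.
  by have := hC 0; rewrite expr0n/= mulr0 expR0 mulr1; apply: le_trans.
have p0 : 0 <= normal_peak (1 : R) by exact: normal_peak_ge0.
pose K := C * normal_peak 1 * (1 + c^-1).
have H n : `|h (u n) * pdf (u n)| <= K * harmonic n.
  rewrite normrM (ger0_norm (normal_pdf_ge0 _ _ _)).
  apply: le_trans (ler_wpM2r (normal_pdf_ge0 _ _ _) (hC _)) _.
  rewrite gauss_pdfE mulrACA -expRD /K -[leRHS]mulrA.
  apply: ler_wpM2l; first exact: mulr_ge0.
  rewrite -mulrDl un (_ : k + - 2^-1 = - c); last by rewrite /c; field.
  rewrite mulNr expRN /harmonic/=.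
  have n0 : 0 <= n%:R :> R by [].
  have cn : 0 <= c * n%:R ^+ 2 by rewrite mulr_ge0 ?sqr_ge0// ltW.
  apply: (@le_trans _ _ (1 + c * n%:R ^+ 2)^-1).
    by rewrite lef_pV2 ?posrE ?expR_gt0 ?expR_ge1Dx// ltr_wpDr.
  rewrite ler_pdivlMr// mulrC ler_pdivrMr; last by rewrite ltr_wpDr.
  have nn : n%:R <= n%:R ^+ 2 :> R.
    by case: (n) => [|m]; rewrite ?expr0n// expr2 -natrM ler_nat leq_pmulr.
  have ic0 : 0 < c^-1 by rewrite invr_gt0.
  rewrite -natr1 (_ : (1 + c^-1) * (1 + c * n%:R ^+ 2) =
    1 + c * n%:R ^+ 2 + c^-1 + n%:R ^+ 2); last by field; rewrite gt_eqF.
  lra.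
apply: (@squeeze_cvgr _ _ _ _ (fun=> 0) (fun n => K * harmonic n)).
- by apply: nearW => n; rewrite normr_ge0 H.
- exact: cvg_cst.
- by rewrite -(mulr0 K); apply: cvgMr; exact: cvg_harmonic.
Qed.

(** The difference of the two integrands times [pdf] is the derivative of [f * pdf]. The fundamental
    theorem on [[- n, n]] leaves boundary terms that tend to zero, and dominated convergence handles
    the left side. *)
Lemma gauss_ibp (f f' : R -> R) (C k : R) : k < 1 / 2 ->
  (forall x : R, is_derive x (1 : R) f (f' x)) -> continuous f' ->
  (forall x, `|f x| <= C * expR (k * x ^+ 2)) ->
  (forall x, `|f' x| <= C * expR (k * x ^+ 2)) ->
  (\int[gauss]_x (x * f x) = \int[gauss]_x f' x)%R.
Proof.
move=> k2 df cf' fC f'C.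
have C0 : 0 <= C.
  by have := fC 0; rewrite expr0n/= mulr0 expR0 mulr1; apply: le_trans.
have cf : continuous f by move=> x; apply/differentiable_continuous/derivable1_diffP.
have mf : measurable_fun setT f by exact: continuous_measurable_fun.
have mf' : measurable_fun setT f' by exact: continuous_measurable_fun.
(* The extra factor [x] costs part of the exponent; the midpoint between [k] and [1 / 2] is still an
   integrable rate. *)
pose k' := (k + 1 / 2) / 2.
have k'2 : k' < 1 / 2 by rewrite /k'; lra.
pose e := k' - k; have e0 : 0 < e by rewrite /e /k'; lra.
have xfC x : `|x * f x| <= (C * (1 + e^-1)) * expR (k' * x ^+ 2).
  rewrite normrM (_ : k' = e + k); last by rewrite /e; lra.
  rewrite mulrDl expRD.
  apply: le_trans (ler_wpM2l (normr_ge0 _) (fC x)) _.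
  rewrite mulrCA -mulrA; apply: ler_wpM2l => //.
  rewrite mulrA; apply: ler_wpM2r; first exact: expR_ge0.
  have ie0 : 0 < e^-1 by rewrite invr_gt0.
  apply: le_trans (ler_wpM2l _ (expR_ge1Dx _)); last by lra.
  rewrite (_ : (1 + e^-1) * (1 + e * x ^+ 2) =
    1 + e * x ^+ 2 + e^-1 + x ^+ 2); last by field; rewrite gt_eqF.
  have := sqr_ge0 (`|x| - 1); rewrite sqrrB1 real_normK ?num_real// => h1.
  have h2 : 0 <= e * x ^+ 2 by rewrite mulr_ge0 ?sqr_ge0// ltW.
  have h3 := sqr_ge0 x; rewrite -mulr_natr in h1.
  have h4 := normr_ge0 x; lra.
have mxf : measurable_fun [set: R] (fun x : R => x * f x) by exact: measurable_funM.
have ixf := integrable_gauss_le k'2 mxf xfC.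
have if' := integrable_gauss_le k2 mf' f'C.
have [ixfp xfE] := gauss_integral mxf ixf.
have [if'p f'E] := gauss_integral mf' if'.
rewrite /Rintegral xfE f'E -!/(Rintegral _ _ _); apply/esym/subr0_eq.
rewrite -RintegralB//.
pose g x := f' x * pdf x - x * f x * pdf x.
have ig : mu.-integrable setT (EFin \o g).
  rewrite (_ : _ \o _ = (fun x => (f' x * pdf x)%:E) \- (fun x => (x * f x * pdf x)%:E))%E//.
  exact: integrableB.
have mg : measurable_fun setT (EFin \o g) by exact: measurable_int ig.
have cpdf : continuous pdf by apply: continuous_normal_pdf; exact: oner_neq0.
have cg : continuous g.
  move=> x; apply: (@cvgB _ R^o); apply: cvgM; [exact: cf'|exact: cpdf| |exact: cpdf].
  by apply: cvgM; [exact: cvg_id|exact: cf].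
pose h x := f x * pdf x.
have dh (x : R) : is_derive x (1 : R) h (g x).
  have d1 := df x; have d2 := is_derive_gauss_pdf x.
  by apply: is_derive_eq; rewrite /g /GRing.scale/=; ring.
have ch : continuous h.
  by move=> x; apply/differentiable_continuous/derivable1_diffP.
pose gn n := (EFin \o g) \_ `[- n%:R, n%:R]%classic.
have FTC n : (\int[mu]_x gn n x = (h n%:R)%:E - (h (- n%:R))%:E)%E.
  rewrite -integral_mkcond.
  have [->|n0] := eqVneq n 0%N.
    by rewrite oppr0 set_itv1 integral_set1 subee.
  rewrite (@continuous_FTC2 _ g h)//.
  - by rewrite gtrN// ltr0n lt0n.
  - exact: continuous_subspaceT.
  - split=> //.
    + by apply: cvg_at_right_filter; exact: ch.
    + by apply: cvg_at_left_filter; exact: ch.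
  - by move=> x _; rewrite derive1E; have dhx := dh x; rewrite derive_val.
suff ig0 : (\int[mu]_x (g x)%:E = 0)%E by rewrite /Rintegral ig0.
have cvg1 : (\int[mu]_x gn n x)%E @[n --> \oo] --> (\int[mu]_x (g x)%:E)%E.
  apply: (@dominated_cvg _ _ _ mu setT measurableT gn (EFin \o g) (abse \o (EFin \o g))) => //.
  - move=> n; apply/measurable_restrict => //.
    by rewrite setTI; apply: measurable_funS mg.
  - move=> x _; apply: cvg_near_cst; near=> n.
    rewrite /gn patchE ifT// inE/= in_itv/= -ler_norml.
    near: n; exact: nbhs_infty_ger.
  - exact: integrable_abse.
  - move=> n x _; rewrite /gn patchE; case: ifPn => // _.
    by rewrite abse0 abse_ge0.
have cvg2 : ((h n%:R)%:E - (h (- n%:R))%:E)%E @[n --> \oo] --> 0%E.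
  apply: cvg_EFin; first exact: nearW.
  rewrite -[X in _ --> X](subr0 0); apply: (@cvgB _ R^o).
    exact: (gauss_pdf_tail k2 fC).
  by apply: (gauss_pdf_tail k2 fC) => n; rewrite sqrrN.
move: cvg1; under eq_fun do rewrite FTC.
by move=> cvg1; apply: (cvg_unique _ cvg1 cvg2); exact: ereal_hausdorff.
Unshelve. all: by end_near. Qed.

End gaussian_line.

Lemma is_derive_under_integral {R : realType} {d} {Y : measurableType d}
    (mu : {measure set Y -> \bar R}) (f f' : R -> Y -> R) (G : Y -> R) (a u v : R) :
  u < a < v ->
  (forall x, u < x < v -> mu.-integrable setT (EFin \o f x)) ->
  (forall x y, u < x < v -> is_derive x (1 : R) (f ^~ y) (f' x y)) ->
  mu.-integrable setT (EFin \o G) ->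
  (forall x y, u < x < v -> `|f' x y| <= G y) ->
  is_derive a (1 : R) (fun x => \int[mu]_y f x y) (\int[mu]_y f' a y).
Proof.
move=> auv fi df iG Gf.
have inI x : `]u, v[%classic x <-> u < x < v by rewrite /= in_itv.
have pE x y : u < x < v -> partial1of2 f x y = f' x y.
  by move=> xuv; rewrite partial1of2E; have ? := df x y xuv; exact: derive_val.
have Ia : `]u, v[%classic a by apply/inI.
have fi' x : `]u, v[%classic x -> mu.-integrable setT (EFin \o f x).
  by move=> /inI; exact: fi.
have df' x y : `]u, v[%classic x -> setT y -> derivable (f ^~ y) x 1.
  by move=> /inI xuv _; have ? := df x y xuv; exact: ex_derive.
have Gf' x y : `]u, v[%classic x -> setT y -> `|partial1of2 f x y| <= G y.
  by move=> /inI xuv _; rewrite pE//; exact: Gf.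
have G0 y : 0 <= G y by apply: le_trans (Gf a y auv).
apply: DeriveDef.
  exact: (derivable_under_integral measurableT Ia fi' df' G0 iG Gf').
rewrite -derive1E (differentiation_under_integral measurableT Ia fi' df' G0 iG Gf').
by apply: eq_Rintegral => y _; exact: pE.
Qed.

Lemma Rintegral_prob_cst {R : realType} {d} {T : measurableType d}
    (P : probability T R) (c : R) : \int[P]_w c = c.
Proof.
transitivity (c * fine (P setT)); first exact: Rintegral_cst.
by rewrite probability_setT mulr1.
Qed.

(** * Exponential moments of squared positive parts of a Gaussian *)

Section positive_part.
Context {R : realType}.
Notation gauss := (normal_prob (0 : R) 1).

Definition pospart (x : R) : R := Num.max x 0.

Lemma pospart_ge0 x : 0 <= pospart x.
Proof. by rewrite /pospart le_max lexx orbT. Qed.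

Lemma pospart_le_norm x : pospart x <= `|x|.
Proof. by rewrite /pospart ge_max ler_norm normr_ge0. Qed.

Lemma measurable_pospart : measurable_fun setT pospart.
Proof. by apply: measurable_maxr => //; exact: measurable_id. Qed.

Lemma continuous_pospart : continuous pospart.
Proof.
move=> x; rewrite /pospart; apply: continuous_max; first exact: cvg_id.
exact: cvg_cst.
Qed.

Lemma is_derive_sqr_pospart (x : R) :
  is_derive x (1 : R) (fun y => pospart y ^+ 2) (2 * pospart x).
Proof.
have [x0|x0|->] := ltgtP x 0.
- apply: (@near_eq_is_derive _ _ _ (cst 0)).
  + near=> y; rewrite /pospart max_r ?expr0n// ltW//.
    by near: y; exact: lt_nbhsl.
  + by rewrite /pospart max_r ?ltW// mulr0; exact: is_derive_cst.
- apply: (@near_eq_is_derive _ _ _ (fun y : R => y ^+ 2)).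
  + near=> y; rewrite /pospart max_l// ltW//.
    by near: y; exact: lt_nbhsr.
  + rewrite /pospart max_l ?ltW//; apply: is_derive_eq.
    by rewrite /GRing.scale/=; ring.
- rewrite {2}/pospart maxxx mulr0; apply/is_derive1_caratheodory.
  exists pospart; split; [|exact: continuous_pospart|by rewrite /pospart maxxx].
  move=> z; rewrite /pospart maxxx expr0n subr0 subr0.
  by have [z0|z0] := ltP z 0; rewrite ?mul0r ?expr0n.
Unshelve. all: by end_near. Qed.

(** One integrable majorant for all thresholds in [[- T, T]], as differentiation under the integral
    requires. Of the gap [1 / 2 - t = 3 * e], one [e] absorbs the factor [1 + pospart (s - u)] and
    one the cross term of [(T + |u|) ^+ 2]. *)
Lemma pospart_exp_bound (t T : R) : 0 <= t -> t < 1 / 2 -> 0 <= T ->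
  exists C k, [/\ 0 <= C, 0 <= k, k < 1 / 2 & forall s u, `|s| <= T ->
    (1 + pospart (s - u)) * expR (t * pospart (s - u) ^+ 2)
      <= C * expR (k * u ^+ 2)].
Proof.
move=> t0 t2 T0.
pose e : R := (1 / 2 - t) / 3.
have e0 : 0 < e by rewrite /e; lra.
pose t' := t + e; pose k := t + 2 * e.
have t'0 : 0 < t' by rewrite /t'; lra.
have ie0 : 0 < e^-1 by rewrite invr_gt0.
exists ((2 + e^-1) * expR (t' * (1 + t' / e) * T ^+ 2)), k.
have c0 : 0 < 2 + e^-1 by lra.
split.
- by rewrite mulr_ge0 ?expR_ge0// ltW.
- by rewrite /k; lra.
- by rewrite /k /e; lra.
move=> s u sT; set p := pospart _.
have p0 : 0 <= p := pospart_ge0 _.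
have pT : p <= T + `|u|.
  apply: le_trans (pospart_le_norm _) _; apply: le_trans (ler_normB _ _) _.
  by rewrite lerD2r.
have h1 : 1 + p <= (2 + e^-1) * expR (e * p ^+ 2).
  apply: le_trans (ler_wpM2l (ltW c0) (expR_ge1Dx _)).
  rewrite (_ : (2 + e^-1) * (1 + e * p ^+ 2) =
    2 + e^-1 + 2 * e * p ^+ 2 + p ^+ 2); last by field; rewrite gt_eqF.
  have := sqr_ge0 (p - 1); rewrite sqrrB1 -mulr_natr => h.
  have : 0 <= e * p ^+ 2 by rewrite mulr_ge0 ?sqr_ge0// ltW.
  lra.
apply: le_trans (ler_wpM2r (expR_ge0 _) h1) _.
rewrite -[leLHS]mulrA -[leRHS]mulrA; apply: ler_wpM2l; first exact: ltW.
rewrite -!expRD ler_expR -mulrDl (addrC e t) -/t'.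
have p2 : p ^+ 2 <= (T + `|u|) ^+ 2 by rewrite ler_sqr ?nnegrE// (le_trans p0).
apply: le_trans (ler_wpM2l (ltW t'0) p2) _.
rewrite -(real_normK (num_real u)); set v := `|u|.
rewrite -subr_ge0 (_ : _ - _ = e^-1 * (t' * T - e * v) ^+ 2); last first.
  by rewrite /k /t'; field; rewrite gt_eqF.
by rewrite mulr_ge0 ?sqr_ge0// ltW.
Qed.

Section mgf.
Variable t : R.
Hypotheses (t0 : 0 <= t) (t2 : t < 1 / 2).
Let p (s u : R) := pospart (s - u).
Let E (s u : R) := expR (t * p s u ^+ 2).
Let M s := \int[gauss]_u E s u.

Let mp s : measurable_fun [set: R] (p s).
Proof.
apply: (measurableT_comp measurable_pospart).
by apply: measurable_funB => //; exact: measurable_id.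
Qed.

Let mE s : measurable_fun [set: R] (E s).
Proof. by apply: measurableT_comp => //; apply: measurable_funM => //; exact: measurable_funX. Qed.

Let p0 s u : 0 <= p s u. Proof. exact: pospart_ge0. Qed.

Let E1 s u : 1 <= E s u.
Proof. by rewrite -expR0 ler_expR mulr_ge0// sqr_ge0. Qed.

Lemma integrable_gauss_pospart_bound (f : R -> R) s : measurable_fun setT f ->
  (forall u, `|f u| <= (1 + p s u) * E s u) ->
  gauss.-integrable setT (EFin \o f).
Proof.
move=> mf fb; have [C [k [C0 k0 k2 H]]] := pospart_exp_bound t0 t2 (normr_ge0 s).
by apply: (integrable_gauss_le k2 mf (C := C)) => u; exact: le_trans (fb u) (H s u (lexx _)).
Qed.

Let ip s : gauss.-integrable setT (EFin \o p s).
Proof.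
apply: (@integrable_gauss_pospart_bound _ s) => // u; rewrite ger0_norm//.
by have h1 := E1 s u; have h2 := p0 s u; nra.
Qed.

Let iE s : gauss.-integrable setT (EFin \o E s).
Proof.
apply: (@integrable_gauss_pospart_bound _ s) => // u.
rewrite ger0_norm; last exact: expR_ge0.
by have h1 := E1 s u; have h2 := p0 s u; nra.
Qed.

Lemma integrable_gauss_exp_pospart s :
  gauss.-integrable setT (EFin \o (fun u => expR (t * pospart (s - u) ^+ 2))).
Proof. exact: iE. Qed.

Let ipE s : gauss.-integrable setT (EFin \o (fun u => p s u * E s u)).
Proof.
apply: (@integrable_gauss_pospart_bound _ s) => [|u]; first exact: measurable_funM.
rewrite ger0_norm; last by rewrite mulr_ge0 ?expR_ge0.
by have h1 := E1 s u; have h2 := p0 s u; nra.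
Qed.

(** The complementary positive part: [p s u = s - u + q s u], and [E s u = 1] wherever [q s u] is
    nonzero. These two facts close the Stein identity for [E]. *)
Let q (s u : R) := pospart (u - s).

Let pq s u : p s u = s - u + q s u.
Proof.
rewrite /p /q /pospart; case: (leP (s - u) 0) => h; case: (leP (u - s) 0) => h'; lra.
Qed.

Let qE s u : q s u * E s u = q s u.
Proof.
rewrite /E /q /p /pospart; case: (leP (s - u) 0) => h; last first.
  by rewrite max_r ?mul0r//; lra.
by rewrite expr0n mulr0 expR0 mulr1.
Qed.

Let iid_ : gauss.-integrable setT (EFin \o (fun u : R => u)).
Proof.
apply: (@integrable_gauss_le _ _ 4 (1/4)) => [||x]; [lra|exact: measurable_id|].
have h := expR_ge1Dx (1 / 4 * x ^+ 2).
have h2 : 4 * (1 + 1 / 4 * x ^+ 2) <= 4 * expR (1 / 4 * x ^+ 2) by lra.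
apply: le_trans h2; have := sqr_ge0 (`|x| - 1); rewrite sqrrB1 real_normK ?num_real//.
by rewrite -mulr_natr; have := sqr_ge0 x; lra.
Qed.

Let iq s : gauss.-integrable setT (EFin \o q s).
Proof.
have h : gauss.-integrable setT (EFin \o (fun u => p s u - (s - u))).
  have is_ : gauss.-integrable setT (EFin \o (fun u : R => s - u)).
    have ic : gauss.-integrable setT (EFin \o (fun _ : R => s)).
      exact: finite_measure_integrable_cst.
    exact: (integrableB _ ic iid_).
  exact: (integrableB _ (ip s) is_).
apply: eq_integrable h => // u _; congr EFin.
by rewrite pq; ring.
Qed.

Let ip2 s : gauss.-integrable setT (EFin \o (fun u => p s u ^+ 2)).
Proof.
have [|||C [k [C0 k0 k2 H]]] := @pospart_exp_bound (1 / 4) `|s|; [lra|lra|exact: normr_ge0|].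
apply: (integrable_gauss_le k2 (C := 4 * C)) => [|u]; first exact: measurable_funX.
rewrite ger0_norm ?sqr_ge0// -mulrA.
apply: le_trans (ler_wpM2l _ (H s u (lexx _))) => //.
have h := expR_ge1Dx (1 / 4 * p s u ^+ 2); have h2 := p0 s u; rewrite -/(p s u).
have h3 := mulr_ge0 h2 (expR_ge0 (1 / 4 * p s u ^+ 2)).
set e := expR _ in h h3 *; rewrite -/(p s u) in h *.
have -> : 4 * ((1 + p s u) * e) = 4 * e + 4 * (p s u * e) by ring.
lra.
Qed.

Let is_derive_E_u s (u : R) :
  is_derive u (1 : R) (E s) (- (2 * t) * (p s u * E s u)).
Proof.
have d1 : is_derive u (1 : R) (fun u => pospart (s - u) ^+ 2) (2 * p s u * (- 1)).
  apply: (@is_derive1_comp _ (fun y => pospart y ^+ 2) (fun u => s - u)).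
    exact: is_derive_sqr_pospart.
  by apply: is_derive_eq; ring.
have d2 : is_derive u (1 : R) (fun u => t * pospart (s - u) ^+ 2)
    (t * (2 * p s u * (- 1))) by exact: is_deriveZ.
by apply: is_derive_eq; rewrite /E /p/=; ring.
Qed.

Let is_derive_p2_s (s u : R) : is_derive s (1 : R) (fun s => p s u ^+ 2) (2 * p s u).
Proof.
apply: is_derive_eq.
  apply: (@is_derive1_comp _ (fun y => pospart y ^+ 2) (fun s => s - u)).
  exact: is_derive_sqr_pospart.
by rewrite /= subr0 mulr1.
Qed.

Let is_derive_E_s (s u : R) :
  is_derive s (1 : R) (E ^~ u) (2 * t * (p s u * E s u)).
Proof.
have d1 := is_derive_p2_s s u.
have d2 : is_derive s (1 : R) (fun s => t * p s u ^+ 2) (t * (2 * p s u))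
  by exact: is_deriveZ.
by apply: is_derive_eq; rewrite /E /p/=; ring.
Qed.

Let continuous_p s : continuous (p s).
Proof.
move=> u; apply: (continuous_comp (f := fun u : R => s - u)).
  by apply: (@cvgB _ R^o); [exact: cvg_cst|exact: cvg_id].
exact: continuous_pospart.
Qed.

Let mean0 : \int[gauss]_u u = 0.
Proof.
transitivity (\int[gauss]_u (u * cst 1 u)).
  by apply: eq_Rintegral => u _; rewrite /= mulr1.
have h02 : (0 : R) < 1 / 2 by lra.
rewrite (gauss_ibp (f' := cst 0) (C := 1) h02).
- by rewrite Rintegral_cst// mul0r.
- by move=> x; exact: cvg_cst.
- by move=> x; rewrite mul0r expR0 mulr1 normr1.
- by move=> x; rewrite mul0r expR0 mulr1 normr0.
Qed.

Let pE_bound s u : 2 * t * (p s u * E s u) <= (1 + p s u) * E s u.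
Proof.
have h1 := E1 s u; have h2 : 0 <= p s u * E s u by rewrite mulr_ge0 ?expR_ge0.
have t21 : 2 * t <= 1 by move: t2; lra.
have h3 := ler_wpM2r h2 t21.
by apply: le_trans h3 _; rewrite mul1r ler_wpM2r ?expR_ge0// lerDr.
Qed.

(** Integrate [p * E = s * E - u * E + q]. Integration by parts turns the mean of [u * E] into
    [- 2 * t] times the mean of [p * E], so the same moment stands on both sides, whence the factor
    [1 - 2 * t]. *)
Let stein s : (1 - 2 * t) * \int[gauss]_u (p s u * E s u) =
  s * M s + \int[gauss]_u q s u.
Proof.
have [C [k [C0 k0 k2 H]]] := pospart_exp_bound t0 t2 (normr_ge0 s).
have {}H u : (1 + p s u) * E s u <= C * expR (k * u ^+ 2) := H s u (lexx _).
have cE : continuous (E s).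
  move=> u; apply/differentiable_continuous/derivable1_diffP.
  by have ? := is_derive_E_u s u.
have ibp : \int[gauss]_u (u * E s u) =
    \int[gauss]_u (- (2 * t) * (p s u * E s u)).
  apply: (gauss_ibp (C := C) k2) => [u||u|u].
  - exact: is_derive_E_u.
  - move=> u; apply: cvgM; first exact: cvg_cst.
    by apply: cvgM; [exact: continuous_p|exact: cE].
  - apply: le_trans (H u); rewrite ger0_norm ?expR_ge0//.
    by have h1 := E1 s u; have h2 := p0 s u; nra.
  - apply: le_trans (H u); rewrite mulNr normrN ger0_norm; first exact: pE_bound.
    by rewrite mulr_ge0// mulr_ge0 ?expR_ge0.
have iuE : gauss.-integrable setT (EFin \o (fun u => u * E s u)).
  have h : gauss.-integrable setT (EFin \o (fun u => s * E s u + q s u - p s u * E s u)).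
    have i1 : gauss.-integrable setT (EFin \o (fun u => s * E s u)).
      exact: (integrableZl measurableT s (iE s)).
    exact: (integrableB _ (integrableD _ i1 (iq s)) (ipE s)).
  apply: eq_integrable h => // u _; congr EFin.
  by rewrite pq mulrDl qE; ring.
have : \int[gauss]_u (p s u * E s u) =
    s * M s - \int[gauss]_u (u * E s u) + \int[gauss]_u q s u.
  rewrite -RintegralZl// -RintegralB//; last first.
    exact: (integrableZl measurableT s (iE s)).
  rewrite -RintegralD//; last first.
    exact: (integrableB _ (integrableZl measurableT s (iE s)) iuE).
  by apply: eq_Rintegral => u _; rewrite [in LHS]pq !mulrDl mulNr qE.
by rewrite ibp RintegralZl//; set J := \int[_]_x (_ * _); set m := _ * _; lra.
Qed.

Let mean_p s : \int[gauss]_u p s u = s + \int[gauss]_u q s u.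
Proof.
have i1 : gauss.-integrable setT (EFin \o (fun _ : R => s)).
  exact: finite_measure_integrable_cst.
transitivity (\int[gauss]_u (s - u + q s u)).
  by apply: eq_Rintegral => u _; exact: pq.
rewrite RintegralD//; last exact: (integrableB _ i1 iid_).
rewrite RintegralB// mean0 subr0; congr (_ + _).
exact: Rintegral_prob_cst.
Qed.

Let M_ge1 s : 1 <= M s.
Proof.
have -> : 1 = \int[gauss]_u (cst 1 u) :> R.
  by rewrite Rintegral_prob_cst.
apply: le_Rintegral => //.
exact: finite_measure_integrable_cst.
Qed.

Let dom_s (s : R) : exists G : R -> R, gauss.-integrable setT (EFin \o G) /\
  forall s' u, s - 1 < s' < s + 1 -> (1 + p s' u) * E s' u <= G u.
Proof.
have [|C [k [C0 k0 k2 H]]] := @pospart_exp_bound t (`|s| + 1) t0 t2; first exact: addr_ge0.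
exists (fun u => C * expR (k * u ^+ 2)); split.
  exact: (integrableZl measurableT C (integrable_gauss_exp_sqr k2)).
move=> s' u /andP[h1 h2]; apply: H.
have h3 := ler_norm s; have h4 := ler_norm (- s); rewrite normrN in h4.
by rewrite ler_norml; apply/andP; split; lra.
Qed.

Let is_derive_M (s : R) : is_derive s (1 : R) M (2 * t * \int[gauss]_u (p s u * E s u)).
Proof.
have [G [iG HG]] := dom_s s.
rewrite -RintegralZl//.
apply: (@is_derive_under_integral _ _ _ gauss E
  (fun s u => 2 * t * (p s u * E s u)) G s (s - 1) (s + 1)) => //.
- by apply/andP; split; lra.
- move=> s' u hs'; apply: le_trans (HG _ u hs').
  rewrite ger0_norm; last by rewrite !mulr_ge0 ?expR_ge0.
  exact: pE_bound.
Qed.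

Let A s := \int[gauss]_u (p s u ^+ 2).

Let is_derive_A (s : R) : is_derive s (1 : R) A (2 * \int[gauss]_u p s u).
Proof.
have [G [iG HG]] := dom_s s.
rewrite -RintegralZl//.
apply: (@is_derive_under_integral _ _ _ gauss (fun s u => p s u ^+ 2)
  (fun s u => 2 * p s u) (fun u => 2 * G u) s (s - 1) (s + 1)) => //.
- by apply/andP; split; lra.
- exact: (integrableZl measurableT 2 iG).
- move=> s' u hs'; rewrite normrM !ger0_norm// ler_pM2l//.
  apply: le_trans (HG _ u hs').
  by have h1 := E1 s' u; have h2 := p0 s' u; nra.
Qed.

Let M_cvg : M (- n%:R) @[n --> \oo] --> (1 : R).
Proof.
have mn n : measurable_fun [set: R] (fun u => (E (- n%:R) u)%:E).
  by apply/measurable_EFinP; exact: mE.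
have cn u : [set: R] u -> (fun n => (E (- n%:R) u)%:E) @ \oo --> 1%:E.
  move=> _; apply: cvg_near_cst; near=> n; congr EFin.
  rewrite /E /p /pospart max_r ?expr0n ?mulr0 ?expR0//.
  rewrite subr_le0 lerNl; apply: le_trans (ler_norm _) _; rewrite normrN.
  near: n; exact: nbhs_infty_ger.
have dn n u : [set: R] u -> (`|(E (- n%:R) u)%:E| <= (expR (t * u ^+ 2))%:E)%E.
  move=> _; rewrite lee_fin ger0_norm ?expR_ge0// ler_expR ler_wpM2l//.
  rewrite -(real_normK (num_real u)) ler_sqr ?nnegrE//.
  rewrite /p /pospart ge_max normr_ge0 andbT.
  have h3 := ler_norm (- u); rewrite normrN in h3.
  have : 0 <= n%:R :> R by []. lra.
have : (\int[gauss]_u (E (- n%:R) u)%:E)%E @[n --> \oo] -->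
    (\int[gauss]_u (1 : R)%:E)%E.
  have fn u : [set: R] u -> (expR (t * u ^+ 2))%:E \is a fin_num by [].
  exact (@dominated_cvg _ _ _ gauss setT measurableT _ _ _ mn cn fn
    (integrable_gauss_exp_sqr t2) dn).
have -> : (\int[gauss]_u (1 : R)%:E = 1%:E)%E.
  by rewrite integral_cst// mul1e; exact: probability_setT.
exact: fine_cvg.
Unshelve. all: by end_near. Qed.

(* The exponential moment of [pospart (s - u) ^+ 2] is compared with its mean by
   differentiating in the threshold [s], starting from [s = -oo] where the two
   sides agree. *)
Lemma gauss_pospart_mgf s : \int[gauss]_u expR (t * pospart (s - u) ^+ 2) <=
  expR (t / (1 - 2 * t) * \int[gauss]_u (pospart (s - u) ^+ 2)).
Proof.
rewrite -/(M s) -/(A s); pose c := t / (1 - 2 * t); rewrite -/c.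
have d0 : 0 < 1 - 2 * t by rewrite subr_gt0 mulrC -ltr_pdivlMr.
have c0 : 0 <= c by rewrite divr_ge0// ltW.
(* By [stein] and [mean_p] the terms in [s * M s] cancel in the derivative of [Q]. What remains is
   [2 * c * (1 - M s)] times the mean of [q s], up to a positive factor, and it is nonpositive
   because [M s >= 1]. *)
pose Q s := M s * expR (- c * A s).
have dQ (x : R) : is_derive x (1 : R) Q (expR (- c * A x) *
    (2 * t * \int[gauss]_u (p x u * E x u) - 2 * c * M x * \int[gauss]_u p x u)).
  have h1 := is_derive_M x; have h2 := is_derive_A x.
  have h3 : is_derive x (1 : R) (fun x => - c * A x) (- c * (2 * \int[gauss]_u p x u)).
    exact: is_deriveZ.
  by apply: is_derive_eq; rewrite /GRing.scale/=; ring.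
have dQ0 x : expR (- c * A x) *
    (2 * t * \int[gauss]_u (p x u * E x u) - 2 * c * M x * \int[gauss]_u p x u) <= 0.
  apply: mulr_ge0_le0; first exact: expR_ge0.
  have tc : t = c * (1 - 2 * t) by rewrite /c divfK// gt_eqF.
  have -> : 2 * t * \int[gauss]_u (p x u * E x u) =
     2 * c * (x * M x + \int[gauss]_u q x u).
    by rewrite -stein {1}tc; ring.
  rewrite mean_p; have hM := M_ge1 x.
  have hq : 0 <= \int[gauss]_u q x u by apply: Rintegral_ge0 => u _; exact: pospart_ge0.
  have h : \int[gauss]_u q x u <= M x * \int[gauss]_u q x u by rewrite ler_peMl.
  rewrite (_ : _ - _ = - (2 * c * (M x * \int[gauss]_u q x u - \int[gauss]_u q x u))); last by ring.
  rewrite oppr_le0; apply: mulr_ge0; last by rewrite subr_ge0.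
  exact: mulr_ge0.
have Qdecr x y : x <= y -> Q y <= Q x.
  move=> xy.
  apply: (@ler0_derive1_le_cc _ Q x y); rewrite ?in_itv/= ?lexx ?xy//.
  - by move=> z _; rewrite derive1E; have ? := dQ z; rewrite derive_val.
  - by apply: derivable_within_continuous => z _; have ? := dQ z.
have A0 x : 0 <= A x by apply: Rintegral_ge0 => u _; exact: sqr_ge0.
have QM x : Q x <= M x.
  rewrite /Q ler_piMr ?(le_trans _ (M_ge1 x))// -expR0 ler_expR mulNr oppr_le0.
  exact: mulr_ge0.
have Q1 : Q s <= 1.
  apply: (cvgr_to_ge M_cvg); near=> n.
  apply: le_trans (QM _); apply: Qdecr; rewrite lerNl.
  apply: le_trans (ler_norm _) _; rewrite normrN.
  near: n; exact: nbhs_infty_ger.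
by move: Q1; rewrite /Q mulNr expRN ler_pdivrMr ?expR_gt0// mul1r.
Unshelve. all: by end_near. Qed.

End mgf.

End positive_part.

(** * Integration by parts in one coordinate of an i.i.d. family *)

Section iid_ibp.
Context {R : realType}.
Notation gauss := (normal_prob (0 : R) 1).

(** Measurability is read on tuples, where the sigma-algebra lives, while the calculus takes place
    on functions [I -> R]. *)
Definition measurable_family {I : finType} (F : (I -> R) -> R) :=
  measurable_fun [set: #|I|.-tuple R] (fun t => F (fun i => coord i t)).

Definition update {I : finType} (x : I -> R) (i : I) (y : R) (j : I) : R :=
  if j == i then y else x j.

(** A growth class that is integrable under i.i.d. normal variables, and whose sections in one
    coordinate obey the bound asked for by [gauss_ibp]. *)
Definition exp_bounded {I : finType} (C K : R) (F : (I -> R) -> R) :=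
  forall x, `|F x| <= C * expR (K * \sum_i `|x i|).

Lemma coord_vecE {T : Type} {I : finType} (X : I -> T -> R) w :
  (fun i => coord i (vec X w)) = X ^~ w.
Proof. by apply/funext => i; exact: coord_vec. Qed.

Lemma measurable_family_comp {d} {T : measurableType d} {I : finType}
    (F : (I -> R) -> R) (X : I -> T -> R) :
  measurable_family F -> (forall i, measurable_fun setT (X i)) ->
  measurable_fun setT (fun w => F (X ^~ w)).
Proof.
move=> mF mX; have mv := measurable_vec mX.
have -> : (fun w => F (X ^~ w)) = (fun t => F (fun i => coord i t)) \o vec X.
  by apply/funext => w /=; rewrite coord_vecE.
exact: measurableT_comp mF mv.
Qed.

Lemma measurable_family_coord {I : finType} (i : I) :
  measurable_family (fun x : I -> R => x i).
Proof. exact: measurable_coord. Qed.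

Lemma law_Rintegral {d d'} {T : measurableType d} {T' : measurableType d'}
    (P : probability T R) (P' : probability T' R) (I : finType)
    (X : I -> T -> R) (X' : I -> T' -> R) (F : (I -> R) -> R) :
  iid_normal P X -> iid_normal P' X' -> measurable_family F ->
  \int[P]_w F (X ^~ w) = \int[P']_w F (X' ^~ w).
Proof.
move=> iX iX' mF; rewrite /Rintegral; congr fine.
pose f (t : #|I|.-tuple R) := (F (fun i => coord i t))%:E.
have mf : measurable_fun [set: #|I|.-tuple R] f by exact/measurable_EFinP.
have -> : (\int[P]_w (F (X ^~ w))%:E = \int[P]_w (f \o vec X) w)%E.
  by apply: eq_integral => w _; rewrite /f /= coord_vecE.
have -> : (\int[P']_w (F (X' ^~ w))%:E = \int[P']_w (f \o vec X') w)%E.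
  by apply: eq_integral => w _; rewrite /f /= coord_vecE.
rewrite integralE [RHS]integralE; congr (_ - _)%E.
- rewrite (funepos_comp f (vec X)) (funepos_comp f (vec X')).
  apply: (law_ge0_integral (F := f^\+%E) iX iX') => //.
  exact: measurable_funepos.
- rewrite (funeneg_comp f (vec X)) (funeneg_comp f (vec X')).
  apply: (law_ge0_integral (F := f^\-%E) iX iX') => //.
  exact: measurable_funeneg.
Qed.

(** Expand [(K - |y| / 2) ^+ 2 >= 0]. The rate [1 / 4] lies below the critical rate [1 / 2] of
    Gaussian integrability. *)
Lemma expR_abs_le (K y : R) : expR (K * `|y|) <= expR (K ^+ 2) * expR (1 / 4 * y ^+ 2).
Proof.
rewrite -expRD ler_expR -(real_normK (num_real y)).
have := sqr_ge0 (K - `|y| / 2); set v := `|y|.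
have -> : (K - v / 2) ^+ 2 = K ^+ 2 - K * v + 1 / 4 * v ^+ 2 by field.
lra.
Qed.

Lemma measurable_exp_abs (K : R) : measurable_fun [set: R] (fun x => expR (K * `|x|)).
Proof.
apply: (measurableT_comp (@measurable_expR R)).
by apply: measurable_funM; [exact: measurable_cst|exact: normr_measurable].
Qed.

Lemma exp_abs_integral_fin (K : R) :
  (\int[gauss]_x (expR (K * `|x|))%:E < +oo)%E.
Proof.
have k2 : 1 / 4 < 1 / 2 :> R by lra.
have h : gauss.-integrable setT (EFin \o (fun x : R => expR (K * `|x|))).
  apply: (integrable_gauss_le (C := expR (K ^+ 2)) k2) => [|x].
    exact: measurable_exp_abs.
  by rewrite ger0_norm ?expR_ge0//; exact: expR_abs_le.
have := integrable_fin_num measurableT h.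
by rewrite fin_numElt => /andP[_].
Qed.

Lemma exp_bounded_integrable {d} {T : measurableType d} (P : probability T R)
    (I : finType) (X : I -> T -> R) (C K : R) (F : (I -> R) -> R) :
  iid_normal P X -> measurable_family F -> exp_bounded C K F ->
  P.-integrable setT (fun w => (F (X ^~ w))%:E).
Proof.
move=> iX mF bF.
have mX i : measurable_fun setT (X i) by have [] := iX.1 i.
pose f (x : R) := expR (K * `|x|).
have mf : measurable_fun setT f.
  exact: measurable_exp_abs.
have i1 : P.-integrable setT (fun w => (\prod_i f (X i w))%:E).
  apply/integrableP; split.
    apply/measurable_EFinP; apply: measurable_prod => i _.
    exact: measurableT_comp.
  under eq_integral.
    move=> w _; rewrite gee0_abs; last by rewrite lee_fin prodr_ge0// => i _; exact: expR_ge0.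
    over.
  rewrite (iid_prod_expectation (f := fun=> f) iX)//; last by move=> *; exact: expR_ge0.
  rewrite ltey_eq prode_fin_num// => i _; rewrite ge0_fin_numE.
    exact: exp_abs_integral_fin.
  by apply: integral_ge0 => x _; rewrite lee_fin expR_ge0.
apply: le_integrable (integrableZl measurableT C i1) => //.
  by apply/measurable_EFinP; exact: measurable_family_comp.
move=> w _ /=; rewrite lee_fin (le_trans (bF _))//.
by rewrite (le_trans _ (ler_norm _))// mulr_sumr -expR_sum.
Qed.

Lemma measurable_update_section {I : finType} (F : (I -> R) -> R) (x : I -> R) i :
  measurable_family F -> measurable_fun setT (fun y => F (update x i y)).
Proof.
move=> mF; apply: (measurable_family_comp (X := fun j y => update x i y j) mF) => j.
by rewrite /update; case: eqP => _; [exact: measurable_id|exact: measurable_cst].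
Qed.

Lemma exp_bounded_update {I : finType} (C K : R) (F : (I -> R) -> R) (x : I -> R) i :
  0 <= C -> 0 <= K -> exp_bounded C K F ->
  forall y, `|F (update x i y)| <=
    (C * expR (K * \sum_j `|x j|) * expR (K ^+ 2)) * expR (1 / 4 * y ^+ 2).
Proof.
move=> C0 K0 bF y; apply: (le_trans (bF (update x i y))).
rewrite -[leRHS]mulrA -[leRHS]mulrA ler_wpM2l//.
apply: le_trans (ler_wpM2l (expR_ge0 _) (expR_abs_le K y)).
rewrite -expRD ler_expR -mulrDr ler_wpM2l//.
rewrite (bigD1 i)//= {1}/update eqxx addrC lerD2r.
rewrite [leRHS](bigD1 i)//= ler_wpDl//.
apply: ler_sum => j ji.
by rewrite /update (negbTE ji).
Qed.

Lemma is_derive_update {I : finType} (z : I -> R) k l (y : R) :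
  is_derive y (1 : R) (fun y => update z k y l) (l == k)%:R.
Proof.
by rewrite /update; case: (l == k); [exact: is_derive_id|exact: is_derive_cst].
Qed.

(** After resampling coordinate [i] the law is a product; [gauss_ibp] holds for every frozen value
    of the other coordinates, and Fubini integrates it. *)
Lemma iid_ibp {d} {T : measurableType d} (P : probability T R)
    (I : finType) (X : I -> T -> R) (i : I) (C K : R) (F F' : (I -> R) -> R) :
  iid_normal P X -> 0 <= C -> 0 <= K ->
  measurable_family F -> measurable_family F' ->
  exp_bounded C K F -> exp_bounded C K F' ->
  (forall (x : I -> R) (y : R),
    is_derive y (1 : R) (fun y => F (update x i y)) (F' (update x i y))) ->
  (forall x : I -> R, continuous (fun y => F' (update x i y))) ->
  \int[P]_w (X i w * F (X ^~ w)) = \int[P]_w F' (X ^~ w).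
Proof.
move=> iX C0 K0 mF mF' bF bF' dF cF'.
have k2 : 1 / 4 < 1 / 2 :> R by lra.
have iY := iid_resample i iX.
set Y := (fun j w => _) in iY.
have mX j : measurable_fun setT (X j) by have [] := iX.1 j.
have mY j : measurable_fun setT (Y j) by have [] := iY.1 j.
have YE w : Y ^~ w = update (X ^~ w.1) i w.2.
  by apply/funext => j; rewrite /Y /update; case: eqP.
have mxF : measurable_family (fun x => x i * F x).
  by apply: measurable_funM => //; exact: measurable_family_coord.
have bxF : exp_bounded C (K + 1) (fun x => x i * F x).
  move=> x; rewrite normrM.
  apply: le_trans (ler_wpM2l (normr_ge0 _) (bF x)) _.
  rewrite mulrCA ler_wpM2l// mulrDl mul1r expRD mulrC ler_wpM2l ?expR_ge0//.
  apply: le_trans (expR_ge1Dx _); rewrite (bigD1 i)//= ler_wpDl// lerDl.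
  by apply: sumr_ge0.
rewrite (law_Rintegral iX iY mxF) (law_Rintegral iX iY mF').
have i1 := exp_bounded_integrable iY mxF bxF.
have i2 := exp_bounded_integrable iY mF' bF'.
rewrite /Rintegral -(integral12_prod_meas1 i1) -(integral12_prod_meas1 i2).
congr fine; apply: eq_integral => w _; rewrite /fubini_F.
pose x := X ^~ w.
have b1 := exp_bounded_update x i C0 K0 bF.
have b2 := exp_bounded_update x i C0 K0 bF'.
have := gauss_ibp k2 (dF x) (cF' x) b1 b2.
have m1 := measurable_update_section x i mF.
have m2 := measurable_update_section x i mF'.
have m3 := measurable_update_section x i mxF.
have bxF1 : 0 <= K + 1 by rewrite addr_ge0.
have i3 := integrable_gauss_le k2 m3 (exp_bounded_update x i C0 bxF1 bxF).
have i4 := integrable_gauss_le k2 m2 b2.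
rewrite /Rintegral => h.
have e1 : (\int[gauss]_y (Y i (w, y) * F (Y^~ (w, y)))%:E =
    \int[gauss]_y (y * F (update x i y))%:E)%E.
  by apply: eq_integral => y _; rewrite YE /Y eqxx.
have e2 : (\int[gauss]_y (F' (Y^~ (w, y)))%:E =
    \int[gauss]_y (F' (update x i y))%:E)%E.
  by apply: eq_integral => y _; rewrite YE.
rewrite e1 e2 -[LHS]fineK; last first.
  apply: integrable_fin_num => //.
  by apply: eq_integrable i3 => // y _; rewrite /= /update eqxx.
by rewrite h fineK// integrable_fin_num.
Qed.

End iid_ibp.

(** * Differential calculus of the smoothed norm and the soft maximum *)

Section soft_min.
Context {R : realType}.

Lemma is_derive_bigsum {I : Type} (s : seq I) (f : I -> R -> R) (df : I -> R) (y : R) :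
  (forall i, is_derive y (1 : R) (f i) (df i)) ->
  is_derive y (1 : R) (fun z => \sum_(i <- s) f i z) (\sum_(i <- s) df i).
Proof.
move=> fd; elim: s => [|i s IH].
  rewrite big_nil; have -> : (fun z : R => \sum_(i <- [::]) f i z) = cst 0.
    by apply/funext => z; rewrite big_nil.
  exact: is_derive_cst.
rewrite big_cons.
have -> : (fun z : R => \sum_(j <- i :: s) f j z) =
    f i + (fun z => \sum_(j <- s) f j z).
  by apply/funext => z; rewrite big_cons.
exact: is_deriveD.
Qed.

Variables (J : finType) (m : nat) (zeta a b : R).
Hypotheses (zeta0 : 0 < zeta) (a0 : 0 <= a) (b0 : 0 <= b).
Hypothesis J0 : (0 < #|J|)%N.
Implicit Types (V : J -> 'I_m -> R) (w : J -> R).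

(** [zeta] makes the Euclidean norm differentiable at the origin: its gradient [dirn] has norm at
    most one, and the derivatives of [dirn] carry a factor [1 / rad <= 1 / zeta]. *)
Definition rad V x := Num.sqrt (zeta ^+ 2 + \sum_i V x i ^+ 2).
Definition wgt V w x := expR (a * (w x - rad V x)).
Definition mass V w := \sum_x wgt V w x.
Definition soft V w := expR (b * ln (mass V w)).
(** Gibbs weights: up to the factor [a], the partial derivatives of [ln (mass V w)] in the values
    [w x]. *)
Definition share V w x := wgt V w x / mass V w.
Definition dirn V x i := V x i / rad V x.

Lemma rad_sqr_gt0 V x : 0 < zeta ^+ 2 + \sum_i V x i ^+ 2.
Proof. by rewrite ltr_wpDr ?exprn_gt0// sumr_ge0// => i _; exact: sqr_ge0. Qed.

Lemma rad_gt0 V x : 0 < rad V x.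
Proof. by rewrite sqrtr_gt0 rad_sqr_gt0. Qed.

Lemma rad_sqr V x : rad V x ^+ 2 = zeta ^+ 2 + \sum_i V x i ^+ 2.
Proof. by rewrite sqr_sqrtr// ltW// rad_sqr_gt0. Qed.

Lemma zeta_le_rad V x : zeta <= rad V x.
Proof.
rewrite -(ger0_norm (ltW zeta0)) -sqrtr_sqr ler_wsqrtr// lerDl.
by apply: sumr_ge0 => i _; exact: sqr_ge0.
Qed.

Lemma mass_gt0 V w : 0 < mass V w.
Proof.
have /card_gt0P[x _] := J0.
rewrite /mass (bigD1 x)//= ltr_pwDl ?expR_gt0// sumr_ge0// => y _.
exact: expR_ge0.
Qed.

Lemma share_ge0 V w x : 0 <= share V w x.
Proof. by rewrite divr_ge0 ?expR_ge0// ltW// mass_gt0. Qed.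

Lemma sum_share V w : \sum_x share V w x = 1.
Proof. by rewrite -mulr_suml divff// gt_eqF// mass_gt0. Qed.

Lemma share_le1 V w x : share V w x <= 1.
Proof.
rewrite -(sum_share V w) (bigD1 x)//= lerDl sumr_ge0// => y _.
exact: share_ge0.
Qed.

Lemma sum_dirn_sqr_le1 V x : \sum_i dirn V x i ^+ 2 <= 1.
Proof.
under eq_bigr do rewrite expr_div_n.
rewrite -mulr_suml rad_sqr ler_pdivrMr ?rad_sqr_gt0// mul1r lerDr.
exact: sqr_ge0.
Qed.

Lemma dirn_norm_le1 V x i : `|dirn V x i| <= 1.
Proof.
rewrite -sqrtr_sqr -sqrtr1 ler_wsqrtr//.
apply: le_trans (sum_dirn_sqr_le1 V x).
by rewrite (bigD1 i)//= lerDl sumr_ge0// => j _; exact: sqr_ge0.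
Qed.

Lemma dirn_dot_le1 V x y : \sum_i dirn V x i * dirn V y i <= 1.
Proof.
have h : \sum_i dirn V x i * dirn V y i <=
    \sum_i (dirn V x i ^+ 2 / 2 + dirn V y i ^+ 2 / 2).
  apply: ler_sum => i _; have := sqr_ge0 (dirn V x i - dirn V y i).
  by rewrite sqrrB -mulr_natr; lra.
apply: le_trans h _; rewrite big_split/= -!mulr_suml.
have h1 := sum_dirn_sqr_le1 V x; have h2 := sum_dirn_sqr_le1 V y.
lra.
Qed.

Section curve.
Variables (V : R -> J -> 'I_m -> R) (w : R -> J -> R).
Variables (dV : J -> 'I_m -> R) (dw : J -> R) (y : R).
Hypothesis hV : forall x i, is_derive y (1 : R) (fun z => V z x i) (dV x i).
Hypothesis hw : forall x, is_derive y (1 : R) (fun z => w z x) (dw x).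

Let drad x := \sum_i dirn (V y) x i * dV x i.
Let d x := dw x - drad x.
Let dbar := \sum_x share (V y) (w y) x * d x.

Lemma is_derive_rad x : is_derive y (1 : R) (fun z => rad (V z) x) (drad x).
Proof.
have h1 : is_derive y (1 : R) (fun z => \sum_i V z x i ^+ 2)
    (\sum_i 2 * V y x i * dV x i).
  apply: is_derive_bigsum => i; have h := hV x i.
  by apply: is_derive_eq; rewrite /GRing.scale/=; ring.
have h2 : is_derive y (1 : R) (fun z => zeta ^+ 2 + \sum_i V z x i ^+ 2)
    (\sum_i 2 * V y x i * dV x i).
  by rewrite -[X in is_derive _ _ _ X]add0r; exact: is_deriveD.
have h3 := is_derive1_sqrt (rad_sqr_gt0 (V y) x).
have := @is_derive1_comp R Num.sqrt (fun z => zeta ^+ 2 + \sum_i V z x i ^+ 2) y _ _ h3 h2.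
rewrite (_ : _ * _ = drad x)// /drad mulr_sumr; apply: eq_bigr => i _.
rewrite -/(rad (V y) x) /dirn; field.
by rewrite gt_eqF// rad_gt0.
Qed.

Lemma is_derive_wgt x : is_derive y (1 : R) (fun z => wgt (V z) (w z) x)
  (a * wgt (V y) (w y) x * d x).
Proof.
have h1 := is_derive_rad x; have h2 := hw x.
have h3 : is_derive y (1 : R) (fun z => a * (w z x - rad (V z) x)) (a * d x).
  exact: is_deriveZ.
by apply: is_derive_eq; rewrite /wgt; ring.
Qed.

Lemma is_derive_mass : is_derive y (1 : R) (fun z => mass (V z) (w z))
  (a * mass (V y) (w y) * dbar).
Proof.
have h : is_derive y (1 : R) (fun z => mass (V z) (w z))
    (\sum_x a * wgt (V y) (w y) x * d x).
  by apply: is_derive_bigsum => x; exact: is_derive_wgt.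
rewrite (_ : _ * _ = \sum_x a * wgt (V y) (w y) x * d x)//.
rewrite /dbar mulr_sumr; apply: eq_bigr => x _; rewrite /share; field.
by rewrite gt_eqF// mass_gt0.
Qed.

Lemma is_derive_soft : is_derive y (1 : R) (fun z => soft (V z) (w z))
  (a * b * soft (V y) (w y) * dbar).
Proof.
have h := is_derive_mass.
have h1 := is_derive1_ln (mass_gt0 (V y) (w y)).
have h2 := @is_derive1_comp R (@ln R) (fun z => mass (V z) (w z)) y _ _ h1 h.
have h3 : is_derive y (1 : R) (fun z => b * ln (mass (V z) (w z)))
   (b * ((mass (V y) (w y))^-1 * (a * mass (V y) (w y) * dbar))).
  exact: is_deriveZ.
apply: is_derive_eq; rewrite /soft; field.
by rewrite gt_eqF// mass_gt0.
Qed.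

Lemma is_derive_share x : is_derive y (1 : R) (fun z => share (V z) (w z) x)
  (a * share (V y) (w y) x * (d x - dbar)).
Proof.
have h1 := is_derive_wgt x; have h2 := is_derive_mass.
have m0 : mass (V y) (w y) != 0 by rewrite gt_eqF// mass_gt0.
have h3 := @is_deriveV R (fun z => mass (V z) (w z)) y _ _ m0 h2.
apply: is_derive_eq; rewrite /GRing.scale/= /share; field.
by [].
Qed.

Lemma is_derive_dirn x i : is_derive y (1 : R) (fun z => dirn (V z) x i)
  ((dV x i - dirn (V y) x i * drad x) / rad (V y) x).
Proof.
have h1 := is_derive_rad x; have h2 := hV x i.
have m0 : rad (V y) x != 0 by rewrite gt_eqF// rad_gt0.
have h3 := @is_deriveV R (fun z => rad (V z) x) y _ _ m0 h1.
apply: is_derive_eq; rewrite /GRing.scale/= /dirn; field.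
by [].
Qed.

Lemma is_derive_soft_share x : is_derive y (1 : R)
  (fun z => soft (V z) (w z) * share (V z) (w z) x)
  (soft (V y) (w y) * share (V y) (w y) x * ((a * b - a) * dbar + a * d x)).
Proof.
have h1 := is_derive_soft; have h2 := is_derive_share x.
by apply: is_derive_eq; rewrite /GRing.scale/=; ring.
Qed.

(** Up to the factor [- a * b], the product [soft * share * dirn] is the gradient of [soft] in [V].
    It multiplies a Gaussian coordinate in the derivative along the interpolation, so integration by
    parts has to differentiate it once more. *)
Lemma is_derive_soft_share_dirn x i : is_derive y (1 : R)
  (fun z => soft (V z) (w z) * share (V z) (w z) x * dirn (V z) x i)
  (soft (V y) (w y) * share (V y) (w y) x *
    (((a * b - a) * dbar + a * d x) * dirn (V y) x i +
     (dV x i - dirn (V y) x i * drad x) / rad (V y) x)).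
Proof.
have h1 := is_derive_soft_share x; have h2 := is_derive_dirn x i.
by apply: is_derive_eq; rewrite /GRing.scale/=; ring.
Qed.

End curve.
End soft_min.

(** * The Gaussian interpolation path and the sign of its drift *)

Section interpolation.
Context {R : realType}.
Variables (J : finType) (m N : nat) (zeta a b : R) (xs : J -> 'I_N -> R).
Hypotheses (zeta0 : 0 < zeta) (a0 : 0 <= a) (b0 : 0 <= b) (b1 : b <= 1).
Hypothesis J0 : (0 < #|J|)%N.
Hypothesis xs1 : forall x, \sum_j xs x j ^+ 2 = 1.

(** In this order: the entries of [A], of [h] and of [g]. *)
Definition gordon_index := (('I_m * 'I_N) + ('I_m + 'I_N))%type.
Local Notation I := gordon_index.
Implicit Types (z : I -> R) (k : I).

(** With [c = cos t] and [s = sin t], [gV] turns from [A x] into [h] while [gw] grows from [0] to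
    [<g, x>]. *)
Definition gV (c s : R) z x i :=
  c * (\sum_j z (inl (i, j)) * xs x j) + s * z (inr (inl i)).
Definition gw (s : R) z x := s * (\sum_j z (inr (inr j)) * xs x j).

(** Partial derivative in coordinate [k], constant since [gV] is linear in [z]. Sums over [k] of
    products of such coefficients are covariances of the processes. *)
Definition dgV (c s : R) k x i : R :=
  c * (\sum_j (inl (i, j) == k)%:R * xs x j) + s * (inr (inl i) == k)%:R.
Definition dgw (s : R) k x : R := s * (\sum_j (inr (inr j) == k)%:R * xs x j).

Lemma is_derive_gV c s z k x i (y : R) :
  is_derive y (1 : R) (fun y => gV c s (update z k y) x i) (dgV c s k x i).
Proof.
have h1 : is_derive y (1 : R) (fun y => \sum_j update z k y (inl (i, j)) * xs x j)
    (\sum_j (inl (i, j) == k)%:R * xs x j).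
  apply: is_derive_bigsum => j; have h := is_derive_update z k (inl (i, j)) y.
  apply: is_derive_eq.
  by rewrite /GRing.scale/= mulr0 add0r mulrC.
have h2 := is_derive_update z k (inr (inl i)) y.
have h3 : is_derive y (1 : R) (fun y => c * \sum_j update z k y (inl (i, j)) * xs x j)
   (c * \sum_j (inl (i, j) == k)%:R * xs x j) by exact: is_deriveZ.
have h4 : is_derive y (1 : R) (fun y => s * update z k y (inr (inl i)))
   (s * (inr (inl i) == k)%:R) by exact: is_deriveZ.
exact: is_deriveD.
Qed.

Lemma is_derive_gw s z k x (y : R) :
  is_derive y (1 : R) (fun y => gw s (update z k y) x) (dgw s k x).
Proof.
have h1 : is_derive y (1 : R) (fun y => \sum_j update z k y (inr (inr j)) * xs x j)
    (\sum_j (inr (inr j) == k)%:R * xs x j).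
  apply: is_derive_bigsum => j; have h := is_derive_update z k (inr (inr j)) y.
  apply: is_derive_eq.
  by rewrite /GRing.scale/= mulr0 add0r mulrC.
exact: is_deriveZ.
Qed.

Lemma is_derive_gV_angle z x i (t : R) :
  is_derive t (1 : R) (fun t => gV (cos t) (sin t) z x i) (gV (- sin t) (cos t) z x i).
Proof. by rewrite /gV; apply: is_derive_eq; rewrite /GRing.scale/=; ring. Qed.

Lemma is_derive_gw_angle z x (t : R) :
  is_derive t (1 : R) (fun t => gw (sin t) z x) (gw (cos t) z x).
Proof. by rewrite /gw; apply: is_derive_eq; rewrite /GRing.scale/=; ring. Qed.

Lemma xs_norm_le1 x j : `|xs x j| <= 1.
Proof.
rewrite -sqrtr_sqr -sqrtr1 ler_wsqrtr// -(xs1 x) (bigD1 j)//= lerDl.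
by apply: sumr_ge0 => i _; exact: sqr_ge0.
Qed.

Lemma dgV_A c s i' j x i : dgV c s (inl (i', j)) x i = (i == i')%:R * (c * xs x j).
Proof.
rewrite /dgV mulr0 addr0 (bigD1 j)//= big1 ?addr0 => [|j' j'j].
  by rewrite (inj_eq (@inl_inj _ _)) xpair_eqE eqxx andbT mulrCA.
by rewrite (inj_eq (@inl_inj _ _)) xpair_eqE (negbTE j'j) andbF mul0r.
Qed.

Lemma dgV_h c s i' x i : dgV c s (inr (inl i')) x i = (i == i')%:R * s.
Proof. by rewrite /dgV big1 ?mulr0 ?add0r 1?mulrC// => j _; rewrite mul0r. Qed.

Lemma dgV_g c s j x i : dgV c s (inr (inr j)) x i = 0.
Proof. by rewrite /dgV big1 ?mulr0 ?add0r// => j' _; rewrite mul0r. Qed.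

Lemma dgw_A s ij x : dgw s (inl ij) x = 0.
Proof. by rewrite /dgw big1 ?mulr0// => j' _; rewrite mul0r. Qed.

Lemma dgw_h s i x : dgw s (inr (inl i)) x = 0.
Proof. by rewrite /dgw big1 ?mulr0// => j' _; rewrite mul0r. Qed.

Lemma dgw_g s j x : dgw s (inr (inr j)) x = s * xs x j.
Proof.
rewrite /dgw (bigD1 j)//= big1 ?addr0 => [|j' j'j]; first by rewrite eqxx mul1r.
by rewrite (_ : _ == _ = (j' == j))// (negbTE j'j) mul0r.
Qed.

Lemma dgV_norm_le1 c s k x i : `|c| <= 1 -> `|s| <= 1 -> `|dgV c s k x i| <= 1.
Proof.
move=> c1 s1; case: k => [[i' j]|[i'|j]].
- rewrite dgV_A; case: (i == i'); rewrite ?mul0r ?normr0// mul1r normrM.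
  by rewrite mulr_ile1// xs_norm_le1.
- by rewrite dgV_h; case: (i == i'); rewrite ?mul0r ?normr0// mul1r.
- by rewrite dgV_g normr0.
Qed.

Lemma dgw_norm_le1 s k x : `|s| <= 1 -> `|dgw s k x| <= 1.
Proof.
move=> s1; case: k => [ij|[i|j]]; rewrite ?dgw_A ?dgw_h ?normr0// dgw_g normrM.
by rewrite mulr_ile1// xs_norm_le1.
Qed.

Definition gsoft c s z := soft zeta a b (gV c s z) (gw s z).
Definition gshare c s z x := share zeta a (gV c s z) (gw s z) x.
Definition gdirn c s z x i := dirn zeta (gV c s z) x i.
Definition grad c s z x := rad zeta (gV c s z) x.

Definition gdrad c s k z x := \sum_i gdirn c s z x i * dgV c s k x i.
Definition gd c s k z x := dgw s k x - gdrad c s k z x.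
Definition gdbar c s k z := \sum_x gshare c s z x * gd c s k z x.

Definition dsoft_share c s k z x := gsoft c s z * gshare c s z x *
  ((a * b - a) * gdbar c s k z + a * gd c s k z x).
Definition dsoft_share_dirn c s k z x i := gsoft c s z * gshare c s z x *
  (((a * b - a) * gdbar c s k z + a * gd c s k z x) * gdirn c s z x i +
   (dgV c s k x i - gdirn c s z x i * gdrad c s k z x) / grad c s z x).

Definition xdot x y := \sum_j xs x j * xs y j.

Lemma sum_index (f : I -> R) : \sum_k f k = \sum_i \sum_j f (inl (i, j)) +
  (\sum_i f (inr (inl i)) + \sum_j f (inr (inr j))).
Proof.
rewrite big_sumType/=; congr (_ + _); last by rewrite big_sumType.
by rewrite pair_bigA/=; apply: eq_bigr => -[].
Qed.

Lemma dgw_dot c s x y : \sum_k dgw c k x * dgw s k y = c * s * xdot x y.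
Proof.
rewrite sum_index big1 ?add0r => [|i _]; last first.
  by apply: big1 => j _; rewrite dgw_A mul0r.
rewrite big1 ?add0r => [|i _]; last by rewrite dgw_h mul0r.
by rewrite /xdot mulr_sumr; apply: eq_bigr => j _; rewrite !dgw_g; ring.
Qed.

Lemma dgw_dgV_dot c c' s' x y i : \sum_k dgw c k x * dgV c' s' k y i = 0.
Proof.
apply: big1 => -[ij|[i'|j]] _; rewrite ?dgw_A ?dgw_h ?mul0r//.
by rewrite dgV_g mulr0.
Qed.

Lemma dgV_dot c s c' s' x y i i' : \sum_k dgV c s k x i * dgV c' s' k y i' =
  (i == i')%:R * (c * c' * xdot x y + s * s').
Proof.
rewrite sum_index [X in _ + (_ + X)]big1 ?addr0 => [|j _]; last first.
  by rewrite dgV_g mul0r.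
rewrite (bigD1 i)//= [X in _ + X + _]big1 ?addr0 => [|l li]; last first.
  by apply: big1 => j _; rewrite dgV_A eq_sym (negbTE li) !mul0r.
rewrite (bigD1 i)//= [X in _ + (_ + X)]big1 ?addr0 => [|l li]; last first.
  by rewrite dgV_h eq_sym (negbTE li) !mul0r.
rewrite !dgV_h eqxx mulr1n (eq_sym i i') mulrDr; congr (_ + _); last by ring.
rewrite /xdot !mulr_sumr; apply: eq_bigr => j _.
by rewrite !dgV_A eqxx mulr1n; ring.
Qed.

Lemma gV_sum c s z x i : gV c s z x i = \sum_k dgV c s k x i * z k.
Proof.
rewrite sum_index [X in _ + (_ + X)]big1 ?addr0 => [|j _]; last first.
  by rewrite dgV_g mul0r.
rewrite (bigD1 i)//= [X in _ + X + _]big1 ?addr0 => [|l li]; last first.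
  by apply: big1 => j _; rewrite dgV_A eq_sym (negbTE li) !mul0r.
rewrite (bigD1 i)//= [X in _ + (_ + X)]big1 ?addr0 => [|l li]; last first.
  by rewrite dgV_h eq_sym (negbTE li) !mul0r.
rewrite dgV_h eqxx mul1r; congr (_ + _); rewrite mulr_sumr.
by apply: eq_bigr => j _; rewrite dgV_A eqxx mulr1n; ring.
Qed.

Lemma gw_sum s z x : gw s z x = \sum_k dgw s k x * z k.
Proof.
rewrite sum_index big1 ?add0r => [|i _]; last first.
  by apply: big1 => j _; rewrite dgw_A mul0r.
rewrite big1 ?add0r => [|i _]; last by rewrite dgw_h mul0r.
by rewrite /gw mulr_sumr; apply: eq_bigr => j _; rewrite dgw_g; ring.
Qed.

Lemma xdot_self x : xdot x x = 1.
Proof. by rewrite -(xs1 x); apply: eq_bigr => j _; rewrite expr2. Qed.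

Lemma xdot_le1 x y : xdot x y <= 1.
Proof.
have h : xdot x y <= \sum_j (xs x j ^+ 2 / 2 + xs y j ^+ 2 / 2).
  apply: ler_sum => i _; have := sqr_ge0 (xs x i - xs y i).
  by rewrite sqrrB -mulr_natr; lra.
apply: le_trans h _; rewrite big_split/= -!mulr_suml !xs1; lra.
Qed.

(** What is left after integrating by parts in every coordinate. The coefficients [dgw c] and
    [dgV (- s) c] belong to the velocity of the path, [(- sin, cos)] being the derivative of
    [(cos, sin)]. *)
Definition drift c s z :=
  \sum_x (\sum_k dgw c k x * dsoft_share c s k z x -
    \sum_i \sum_k dgV (- s) c k x i * dsoft_share_dirn c s k z x i).

Lemma dgw_gd_dot c s z x y : \sum_k dgw c k x * gd c s k z y = c * s * xdot x y.
Proof.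
under eq_bigr do rewrite /gd mulrBr.
rewrite sumrB dgw_dot /gdrad; under [X in _ - X]eq_bigr do rewrite mulr_sumr.
rewrite exchange_big/= [X in _ - X]big1 ?subr0// => i _.
under eq_bigr do rewrite mulrCA.
by rewrite -mulr_sumr dgw_dgV_dot mulr0.
Qed.

Lemma dgV_gdrad_dot c s z x y i : \sum_k dgV (- s) c k x i * gdrad c s k z y =
  gdirn c s z y i * (c * s * (1 - xdot x y)).
Proof.
rewrite /gdrad; under eq_bigr do rewrite mulr_sumr.
rewrite exchange_big/= (bigD1 i)//= [X in _ + X]big1 ?addr0 => [|l li].
  under eq_bigr do rewrite mulrCA.
  by rewrite -mulr_sumr dgV_dot eqxx mulr1n; ring.
under eq_bigr do rewrite mulrCA.
by rewrite -mulr_sumr dgV_dot eq_sym (negbTE li) mul0r mulr0.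
Qed.

Lemma dgV_gd_dot c s z x y i : \sum_k dgV (- s) c k x i * gd c s k z y =
  - gdirn c s z y i * (c * s * (1 - xdot x y)).
Proof.
under eq_bigr do rewrite /gd mulrBr.
rewrite sumrB dgV_gdrad_dot.
under eq_bigr do rewrite mulrC.
by rewrite dgw_dgV_dot sub0r mulNr.
Qed.

Lemma dgw_gdbar_dot c s z x : \sum_k dgw c k x * gdbar c s k z =
  \sum_y gshare c s z y * (c * s * xdot x y).
Proof.
rewrite /gdbar; under eq_bigr do rewrite mulr_sumr.
rewrite exchange_big/=; apply: eq_bigr => y _.
under eq_bigr do rewrite mulrCA.
by rewrite -mulr_sumr dgw_gd_dot.
Qed.

Lemma dgV_gdbar_dot c s z x i : \sum_k dgV (- s) c k x i * gdbar c s k z =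
  \sum_y gshare c s z y * (- gdirn c s z y i * (c * s * (1 - xdot x y))).
Proof.
rewrite /gdbar; under eq_bigr do rewrite mulr_sumr.
rewrite exchange_big/=; apply: eq_bigr => y _.
under eq_bigr do rewrite mulrCA.
by rewrite -mulr_sumr dgV_gd_dot.
Qed.

(** The covariance between velocity and position of [V] is [c * s * (1 - xdot x y)], which vanishes
    for [x = y] because the points are unit vectors. This kills every term containing the second
    derivative of the norm, and with it the factors [1 / grad]. *)
Lemma driftE c s z : drift c s z = c * s * \sum_x gsoft c s z * gshare c s z x *
  (a + (a * b - a) * \sum_y gshare c s z y * (xdot x y +
    (1 - xdot x y) * \sum_i gdirn c s z x i * gdirn c s z y i)).
Proof.
rewrite /drift mulr_sumr; apply: eq_bigr => x _.
set G := gsoft c s z * gshare c s z x.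
have -> : \sum_k dgw c k x * dsoft_share c s k z x =
    G * ((a * b - a) * (\sum_y gshare c s z y * (c * s * xdot x y)) + a * (c * s)).
  rewrite -dgw_gdbar_dot -[c * s](mulr1) -(xdot_self x) -(dgw_gd_dot c s z x x).
  rewrite !mulr_sumr -big_split/= mulr_sumr; apply: eq_bigr => k _.
  by rewrite /dsoft_share -/G; ring.
have -> : \sum_i \sum_k dgV (- s) c k x i * dsoft_share_dirn c s k z x i =
    \sum_i G * ((a * b - a) * (\sum_y gshare c s z y *
      (- gdirn c s z y i * (c * s * (1 - xdot x y)))) * gdirn c s z x i).
  apply: eq_bigr => i _; rewrite -dgV_gdbar_dot.
  have e1 : \sum_k dgV (- s) c k x i * gd c s k z x = 0.
    by rewrite dgV_gd_dot xdot_self subrr mulr0 mulr0.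
  have e2 : \sum_k dgV (- s) c k x i * gdrad c s k z x = 0.
    by rewrite dgV_gdrad_dot xdot_self subrr mulr0 mulr0.
  have e3 : \sum_k dgV (- s) c k x i * dgV c s k x i = 0.
    by rewrite dgV_dot eqxx mulr1n xdot_self; ring.
  transitivity (G * ((a * b - a) * (\sum_k dgV (- s) c k x i * gdbar c s k z) *
    gdirn c s z x i + a * gdirn c s z x i * (\sum_k dgV (- s) c k x i * gd c s k z x) +
    (\sum_k dgV (- s) c k x i * dgV c s k x i) / grad c s z x -
    gdirn c s z x i / grad c s z x * (\sum_k dgV (- s) c k x i * gdrad c s k z x))).
    rewrite !(mulr_sumr, mulr_suml) -!big_split/= -sumrB mulr_sumr.
    apply: eq_bigr => k _; rewrite /dsoft_share_dirn -/G; ring.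
  by rewrite e1 e2 e3; ring.
rewrite -mulr_sumr -mulrBr [RHS]mulrCA; congr (_ * _).
have -> : \sum_i (a * b - a) * (\sum_y gshare c s z y *
      (- gdirn c s z y i * (c * s * (1 - xdot x y)))) * gdirn c s z x i =
   - (a * b - a) * (c * s) * \sum_y gshare c s z y * ((1 - xdot x y) *
     \sum_i gdirn c s z x i * gdirn c s z y i).
  rewrite mulr_sumr; under [RHS]eq_bigr do rewrite !mulr_sumr.
  rewrite exchange_big/=; apply: eq_bigr => i _.
  rewrite mulr_sumr mulr_suml; apply: eq_bigr => y _; ring.
have -> : \sum_y gshare c s z y * (c * s * xdot x y) =
    c * s * \sum_y gshare c s z y * xdot x y.
  by rewrite mulr_sumr; apply: eq_bigr => y _; ring.
under [in RHS]eq_bigr do rewrite mulrDr.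
by rewrite big_split/=; ring.
Qed.

(** Write [n_x] for [gdirn] at [x]. The average over [y] in [driftE] is at most [1], because its
    terms are [1 - (1 - xdot x y) * (1 - <n_x, n_y>)]. Its coefficient [a * b - a] is nonpositive as
    [b <= 1], so replacing the average by [1] leaves exactly [a * b]. *)
Lemma drift_ge c s z : 0 <= c -> 0 <= s ->
  c * s * (a * b * gsoft c s z) <= drift c s z.
Proof.
move=> c0 s0; rewrite driftE ler_wpM2l ?mulr_ge0//.
have p0 x : 0 <= gshare c s z x by exact: share_ge0.
have -> : a * b * gsoft c s z = \sum_x gsoft c s z * gshare c s z x * (a * b).
  by rewrite -mulr_suml -mulr_sumr sum_share//; ring.
apply: ler_sum => x _; apply: ler_wpM2l.
  by rewrite mulr_ge0// expR_ge0.
set S := \sum_y _.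
have S1 : S <= 1.
  rewrite -(sum_share zeta a J0 (gV c s z) (gw s z)); apply: ler_sum => y _.
  rewrite ler_piMr//.
  have h1 := xdot_le1 x y; have h2 := dirn_dot_le1 zeta0 (gV c s z) x y.
  rewrite -/(gdirn _ _ _ _ _) in h2.
  have : (1 - xdot x y) * (\sum_i gdirn c s z x i * gdirn c s z y i) <= (1 - xdot x y) * 1.
    by rewrite ler_wpM2l// subr_ge0.
  lra.
have h : 0 <= (a - a * b) * (1 - S).
  by rewrite mulr_ge0 ?subr_ge0// ler_piMr.
rewrite -subr_ge0 (_ : _ - _ = (a - a * b) * (1 - S))//; ring.
Qed.

Section along_coordinate.
Variables (c s : R) (k : I) (z : I -> R).
Let dV x i (y : R) := is_derive_gV c s z k x i y.
Let dw x (y : R) := is_derive_gw s z k x y.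

Lemma is_derive_gsoft_share x (y : R) :
  is_derive y (1 : R) (fun y => gsoft c s (update z k y) * gshare c s (update z k y) x)
    (dsoft_share c s k (update z k y) x).
Proof.
by have := is_derive_soft_share a b zeta0 J0 (fun x i => dV x i y) (fun x => dw x y) x.
Qed.

Lemma is_derive_gsoft_share_dirn x i (y : R) :
  is_derive y (1 : R) (fun y => gsoft c s (update z k y) *
    gshare c s (update z k y) x * gdirn c s (update z k y) x i)
    (dsoft_share_dirn c s k (update z k y) x i).
Proof.
by have := is_derive_soft_share_dirn a b zeta0 J0 (fun x i => dV x i y) (fun x => dw x y) x i.
Qed.

Lemma cont_of_derive (f df : R -> R) :
  (forall y, is_derive y (1 : R) f (df y)) -> continuous f.
Proof.
move=> fd y; apply/differentiable_continuous/derivable1_diffP.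
by have ? := fd y.
Qed.

Lemma cont_sum (K : Type) (r : seq K) (f : K -> R -> R) :
  (forall i, continuous (f i)) -> continuous (fun y => \sum_(i <- r) f i y).
Proof.
move=> cf; elim: r => [|i r IH] y.
  by under eq_fun do rewrite big_nil; exact: cvg_cst.
rewrite (_ : (fun y : R => _) = (fun y => f i y + \sum_(j <- r) f j y)); last first.
  by apply/funext => u; rewrite big_cons.
by apply: (@cvgD _ R^o); [exact: cf|exact: IH].
Qed.

Let c_soft : continuous (fun y => gsoft c s (update z k y)).
Proof.
apply: cont_of_derive => y.
exact: (is_derive_soft a b zeta0 J0 (fun x i => dV x i y) (fun x => dw x y)).
Qed.

Let c_share x : continuous (fun y => gshare c s (update z k y) x).
Proof.
apply: cont_of_derive => y.
exact: (is_derive_share a zeta0 J0 (fun x i => dV x i y) (fun x => dw x y) x).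
Qed.

Let c_dirn x i : continuous (fun y => gdirn c s (update z k y) x i).
Proof.
apply: cont_of_derive => y.
exact: (is_derive_dirn zeta0 (fun x i => dV x i y) x i).
Qed.

Let c_rad x : continuous (fun y => (grad c s (update z k y) x)^-1).
Proof.
move=> y; apply: cvgV; first by rewrite gt_eqF// rad_gt0.
move: y; apply: cont_of_derive => y.
exact: (is_derive_rad zeta0 (fun x i => dV x i y) x).
Qed.

Let c_drad x : continuous (fun y => gdrad c s k (update z k y) x).
Proof.
apply: cont_sum => i y; apply: cvgM; [exact: c_dirn|exact: cvg_cst].
Qed.

Let c_d x : continuous (fun y => gd c s k (update z k y) x).
Proof.
by move=> y; apply: (@cvgB _ R^o); [exact: cvg_cst|exact: c_drad].
Qed.

Let c_dbar : continuous (fun y => gdbar c s k (update z k y)).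
Proof.
apply: cont_sum => x y; apply: cvgM; [exact: c_share|exact: c_d].
Qed.

Let c_lin x : continuous (fun y => (a * b - a) * gdbar c s k (update z k y) +
  a * gd c s k (update z k y) x).
Proof.
move=> y; apply: (@cvgD _ R^o); apply: cvgM; try exact: cvg_cst.
  exact: c_dbar.
exact: c_d.
Qed.

Let c_ss x : continuous (fun y => gsoft c s (update z k y) * gshare c s (update z k y) x).
Proof. by move=> y; apply: cvgM; [exact: c_soft|exact: c_share]. Qed.

Lemma continuous_dsoft_share x :
  continuous (fun y => dsoft_share c s k (update z k y) x).
Proof. by move=> y; apply: cvgM; [exact: c_ss|exact: c_lin]. Qed.

Lemma continuous_dsoft_share_dirn x i :
  continuous (fun y => dsoft_share_dirn c s k (update z k y) x i).
Proof.
move=> y; apply: cvgM; first exact: c_ss.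
apply: (@cvgD _ R^o).
  by apply: cvgM; [exact: c_lin|exact: c_dirn].
apply: cvgM; last exact: c_rad.
apply: (@cvgB _ R^o); first exact: cvg_cst.
by apply: cvgM; [exact: c_dirn|exact: c_drad].
Qed.

End along_coordinate.
End interpolation.

Lemma measurable_inv_ge0 {R : realType} {d} {T : measurableType d} (f : T -> R) :
  measurable_fun setT f -> (forall t, 0 <= f t) ->
  measurable_fun setT (fun t => (f t)^-1).
Proof.
move=> mf f0; have -> : (fun t => (f t)^-1) = (@powR R ^~ (-1)) \o f.
  by apply/funext => t /=; rewrite powR_inv1.
by apply: measurableT_comp => //; exact: measurable_powR.
Qed.

Lemma measurable_sqrt {R : realType} {d} {T : measurableType d} (f : T -> R) :
  measurable_fun setT f -> measurable_fun setT (fun t => Num.sqrt (f t)).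
Proof.
move=> mf; apply: (measurableT_comp (f := @Num.sqrt R)) => //.
by apply: continuous_measurable_fun; exact: sqrt_continuous.
Qed.

(** * Measurability and growth of the interpolated functionals *)

Section gordon.
Context {R : realType}.
Variables (J : finType) (m N : nat) (zeta a b : R) (xs : J -> 'I_N -> R).
Hypotheses (zeta0 : 0 < zeta) (a0 : 0 <= a) (b0 : 0 <= b) (b1 : b <= 1).
Hypothesis J0 : (0 < #|J|)%N.
Hypothesis xs1 : forall x, \sum_j xs x j ^+ 2 = 1.
Local Notation I := (gordon_index m N).
Implicit Types (z : I -> R) (k : I).
Local Notation gV := (gV xs).
Local Notation gw := (gw xs).
Local Notation gsoft := (gsoft zeta a b xs).
Local Notation gshare := (gshare zeta a xs).
Local Notation gdirn := (gdirn zeta xs).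
Local Notation grad := (grad zeta xs).

Section measurability.
Variables c s : R.

Let mz k : measurable_family (fun z => z k).
Proof. exact: measurable_family_coord. Qed.

Lemma measurable_gV x i : measurable_family (fun z => gV c s z x i).
Proof.
apply: measurable_funD; apply: measurable_funM => //.
  by apply: measurable_sum => j; apply: measurable_funM => //; exact: mz.
exact: mz.
Qed.

Lemma measurable_gw x : measurable_family (fun z => gw s z x).
Proof.
apply: measurable_funM => //.
by apply: measurable_sum => j; apply: measurable_funM => //; exact: mz.
Qed.

Lemma measurable_grad x : measurable_family (fun z => grad c s z x).
Proof.
apply: measurable_sqrt; apply: measurable_funD => //.
by apply: measurable_sum => i; apply: measurable_funX; exact: measurable_gV.
Qed.

Lemma measurable_gwgt x : measurable_family (fun z => wgt zeta a (gV c s z) (gw s z) x).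
Proof.
apply: (measurableT_comp (@measurable_expR R)); apply: measurable_funM => //.
by apply: measurable_funB; [exact: measurable_gw|exact: measurable_grad].
Qed.

Lemma measurable_gmass : measurable_family (fun z => mass zeta a (gV c s z) (gw s z)).
Proof. by apply: measurable_sum => x; exact: measurable_gwgt. Qed.

Lemma measurable_gsoft : measurable_family (fun z => gsoft c s z).
Proof.
apply: (measurableT_comp (@measurable_expR R)); apply: measurable_funM => //.
by apply: (measurableT_comp (@measurable_ln R)); exact: measurable_gmass.
Qed.

Lemma measurable_gshare x : measurable_family (fun z => gshare c s z x).
Proof.
apply: measurable_funM; first exact: measurable_gwgt.
by apply: measurable_inv_ge0 => [|t]; [exact: measurable_gmass|rewrite ltW// mass_gt0].
Qed.

Lemma measurable_gradV x : measurable_family (fun z => (grad c s z x)^-1).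
Proof.
by apply: measurable_inv_ge0 => [|t]; [exact: measurable_grad|exact: sqrtr_ge0].
Qed.

Lemma measurable_gdirn x i : measurable_family (fun z => gdirn c s z x i).
Proof. by apply: measurable_funM; [exact: measurable_gV|exact: measurable_gradV]. Qed.

Lemma measurable_gdrad k x : measurable_family (fun z => gdrad zeta xs c s k z x).
Proof.
by apply: measurable_sum => i; apply: measurable_funM => //; exact: measurable_gdirn.
Qed.

Lemma measurable_gd k x : measurable_family (fun z => gd zeta xs c s k z x).
Proof. by apply: measurable_funB => //; exact: measurable_gdrad. Qed.

Lemma measurable_gdbar k : measurable_family (fun z => gdbar zeta a xs c s k z).
Proof.
apply: measurable_sum => x; apply: measurable_funM; first exact: measurable_gshare.
exact: measurable_gd.
Qed.

Lemma measurable_soft_share x :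
  measurable_family (fun z => gsoft c s z * gshare c s z x).
Proof. by apply: measurable_funM; [exact: measurable_gsoft|exact: measurable_gshare]. Qed.

Lemma measurable_dsoft_share k x :
  measurable_family (fun z => dsoft_share zeta a b xs c s k z x).
Proof.
apply: measurable_funM; first exact: measurable_soft_share.
apply: measurable_funD; apply: measurable_funM => //.
  exact: measurable_gdbar.
exact: measurable_gd.
Qed.

Lemma measurable_dsoft_share_dirn k x i :
  measurable_family (fun z => dsoft_share_dirn zeta a b xs c s k z x i).
Proof.
apply: measurable_funM; first exact: measurable_soft_share.
apply: measurable_funD; apply: measurable_funM.
- apply: measurable_funD; apply: measurable_funM => //.
    exact: measurable_gdbar.
  exact: measurable_gd.
- exact: measurable_gdirn.
- apply: measurable_funB => //; apply: measurable_funM; first exact: measurable_gdirn.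
  exact: measurable_gdrad.
- exact: measurable_gradV.
Qed.

End measurability.

Section bounds.
Variables c s : R.
Hypotheses (c1 : `|c| <= 1) (s1 : `|s| <= 1).

Let C0 := expR (b * ln #|J|%:R).

(** All coefficients [dgw] are at most one in absolute value, so every exponent is at most [a] times
    the sum of the [|z k|]. Summing over the net costs [#|J|], whose power [b] is [C0]. *)
Lemma gsoft_bound z : gsoft c s z <= C0 * expR (a * b * \sum_k `|z k|).
Proof.
have w1 x : gw s z x <= \sum_k `|z k|.
  apply: le_trans (ler_norm _) _; rewrite (gw_sum xs s z x).
  apply: le_trans (ler_norm_sum _ _ _) _; apply: ler_sum => k _.
  by rewrite normrM ler_piMl// dgw_norm_le1.
have S1 : mass zeta a (gV c s z) (gw s z) <= #|J|%:R * expR (a * \sum_k `|z k|).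
  rewrite mulr_natl -sumr_const; apply: ler_sum => x _.
  rewrite ler_expR ler_wpM2l//; apply: le_trans (w1 x).
  by rewrite gerBl sqrtr_ge0.
rewrite /gsoft /soft -expRD ler_expR mulrAC [a * _ * b]mulrC -mulrDr ler_wpM2l//.
have n0 : 0 < #|J|%:R :> R by rewrite ltr0n.
rewrite -[X in _ + X]expRK -lnM ?posrE ?expR_gt0// ler_ln ?posrE ?mass_gt0//.
by rewrite mulr_gt0 ?expR_gt0.
Qed.

Let nd x i z : `|gdirn c s z x i| <= 1. Proof. exact: dirn_norm_le1. Qed.

Let p0 x z : 0 <= gshare c s z x. Proof. exact: share_ge0. Qed.

Let p1 x z : gshare c s z x <= 1. Proof. exact: share_le1. Qed.

Let g0 z : 0 <= gsoft c s z. Proof. exact: expR_ge0. Qed.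

Let drad_le k z x : `|gdrad zeta xs c s k z x| <= m%:R.
Proof.
apply: le_trans (ler_norm_sum _ _ _) _.
have -> : m%:R = \sum_(i < m) (1 : R) by rewrite sumr_const card_ord.
by apply: ler_sum => i _; rewrite normrM mulr_ile1// dgV_norm_le1.
Qed.

Let d_le k z x : `|gd zeta xs c s k z x| <= 1 + m%:R.
Proof. by apply: le_trans (ler_normB _ _) _; rewrite lerD// dgw_norm_le1. Qed.

Let dbar_le k z : `|gdbar zeta a xs c s k z| <= 1 + m%:R.
Proof.
apply: le_trans (ler_norm_sum _ _ _) _.
have -> : 1 + m%:R = \sum_x gshare c s z x * (1 + m%:R).
  by rewrite -mulr_suml sum_share// mul1r.
apply: ler_sum => x _; rewrite normrM ger0_norm; last exact: share_ge0.
by apply: ler_wpM2l; [exact: p0|exact: d_le].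
Qed.

Let lin_le k z x : `|(a * b - a) * gdbar zeta a xs c s k z + a * gd zeta xs c s k z x|
  <= 2 * a * (1 + m%:R).
Proof.
have m0 : 0 <= m%:R :> R by [].
apply: le_trans (ler_normD _ _) _; rewrite !normrM.
have h1 : `|a * b - a| <= a.
  have ab0 := mulr_ge0 a0 b0; have ab1 : a * b <= a by rewrite ler_piMr.
  by rewrite ler_norml; apply/andP; split; lra.
rewrite (_ : 2 * a * (1 + m%:R) = a * (1 + m%:R) + a * (1 + m%:R)); last by ring.
apply: lerD; apply: ler_pM => //.
by rewrite ger0_norm.
Qed.

(** One constant for all integrands: the first summand controls the derivatives of [soft * share],
    the second those of [dirn], and the last the factors bounded by one. *)
Definition gordon_cst := C0 * (2 * a * (1 + m%:R) + (1 + m%:R) / zeta + 1).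

Let cst_ge : 0 <= 2 * a * (1 + m%:R) + (1 + m%:R) / zeta + 1 :> R.
Proof.
have m0 : 0 <= m%:R :> R by [].
by rewrite !addr_ge0// ?mulr_ge0// ?addr_ge0// ?invr_ge0 ltW.
Qed.

Lemma gordon_cst_ge0 : 0 <= gordon_cst.
Proof. by rewrite mulr_ge0 ?expR_ge0. Qed.

Let bound_gen z f : `|f| <= 2 * a * (1 + m%:R) + (1 + m%:R) / zeta + 1 ->
  forall x, `|gsoft c s z * gshare c s z x * f| <=
    gordon_cst * expR (a * b * \sum_k `|z k|).
Proof.
move=> fb x; rewrite normrM.
have gs0 : 0 <= gsoft c s z * gshare c s z x by apply: mulr_ge0.
rewrite (ger0_norm gs0) /gordon_cst [leRHS]mulrAC; apply: ler_pM => //.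
apply: le_trans (gsoft_bound z).
by rewrite ler_piMr.
Qed.

Lemma soft_share_bound x :
  exp_bounded gordon_cst (a * b) (fun z => gsoft c s z * gshare c s z x).
Proof.
move=> z; rewrite -[X in `|X|]mulr1; apply: bound_gen; rewrite normr1.
have m0 : 0 <= m%:R :> R by [].
by rewrite lerDr addr_ge0// ?mulr_ge0// ?addr_ge0// ?invr_ge0 ltW.
Qed.

Lemma gsoft_exp_bounded : exp_bounded gordon_cst (a * b) (fun z => gsoft c s z).
Proof.
move=> z; rewrite ger0_norm//; apply: le_trans (gsoft_bound z) _.
rewrite ler_wpM2r ?expR_ge0// ler_peMr ?expR_ge0// lerDr.
have m0 : 0 <= m%:R :> R by [].
by rewrite addr_ge0// ?mulr_ge0// ?addr_ge0// ?invr_ge0 ltW.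
Qed.

Lemma soft_share_dirn_bound x i :
  exp_bounded gordon_cst (a * b)
    (fun z => gsoft c s z * gshare c s z x * gdirn c s z x i).
Proof.
move=> z; apply: bound_gen; apply: le_trans (nd x i z) _.
have m0 : 0 <= m%:R :> R by [].
by rewrite lerDr addr_ge0// ?mulr_ge0// ?addr_ge0// ?invr_ge0 ltW.
Qed.

Lemma dsoft_share_bound k x :
  exp_bounded gordon_cst (a * b) (fun z => dsoft_share zeta a b xs c s k z x).
Proof.
move=> z; apply: bound_gen; apply: le_trans (lin_le k z x) _.
have m0 : 0 <= m%:R :> R by [].
by rewrite -addrA lerDl addr_ge0// ?mulr_ge0// ?addr_ge0// ?invr_ge0 ltW.
Qed.

Lemma dsoft_share_dirn_bound k x i :
  exp_bounded gordon_cst (a * b) (fun z => dsoft_share_dirn zeta a b xs c s k z x i).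
Proof.
move=> z; apply: bound_gen; apply: le_trans (ler_normD _ _) _.
rewrite -[leLHS]addr0; apply: lerD => //; apply: lerD; rewrite normrM.
  by rewrite -[leRHS]mulr1; apply: ler_pM.
have m0 : 0 <= m%:R :> R by [].
apply: ler_pM => //.
  apply: le_trans (ler_normB _ _) _; apply: lerD; first exact: dgV_norm_le1.
  by rewrite normrM -[leRHS]mul1r; apply: ler_pM.
rewrite normfV ger0_norm ?sqrtr_ge0// lef_pV2 ?posrE ?rad_gt0//.
exact: zeta_le_rad.
Qed.

End bounds.
End gordon.

Lemma Rintegral_bigsum {R : realType} {d} {T : measurableType d}
    (mu : {measure set T -> \bar R}) {K : Type} (r : seq K) (f : K -> T -> R) :
  (forall k, mu.-integrable setT (EFin \o f k)) ->
  mu.-integrable setT (EFin \o (fun w => \sum_(k <- r) f k w)) /\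
  \int[mu]_w (\sum_(k <- r) f k w) = \sum_(k <- r) \int[mu]_w f k w.
Proof.
move=> fi; elim: r => [|k r [IH1 IH2]].
  have e : (fun w : T => \sum_(k <- [::]) f k w) = cst 0.
    by apply/funext => w; rewrite big_nil.
  rewrite e big_nil; split; first exact: integrable0.
  by rewrite /Rintegral integral0.
have e : (fun w : T => \sum_(j <- k :: r) f j w) =
    (fun w => f k w + \sum_(j <- r) f j w).
  by apply/funext => w; rewrite big_cons.
rewrite e big_cons -IH2; split.
  exact: (integrableD _ (fi k) IH1).
by rewrite RintegralD.
Qed.

(** * The comparison inequality along the path *)

Section gordon_comparison.
Context {R : realType}.
Variables (J : finType) (m N : nat) (zeta a b : R) (xs : J -> 'I_N -> R).
Hypotheses (zeta0 : 0 < zeta) (a0 : 0 <= a) (b0 : 0 <= b) (b1 : b <= 1).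
Hypothesis J0 : (0 < #|J|)%N.
Hypothesis xs1 : forall x, \sum_j xs x j ^+ 2 = 1.
Local Notation I := (gordon_index m N).
Implicit Types (z : I -> R) (k : I).
Local Notation gV := (gV xs).
Local Notation gw := (gw xs).
Local Notation gsoft := (gsoft zeta a b xs).
Local Notation gshare := (gshare zeta a xs).
Local Notation gdirn := (gdirn zeta xs).
Local Notation drift := (drift zeta a b xs).
Local Notation C := (gordon_cst J m zeta a b).

Variables (d : measure_display) (T : measurableType d) (P : probability T R)
  (Z : I -> T -> R).
Hypothesis iZ : iid_normal P Z.

Let C_ge0 : 0 <= C. Proof. exact: gordon_cst_ge0. Qed.
Let K_ge0 : 0 <= a * b. Proof. exact: mulr_ge0. Qed.

Let dangle c s z := a * b * gsoft c s z * \sum_x gshare c s z x *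
  (gw c z x - \sum_i gdirn c s z x i * gV (- s) c z x i).

Let is_derive_angle z (t : R) :
  is_derive t (1 : R) (fun t => gsoft (cos t) (sin t) z) (dangle (cos t) (sin t) z).
Proof.
apply: (@is_derive_soft _ _ _ zeta a b zeta0 J0 (fun t x i => gV (cos t) (sin t) z x i)
  (fun t x => gw (sin t) z x)) => [x i|x].
  exact: is_derive_gV_angle.
exact: is_derive_gw_angle.
Qed.

Section fixed_angle.
Variables c s : R.
Hypotheses (c1 : `|c| <= 1) (s1 : `|s| <= 1).

Let mZ k : measurable_family (fun z => z k).
Proof. exact: measurable_family_coord. Qed.

Lemma coord_exp_bounded k F : exp_bounded C (a * b) F ->
  exp_bounded C (a * b + 1) (fun z => z k * F z).
Proof.
move=> bF z; rewrite normrM.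
apply: le_trans (ler_wpM2l (normr_ge0 _) (bF z)) _.
rewrite mulrCA ler_wpM2l// mulrDl mul1r expRD mulrC ler_wpM2l ?expR_ge0//.
apply: le_trans (expR_ge1Dx _); rewrite (bigD1 k)//= ler_wpDl// lerDl.
by apply: sumr_ge0.
Qed.

Let gradient_term c s z := \sum_x (\sum_k dgw xs c k x * (z k * (gsoft c s z * gshare c s z x)) -
  \sum_i \sum_k dgV xs (- s) c k x i * (z k * (gsoft c s z * gshare c s z x * gdirn c s z x i))).

Lemma dangleE z : dangle c s z = a * b * gradient_term c s z.
Proof.
rewrite /dangle -mulrA; congr (_ * _); rewrite mulr_sumr; apply: eq_bigr => x _.
rewrite mulrA mulrBr; congr (_ - _).
  by rewrite gw_sum// mulr_sumr; apply: eq_bigr => k _; ring.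
rewrite mulr_sumr; apply: eq_bigr => i _.
by rewrite gV_sum mulrA mulr_sumr; apply: eq_bigr => k _; ring.
Qed.

Let linear_expectation (F : I -> J -> T -> R) (G : I -> J -> 'I_m -> T -> R)
    (u : I -> J -> R) (v : I -> J -> 'I_m -> R) :
  (forall k x, P.-integrable setT (EFin \o F k x)) ->
  (forall k x i, P.-integrable setT (EFin \o G k x i)) ->
  P.-integrable setT (EFin \o (fun w => \sum_x (\sum_k u k x * F k x w -
      \sum_i \sum_k v k x i * G k x i w))) /\
  \int[P]_w (\sum_x (\sum_k u k x * F k x w - \sum_i \sum_k v k x i * G k x i w)) =
  \sum_x (\sum_k u k x * \int[P]_w F k x w - \sum_i \sum_k v k x i * \int[P]_w G k x i w).
Proof.
move=> iF iG.
have iuF k x : P.-integrable setT (EFin \o (fun w => u k x * F k x w)).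
  exact: (integrableZl measurableT (u k x) (iF k x)).
have ivG k x i : P.-integrable setT (EFin \o (fun w => v k x i * G k x i w)).
  exact: (integrableZl measurableT (v k x i) (iG k x i)).
have A1 x := Rintegral_bigsum (index_enum I) (fun k => iuF k x).
have A2 x i := Rintegral_bigsum (index_enum I) (fun k => ivG k x i).
have A3 x := Rintegral_bigsum (index_enum 'I_m) (fun i => (A2 x i).1).
have iB x : P.-integrable setT (EFin \o (fun w => \sum_k u k x * F k x w -
      \sum_i \sum_k v k x i * G k x i w)).
  exact: (integrableB _ (A1 x).1 (A3 x).1).
have [A4 A5] := Rintegral_bigsum (index_enum J) iB.
split=> //; rewrite A5; apply: eq_bigr => x _.
rewrite RintegralB//; [|exact: (A1 x).1|exact: (A3 x).1].
rewrite (A1 x).2 (A3 x).2; congr (_ - _).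
  by apply: eq_bigr => k _; rewrite RintegralZl.
apply: eq_bigr => i _; rewrite (A2 x i).2.
by apply: eq_bigr => k _; rewrite RintegralZl.
Qed.

Let iss k x : P.-integrable setT
  (EFin \o (fun w => Z k w * (gsoft c s (Z ^~ w) * gshare c s (Z ^~ w) x))).
Proof.
apply: (exp_bounded_integrable iZ
  (F := fun z => z k * (gsoft c s z * gshare c s z x)) (C := C) (K := a * b + 1)).
  by apply: measurable_funM; [exact: mZ|exact: measurable_soft_share].
by apply: coord_exp_bounded; exact: soft_share_bound.
Qed.

Let issd k x i : P.-integrable setT (EFin \o (fun w => Z k w *
   (gsoft c s (Z ^~ w) * gshare c s (Z ^~ w) x * gdirn c s (Z ^~ w) x i))).
Proof.
apply: (exp_bounded_integrable iZ
  (F := fun z => z k * (gsoft c s z * gshare c s z x * gdirn c s z x i))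
  (C := C) (K := a * b + 1)).
  apply: measurable_funM; first exact: mZ.
  by apply: measurable_funM; [exact: measurable_soft_share|exact: measurable_gdirn].
by apply: coord_exp_bounded; exact: soft_share_dirn_bound.
Qed.

Let idss k x : P.-integrable setT
  (EFin \o (fun w => dsoft_share zeta a b xs c s k (Z ^~ w) x)).
Proof.
apply: (exp_bounded_integrable iZ
  (F := fun z => dsoft_share zeta a b xs c s k z x) (C := C) (K := a * b)).
  exact: measurable_dsoft_share.
exact: dsoft_share_bound.
Qed.

Let idssd k x i : P.-integrable setT
  (EFin \o (fun w => dsoft_share_dirn zeta a b xs c s k (Z ^~ w) x i)).
Proof.
apply: (exp_bounded_integrable iZ
  (F := fun z => dsoft_share_dirn zeta a b xs c s k z x i) (C := C) (K := a * b)).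
  exact: measurable_dsoft_share_dirn.
exact: dsoft_share_dirn_bound.
Qed.

Lemma integrable_gsoft : P.-integrable setT (EFin \o (fun w => gsoft c s (Z ^~ w))).
Proof.
apply: (exp_bounded_integrable iZ (F := fun z => gsoft c s z) (C := C) (K := a * b)).
  exact: measurable_gsoft.
exact: gsoft_exp_bounded.
Qed.

Let ibp_share k x :
  \int[P]_w (Z k w * (gsoft c s (Z ^~ w) * gshare c s (Z ^~ w) x)) =
  \int[P]_w dsoft_share zeta a b xs c s k (Z ^~ w) x.
Proof.
apply: (iid_ibp (F := fun z => gsoft c s z * gshare c s z x)
  (F' := fun z => dsoft_share zeta a b xs c s k z x) (C := C) (K := a * b) iZ) => //.
- exact: measurable_soft_share.
- exact: measurable_dsoft_share.
- exact: soft_share_bound.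
- exact: dsoft_share_bound.
- by move=> z y; exact: is_derive_gsoft_share.
- by move=> z; exact: continuous_dsoft_share.
Qed.

Let ibp_share_dirn k x i :
  \int[P]_w (Z k w *
   (gsoft c s (Z ^~ w) * gshare c s (Z ^~ w) x * gdirn c s (Z ^~ w) x i)) =
  \int[P]_w dsoft_share_dirn zeta a b xs c s k (Z ^~ w) x i.
Proof.
apply: (iid_ibp (F := fun z => gsoft c s z * gshare c s z x * gdirn c s z x i)
  (F' := fun z => dsoft_share_dirn zeta a b xs c s k z x i) (C := C) (K := a * b) iZ) => //.
- by apply: measurable_funM; [exact: measurable_soft_share|exact: measurable_gdirn].
- exact: measurable_dsoft_share_dirn.
- exact: soft_share_dirn_bound.
- exact: dsoft_share_dirn_bound.
- by move=> z y; exact: is_derive_gsoft_share_dirn.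
- by move=> z; exact: continuous_dsoft_share_dirn.
Qed.

(** The angular derivative is a sum of coordinates [Z k] times [soft * share] or
    [soft * share * dirn]. Integration by parts in each [k] turns its mean into [a * b] times the
    mean of [drift], which [drift_ge] bounds pointwise. *)
Lemma expectation_dangle : 0 <= c -> 0 <= s ->
  (a * b) ^+ 2 * (c * s) * \int[P]_w gsoft c s (Z ^~ w) <=
  \int[P]_w dangle c s (Z ^~ w).
Proof.
move=> c0 s0.
have [g1 g2] := linear_expectation (fun k x => dgw xs c k x)
  (fun k x i => dgV xs (- s) c k x i) iss issd.
have [h1 h2] := linear_expectation (fun k x => dgw xs c k x)
  (fun k x i => dgV xs (- s) c k x i) idss idssd.
have -> : \int[P]_w dangle c s (Z ^~ w) = a * b * \int[P]_w drift c s (Z ^~ w).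
  transitivity (\int[P]_w (a * b * gradient_term c s (Z ^~ w))).
    by apply: eq_Rintegral => w _; exact: dangleE.
  rewrite RintegralZl//; congr (_ * _).
  rewrite [LHS]g2 [RHS]h2; apply: eq_bigr => x _; congr (_ - _).
    by apply: eq_bigr => k _; rewrite ibp_share.
  by apply: eq_bigr => i _; apply: eq_bigr => k _; rewrite ibp_share_dirn.
have igs := integrable_gsoft.
rewrite (_ : (a * b) ^+ 2 * (c * s) * _ =
  a * b * (c * s * (a * b) * \int[P]_w gsoft c s (Z ^~ w))); last by ring.
apply: ler_wpM2l => //; rewrite -RintegralZl//; apply: le_Rintegral => //.
  exact: (integrableZl measurableT _ igs).
move=> w _; rewrite -[leLHS]mulrA.
exact: drift_ge.
Qed.

End fixed_angle.

Let dangle_bound c s z : `|c| <= 1 -> `|s| <= 1 ->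
  `|dangle c s z| <= a * b * C * (1 + m%:R) * expR ((a * b + 1) * \sum_k `|z k|).
Proof.
move=> c1 s1; set S := \sum_k _.
have S0 : 0 <= S by apply: sumr_ge0.
have m0 : 0 <= m%:R :> R by [].
have gS x : `|gw c z x| <= S.
  rewrite gw_sum//; apply: le_trans (ler_norm_sum _ _ _) _.
  by apply: ler_sum => k _; rewrite normrM ler_piMl// dgw_norm_le1.
have VS x i : `|gV (- s) c z x i| <= S.
  rewrite gV_sum; apply: le_trans (ler_norm_sum _ _ _) _.
  by apply: ler_sum => k _; rewrite normrM ler_piMl// dgV_norm_le1// normrN.
have bS : `|\sum_x gshare c s z x * (gw c z x - \sum_i gdirn c s z x i * gV (- s) c z x i)|
    <= (1 + m%:R) * S.
  apply: le_trans (ler_norm_sum _ _ _) _.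
  have -> : (1 + m%:R) * S = \sum_x gshare c s z x * ((1 + m%:R) * S).
    by rewrite -mulr_suml sum_share// mul1r.
  apply: ler_sum => x _; rewrite normrM ger0_norm; last exact: share_ge0.
  apply: ler_wpM2l; first exact: share_ge0.
  apply: le_trans (ler_normB _ _) _; rewrite mulrDl mul1r; apply: lerD => //.
  apply: le_trans (ler_norm_sum _ _ _) _.
  have -> : m%:R * S = \sum_(i < m) S by rewrite sumr_const card_ord mulr_natl.
  apply: ler_sum => i _; rewrite normrM -[leRHS]mul1r; apply: ler_pM => //.
  exact: dirn_norm_le1.
rewrite /dangle normrM.
have gb : `|gsoft c s z| <= C * expR (a * b * S) by exact: gsoft_exp_bounded.
rewrite normrM (ger0_norm K_ge0).
rewrite mulrDl mul1r expRD.
rewrite (_ : a * b * C * (1 + m%:R) * _ = a * b * (C * expR (a * b * S)) * ((1 + m%:R) * expR S));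
  last by ring.
apply: ler_pM => //.
- by rewrite mulr_ge0.
- exact: ler_wpM2l.
- apply: le_trans bS _; apply: ler_wpM2l; first exact: addr_ge0.
  by apply: le_trans (expR_ge1Dx _); rewrite lerDr.
Qed.

(* Gaussian interpolation between the processes [|A x| + gamma] and
   [|h| + <g, x>]; the factor [expR ((a * b) ^+ 2 / 2)] is the contribution of
   the independent variable [gamma] of Gordon's comparison inequality. *)
Theorem gordon_comparison :
  expR ((a * b) ^+ 2 / 2) * \int[P]_w gsoft 1 0 (Z ^~ w) <=
  \int[P]_w gsoft 0 1 (Z ^~ w).
Proof.
pose Jt (t : R) := \int[P]_w gsoft (cos t) (sin t) (Z ^~ w).
pose G w := a * b * C * (1 + m%:R) * expR ((a * b + 1) * \sum_k `|Z k w|).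
have mZ k : measurable_fun setT (Z k) by have [] := iZ.1 k.
have dJ (t : R) : is_derive t (1 : R) Jt (\int[P]_w dangle (cos t) (sin t) (Z ^~ w)).
  apply: (@is_derive_under_integral _ _ _ P (fun t w => gsoft (cos t) (sin t) (Z ^~ w))
    (fun t w => dangle (cos t) (sin t) (Z ^~ w)) G t (t - 1) (t + 1)).
  - by apply/andP; split; lra.
  - by move=> x _; apply: integrable_gsoft; exact: sin_max.
  - by move=> x w _; exact: is_derive_angle.
  - apply: (exp_bounded_integrable iZ (F := fun z => a * b * C * (1 + m%:R) *
      expR ((a * b + 1) * \sum_k `|z k|)) (C := a * b * C * (1 + m%:R)) (K := a * b + 1)).
      apply: measurable_funM => //; apply: (measurableT_comp (@measurable_expR R)).
      apply: measurable_funM => //; apply: measurable_sum => k.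
      by apply: (measurableT_comp (@normr_measurable R setT)); exact: measurable_family_coord.
    move=> z; rewrite ger0_norm// mulr_ge0 ?expR_ge0//.
    by rewrite mulr_ge0 ?addr_ge0// mulr_ge0.
  - by move=> x w _; apply: dangle_bound; [exact: cos_max|exact: sin_max].
(* The integrating factor for [Jt' >= (a * b) ^+ 2 * cos t * sin t * Jt]: a primitive of
   [cos t * sin t] is [sin t ^+ 2 / 2]. Hence [Q] is nondecreasing on [[0, pi / 2]]. *)
pose Q (t : R) := expR (- ((a * b) ^+ 2 / 2) * sin t ^+ 2) * Jt t.
have dQ (t : R) : is_derive t (1 : R) Q (expR (- ((a * b) ^+ 2 / 2) * sin t ^+ 2) *
   (\int[P]_w dangle (cos t) (sin t) (Z ^~ w) - (a * b) ^+ 2 * (cos t * sin t) * Jt t)).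
  have h1 := dJ t.
  have h2 : is_derive t (1 : R) (fun t => - ((a * b) ^+ 2 / 2) * sin t ^+ 2)
     (- ((a * b) ^+ 2 / 2) * (2 * sin t * cos t)).
    by apply: is_derive_eq; rewrite /GRing.scale/=; ring.
  by apply: is_derive_eq; rewrite /GRing.scale/= /Q; field.
have pi0 : 0 < pi / 2 :> R by have /andP[] := @pihalf_02 R.
have : Q 0 <= Q (pi / 2).
  apply: (@ger0_derive1_le_cc _ Q 0 (pi / 2)); rewrite ?in_itv/= ?lexx ?(ltW pi0)//.
  - move=> t; rewrite in_itv/= => /andP[t0 t1].
    rewrite derive1E; have ? := dQ t; rewrite derive_val.
    rewrite mulr_ge0 ?expR_ge0// subr_ge0 expectation_dangle//.
    + exact: cos_max.
    + exact: sin_max.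
    + by rewrite cos_ge0_pihalf// (ltW t1) andbT ltW// (lt_trans _ t0)// oppr_lt0.
    + by rewrite sin_ge0_pi// (ltW t0)/= ltW// (lt_le_trans t1)// ler_pdivrMr// ler_peMr ?pi_ge0// ler1n.
  - by apply: derivable_within_continuous => t _; have ? := dQ t.
rewrite /Q /Jt sin0 cos0 sin_pihalf cos_pihalf expr0n expr1n mulr0 expR0 mul1r mulr1.
by rewrite expRN ler_pdivlMl ?expR_gt0.
Qed.

End gordon_comparison.

(** * Laplace transform of the norm of a Gaussian vector *)

Section chi_lower_tail.
Context {R : realType}.
Variables (m : nat) (zeta : R).
Hypotheses (zeta0 : 0 < zeta) (m0 : (0 < m)%N).
Variables (d : measure_display) (T : measurableType d) (P : probability T R)
  (X : 'I_m -> T -> R).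
Hypothesis iX : iid_normal P X.
Implicit Types (z : 'I_m -> R) (k i : 'I_m).

(** A one-point index set, so that the calculus of [rad] and [dirn] applies to a single vector. *)
Let V z : unit -> 'I_m -> R := fun _ i => z i.
Definition smooth_norm z := rad zeta (V z) tt.
Local Notation rho := smooth_norm.
Let n z i := dirn zeta (V z) tt i.

Let mz k : measurable_family (fun z => z k).
Proof. exact: measurable_family_coord. Qed.

Lemma measurable_smooth_norm : measurable_family rho.
Proof.
apply: measurable_sqrt; apply: measurable_funD => //.
by apply: measurable_sum => i; apply: measurable_funX; exact: mz.
Qed.

Let mn k : measurable_family (fun z => n z k).
Proof.
apply: measurable_funM; first exact: mz.
by apply: measurable_inv_ge0 => [|t]; [exact: measurable_smooth_norm|exact: sqrtr_ge0].
Qed.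

Lemma smooth_norm_gt0 z : 0 < rho z. Proof. exact: rad_gt0. Qed.

Lemma smooth_norm_sqr z : rho z ^+ 2 = zeta ^+ 2 + \sum_i z i ^+ 2.
Proof. exact: rad_sqr. Qed.

Lemma smooth_norm_le z : rho z <= zeta + \sum_i `|z i|.
Proof.
have S0 : 0 <= \sum_i `|z i| by apply: sumr_ge0.
rewrite -(ger0_norm (addr_ge0 (ltW zeta0) S0)) -sqrtr_sqr /smooth_norm /rad ler_wsqrtr//.
rewrite sqrrD -mulr_natr; apply: (@le_trans _ _ (zeta ^+ 2 + (\sum_i `|z i|) ^+ 2)).
  rewrite lerD2l.
  have : forall r : seq 'I_m, \sum_(i <- r) z i ^+ 2 <= (\sum_(i <- r) `|z i|) ^+ 2.
    elim=> [|i r IH]; first by rewrite !big_nil expr0n.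
    rewrite !big_cons sqrrD real_normK ?num_real// -mulr_natr -addrA lerD2l.
    rewrite -[leLHS]add0r lerD// !mulr_ge0//; exact: sumr_ge0.
  exact.
by rewrite lerD2r lerDl !mulr_ge0// ltW.
Qed.

Let sum_zn z : \sum_k z k * n z k <= rho z.
Proof.
have -> : \sum_k z k * n z k = (\sum_k z k ^+ 2) / rho z.
  by rewrite mulr_suml; apply: eq_bigr => k _; rewrite /n /dirn mulrA expr2.
rewrite ler_pdivrMr ?smooth_norm_gt0// -expr2 smooth_norm_sqr lerDr.
exact: sqr_ge0.
Qed.

Section fixed_rate.
Variable s : R.

(** The components of a radial vector field. As [F' k] is the derivative of [F k] in coordinate [k],
    the sum of the [F' k] is the divergence. *)
Let F k z := n z k * expR (- s * rho z).
Let F' k z := ((1 - n z k ^+ 2) / rho z - s * n z k ^+ 2) * expR (- s * rho z).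

Hypothesis s0 : 0 <= s.

Let dz z k i (y : R) : is_derive y (1 : R) (fun y => V (update z k y) tt i) (i == k)%:R.
Proof. exact: is_derive_update. Qed.

Let drho z k (y : R) : is_derive y (1 : R) (fun y => rho (update z k y)) (n (update z k y) k).
Proof.
have := @is_derive_rad R unit m zeta zeta0 (fun y => V (update z k y)) (fun _ i => (i == k)%:R) y
  (fun _ i => dz z k i y) tt.
rewrite (bigD1 k)//= eqxx mulr1 big1 ?addr0// => i /negbTE ->.
by rewrite mulr0.
Qed.

Let dn z k (y : R) : is_derive y (1 : R) (fun y => n (update z k y) k)
  ((1 - n (update z k y) k ^+ 2) / rho (update z k y)).
Proof.
have := @is_derive_dirn R unit m zeta zeta0 (fun y => V (update z k y)) (fun _ i => (i == k)%:R) y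
  (fun _ i => dz z k i y) tt k.
rewrite (bigD1 k)//= eqxx mulr1 big1 ?addr0// => i /negbTE ->.
by rewrite mulr0.
Qed.

Let dexp z k (y : R) : is_derive y (1 : R) (fun y => expR (- s * rho (update z k y)))
  (- s * n (update z k y) k * expR (- s * rho (update z k y))).
Proof.
have h := drho z k y.
have h2 : is_derive y (1 : R) (fun y => - s * rho (update z k y)) (- s * n (update z k y) k).
  exact: is_deriveZ.
by apply: is_derive_eq; ring.
Qed.

Let dF z k (y : R) :
  is_derive y (1 : R) (fun y => F k (update z k y)) (F' k (update z k y)).
Proof.
have h1 := dn z k y; have h2 := dexp z k y.
by apply: is_derive_eq; rewrite /GRing.scale/= /F'; ring.
Qed.

Let cF' z k : continuous (fun y => F' k (update z k y)).
Proof.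
have crho := cont_of_derive (drho z k).
have cn := cont_of_derive (dn z k).
have ce := cont_of_derive (dexp z k).
have cn2 : continuous (fun y => n (update z k y) k ^+ 2).
  by move=> y; apply: cvgM; exact: cn.
move=> y; apply: cvgM; last exact: ce.
apply: (@cvgB _ R^o); apply: cvgM; last exact: cn2.
- by apply: (@cvgB _ R^o); [exact: cvg_cst|exact: cn2].
- by apply: cvgV; [rewrite gt_eqF// smooth_norm_gt0|exact: crho].
- exact: cvg_cst.
Qed.

Let mexp : measurable_family (fun z => expR (- s * rho z)).
Proof.
apply: (measurableT_comp (@measurable_expR R)); apply: measurable_funM => //.
exact: measurable_smooth_norm.
Qed.

Let mF k : measurable_family (F k).
Proof. by apply: measurable_funM; [exact: mn|exact: mexp]. Qed.

Let mF' k : measurable_family (F' k).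
Proof.
have mn2 : measurable_family (fun z => n z k ^+ 2) by apply: measurable_funX; exact: mn.
apply: measurable_funM; last exact: mexp.
apply: measurable_funB; apply: measurable_funM => //.
- exact: measurable_funB.
- by apply: measurable_inv_ge0 => [|t]; [exact: measurable_smooth_norm|exact: sqrtr_ge0].
Qed.

Let K := `|s|.
Let C := expR (K * zeta) * (1 + zeta^-1 + `|s|).

Let K0 : 0 <= K. Proof. exact: normr_ge0. Qed.
Let C1 : 0 <= 1 + zeta^-1 + `|s|.
Proof. by rewrite !addr_ge0// invr_ge0 ltW. Qed.
Let C0 : 0 <= C. Proof. by rewrite mulr_ge0 ?expR_ge0. Qed.

Let exp_le z : expR (- s * rho z) <= expR (K * zeta) * expR (K * \sum_i `|z i|).
Proof.
rewrite -expRD ler_expR -mulrDr.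
apply: le_trans (ler_norm _) _; rewrite normrM normrN (ger0_norm (ltW (smooth_norm_gt0 z))).
by apply: ler_wpM2l => //; exact: smooth_norm_le.
Qed.

Let bound_gen z f : `|f| <= 1 + zeta^-1 + `|s| ->
  `|f * expR (- s * rho z)| <= C * expR (K * \sum_i `|z i|).
Proof.
move=> fb; rewrite normrM (ger0_norm (expR_ge0 _)) mulrC /C [leRHS]mulrAC.
by apply: ler_pM.
Qed.

Let n1 z k : `|n z k| <= 1. Proof. exact: dirn_norm_le1. Qed.

Let n21 z k : 0 <= n z k ^+ 2 <= 1.
Proof.
rewrite sqr_ge0/= -real_normK ?num_real//.
by rewrite expr_le1.
Qed.

Let bF k : exp_bounded C K (F k).
Proof.
move=> z; apply: bound_gen; apply: le_trans (n1 z k) _.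
by rewrite -addrA lerDl addr_ge0// invr_ge0 ltW.
Qed.

Let bF' k : exp_bounded C K (F' k).
Proof.
move=> z; apply: bound_gen; have /andP[h1 h2] := n21 z k.
apply: le_trans (ler_normB _ _) _; apply: lerD.
  rewrite normrM -[leLHS]add0r; apply: lerD => //.
  rewrite -[leRHS]mul1r; apply: ler_pM => //.
    by rewrite ger0_norm; lra.
  rewrite normfV (ger0_norm (ltW (smooth_norm_gt0 z))) lef_pV2 ?posrE ?smooth_norm_gt0//.
  exact: zeta_le_rad.
rewrite normrM -[leRHS]mulr1; apply: ler_pM => //.
by rewrite ger0_norm.
Qed.

Lemma integrable_tilt : P.-integrable setT (EFin \o (fun w => expR (- s * rho (X ^~ w)))).
Proof.
apply: (exp_bounded_integrable iX (F := fun z => expR (- s * rho z)) (C := C) (K := K)) => //.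
move=> z; rewrite -[X in `|X|]mul1r; apply: bound_gen; rewrite normr1.
by rewrite -addrA lerDl addr_ge0// invr_ge0 ltW.
Qed.

Let iF' k : P.-integrable setT (EFin \o (fun w => F' k (X ^~ w))).
Proof. exact: (exp_bounded_integrable iX (mF' k) (bF' k)). Qed.

Let coord_bounded k G : exp_bounded C K G -> exp_bounded C (K + 1) (fun z => z k * G z).
Proof.
move=> bG z; rewrite normrM.
apply: le_trans (ler_wpM2l (normr_ge0 _) (bG z)) _.
rewrite mulrCA ler_wpM2l// mulrDl mul1r expRD mulrC ler_wpM2l ?expR_ge0//.
apply: le_trans (expR_ge1Dx _); rewrite (bigD1 k)//= ler_wpDl// lerDl.
by apply: sumr_ge0.
Qed.

Let izF k : P.-integrable setT (EFin \o (fun w => X k w * F k (X ^~ w))).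
Proof.
apply: (exp_bounded_integrable iX (F := fun z => z k * F k z) (C := C) (K := K + 1)).
  by apply: measurable_funM; [exact: mz|exact: mF].
by apply: coord_bounded; exact: bF.
Qed.

Lemma integrable_tilted_norm : P.-integrable setT (EFin \o (fun w => rho (X ^~ w) * expR (- s * rho (X ^~ w)))).
Proof.
apply: (exp_bounded_integrable iX (F := fun z => rho z * expR (- s * rho z))
   (C := C * expR zeta) (K := K + 1)).
  by apply: measurable_funM; [exact: measurable_smooth_norm|exact: mexp].
move=> z; rewrite normrM (ger0_norm (ltW (smooth_norm_gt0 z))) mulrDl mul1r expRD.
rewrite (_ : _ * _ * _ = (expR zeta * expR (\sum_i `|z i|)) * (C * expR (K * \sum_i `|z i|))); last by ring.
apply: ler_pM => //; first exact/ltW/smooth_norm_gt0.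
  rewrite -expRD; apply: le_trans (expR_ge1Dx _).
  by apply: le_trans (smooth_norm_le z) _; rewrite lerDr.
rewrite -[X in `|X|]mul1r; apply: bound_gen; rewrite normr1.
by rewrite -addrA lerDl addr_ge0// invr_ge0 ltW.
Qed.

Let c := Num.sqrt (m.-1)%:R : R.

(* [(m - 1) / r + r >= 2 sqrt (m - 1)] makes the integration by parts identity
   linear in the two expectations. *)
Lemma tilted_mean_norm_ge : (c - s / 2) * \int[P]_w expR (- s * rho (X ^~ w)) <=
  \int[P]_w (rho (X ^~ w) * expR (- s * rho (X ^~ w))).
Proof.
have ge2c r : 0 < r -> 2 * c <= m.-1%:R / r + r.
  move=> r0; rewrite -subr_ge0.
  have -> : m.-1%:R / r + r - 2 * c = (c - r) ^+ 2 / r.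
    have -> : m.-1%:R = c ^+ 2 :> R by rewrite sqr_sqrtr.
    by field; rewrite gt_eqF.
  by rewrite divr_ge0 ?sqr_ge0// ltW.
have pw z : (2 * c - s) * expR (- s * rho z) <=
    \sum_k F' k z + rho z * expR (- s * rho z).
  rewrite /F' -mulr_suml -mulrDl; apply: ler_wpM2r; first exact: expR_ge0.
  rewrite sumrB -mulr_suml -mulr_sumr sumrB sumr_const card_ord.
  have h1 := sum_dirn_sqr_le1 zeta0 (V z) tt.
  have h2 := ge2c _ (smooth_norm_gt0 z).
  have h3 : s * (\sum_i n z i ^+ 2) <= s by rewrite ler_piMr.
  (* This is where [m] drops to [m - 1]: the squared norm of [n] is bounded by one. *)
  have h4 : m.-1%:R / rho z <= (m%:R - \sum_i n z i ^+ 2) / rho z.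
    apply: ler_wpM2r; first by rewrite invr_ge0 ltW// smooth_norm_gt0.
    have mE : m%:R = m.-1%:R + 1 :> R by rewrite natr1 prednK.
    by move: h1 mE; rewrite /n; lra.
  by move: h2 h3 h4; lra.
have [iS1 eS1] := Rintegral_bigsum (index_enum 'I_m) iF'.
have [iS2 eS2] := Rintegral_bigsum (index_enum 'I_m) izF.
have l1 : (2 * c - s) * \int[P]_w expR (- s * rho (X ^~ w)) <=
    \int[P]_w (\sum_k F' k (X ^~ w)) +
    \int[P]_w (rho (X ^~ w) * expR (- s * rho (X ^~ w))).
  rewrite -(RintegralZl _ measurableT integrable_tilt) -(RintegralD measurableT iS1 integrable_tilted_norm).
  apply: (le_Rintegral measurableT) => [||w _].
  - exact (integrableZl measurableT (2 * c - s) integrable_tilt).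
  - exact (integrableD measurableT iS1 integrable_tilted_norm).
  - exact: pw.
have l2 : \int[P]_w (\sum_k F' k (X ^~ w)) = \int[P]_w (\sum_k X k w * F k (X ^~ w)).
  rewrite eS1 eS2; apply: eq_bigr => k _; apply/esym.
  exact: (iid_ibp iX C0 K0 (mF k) (mF' k) (bF k) (bF' k) (dF ^~ k) (cF' ^~ k)).
have l3 : \int[P]_w (\sum_k X k w * F k (X ^~ w)) <=
    \int[P]_w (rho (X ^~ w) * expR (- s * rho (X ^~ w))).
  apply: (le_Rintegral measurableT iS2 integrable_tilted_norm) => w _; rewrite /F.
  under eq_bigr do rewrite mulrA.
  by rewrite -mulr_suml ler_wpM2r ?expR_ge0//; exact: sum_zn.
by move: l1 l2 l3; lra.
Qed.

End fixed_rate.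

Let mgf (s : R) := \int[P]_w expR (- s * rho (X ^~ w)).

Let Z K z := expR (K * (zeta + \sum_i `|z i|)).

Let mZ K : measurable_family (Z K).
Proof.
apply: (measurableT_comp (@measurable_expR R)); apply: measurable_funM => //.
apply: measurable_funD => //; apply: measurable_sum => i.
by apply: (measurableT_comp (@normr_measurable R setT)); exact: mz.
Qed.

Let bZ K : exp_bounded (expR (K * zeta)) K (Z K).
Proof. by move=> z; rewrite ger0_norm ?expR_ge0// /Z mulrDr expRD. Qed.

Let is_derive_mgf s : is_derive s (1 : R) mgf
  (- \int[P]_w (rho (X ^~ w) * expR (- s * rho (X ^~ w)))).
Proof.
have -> : - (\int[P]_w (rho (X ^~ w) * expR (- s * rho (X ^~ w)))) =
    \int[P]_w (- rho (X ^~ w) * expR (- s * rho (X ^~ w))).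
  rewrite -mulN1r -(RintegralZl _ measurableT (integrable_tilted_norm s)).
  by apply: eq_Rintegral => w _; rewrite mulN1r [RHS]mulNr.
apply: (@is_derive_under_integral _ _ _ P (fun s w => expR (- s * rho (X ^~ w)))
   (fun s w => - rho (X ^~ w) * expR (- s * rho (X ^~ w)))
   (fun w => Z (`|s| + 2) (X ^~ w)) s (s - 1) (s + 1)).
- by apply/andP; split; lra.
- by move=> x _; exact: integrable_tilt.
- move=> x w _; set r := rho _.
  have h : is_derive x (1 : R) (fun x => - x * r) (- r).
    by apply: is_derive_eq; rewrite /GRing.scale/=; ring.
  by apply: is_derive_eq; ring.
- exact: (exp_bounded_integrable iX (mZ _) (bZ _)).
- move=> x w xs; set z := X ^~ w; have r0 := smooth_norm_gt0 z.
  rewrite normrM normrN (ger0_norm (ltW r0)) (ger0_norm (expR_ge0 _)).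
  have h1 : rho z <= expR (rho z).
    by apply: le_trans (expR_ge1Dx _); rewrite lerDr.
  apply: (@le_trans _ _ (expR (rho z) * expR (- x * rho z))).
    by rewrite ler_wpM2r ?expR_ge0.
  rewrite -expRD ler_expR -{1}[rho z]mul1r -mulrDl.
  apply: (@le_trans _ _ ((`|s| + 2) * rho z)).
    rewrite ler_wpM2r ?ltW//; have := ler_norm (- s); rewrite normrN.
    by move: xs => /andP[]; lra.
  by rewrite ler_wpM2l ?addr_ge0//; exact: smooth_norm_le.
Qed.

(** [tilted_mean_norm_ge] says that the logarithmic derivative of [mgf] at [s] is at most
    [- (c - s / 2)]; integrate from [0], where [mgf] equals [1]. *)
Lemma chi_lower_mgf s : 0 <= s ->
  mgf s <= expR (- Num.sqrt (m.-1)%:R * s + s ^+ 2 / 4).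
Proof.
move=> s0; set c := Num.sqrt _.
pose e x := expR (c * x - x ^+ 2 / 4).
have dQ (x : R) : is_derive x (1 : R) (fun x => mgf x * e x)
    (e x * ((c - x / 2) * mgf x - \int[P]_w (rho (X ^~ w) * expR (- x * rho (X ^~ w))))).
  have h := is_derive_mgf x.
  have h2 : is_derive x (1 : R) (fun x => c * x - x ^+ 2 / 4) (c - x / 2).
    by apply: is_derive_eq; rewrite /GRing.scale/=; field.
  by apply: is_derive_eq; rewrite /GRing.scale/= /e; ring.
have Q0 : mgf s * e s <= mgf 0 * e 0.
  apply: (@ler0_derive1_le_cc _ (fun x => mgf x * e x) 0 s); rewrite ?in_itv/= ?lexx ?s0//.
  - move=> x; rewrite in_itv/= => /andP[x0 _].
    rewrite derive1E; have ? := dQ x; rewrite derive_val.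
    apply: mulr_ge0_le0; first exact: expR_ge0.
    by rewrite subr_le0; apply: tilted_mean_norm_ge; exact: ltW.
  - by apply: derivable_within_continuous => x _; have ? := dQ x.
have m0E : mgf 0 = 1.
  rewrite /mgf; under eq_Rintegral do rewrite oppr0 mul0r expR0.
  exact: Rintegral_prob_cst.
move: Q0; rewrite m0E mul1r /e mulr0 expr0n/= mul0r subr0 expR0.
rewrite -ler_pdivlMr ?expR_gt0// mul1r -expRN => /le_trans; apply.
by rewrite ler_expR; lra.
Qed.

End chi_lower_tail.

Lemma integral_prob_cst {R : realType} {d} {T : measurableType d}
    (P : probability T R) (c : R) : (\int[P]_x c%:E = c%:E)%E.
Proof. by rewrite integral_cst// [X in (_ * X)%E]probability_setT mule1. Qed.

Lemma EFin_Rintegral {R : realType} {d} {T : measurableType d}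
    (mu : {measure set T -> \bar R}) (f : T -> R) :
  mu.-integrable setT (EFin \o f) ->
  (\int[mu]_x f x)%:E = (\int[mu]_x (f x)%:E)%E.
Proof. by move=> fi; rewrite /Rintegral fineK//; exact: integrable_fin_num fi. Qed.

Lemma ge0_integral_prod_sep {R : realType} {d d'} {T : measurableType d}
    {T' : measurableType d'} (P : probability T R) (P' : probability T' R)
    (f : T -> R) (g : T' -> R) :
  measurable_fun setT f -> measurable_fun setT g ->
  (forall x, 0 <= f x) -> (forall y, 0 <= g y) ->
  (\int[P \x P']_z (f z.1 * g z.2)%:E =
   \int[P]_x (f x)%:E * \int[P']_y (g y)%:E)%E.
Proof.
move=> mf mg f0 g0.
rewrite fubini_tonelli1/=; last 2 first.
- apply/measurable_EFinP; apply: measurable_funM.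
    by apply: measurableT_comp; [exact: mf|exact: measurable_fst].
  by apply: measurableT_comp; [exact: mg|exact: measurable_snd].
- by move=> z; rewrite lee_fin mulr_ge0.
rewrite /fubini_F /=.
under eq_integral => w _.
  under eq_integral do rewrite EFinM.
  rewrite ge0_integralZl//=; last 3 first.
  - by apply/measurable_EFinP; exact: mg.
  - by move=> x _; rewrite lee_fin.
  - by rewrite lee_fin.
  over.
rewrite ge0_integralZr//=.
- by apply/measurable_EFinP; exact: mf.
- by move=> w _; rewrite lee_fin.
- by apply: integral_ge0 => x _; rewrite lee_fin.
Qed.

(** * Escape bound for a finite family of unit vectors *)

Section escape.
Context {R : realType}.
Notation gauss := (normal_prob (0 : R) 1).
Variables (J : finType) (m N : nat) (zeta b s kappa : R) (xs : J -> 'I_N -> R).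
Hypotheses (zeta0 : 0 < zeta) (s0 : 0 <= s) (b0 : 0 < b) (b1 : b <= 1).
Hypotheses (J0 : (0 < #|J|)%N) (m0 : (0 < m)%N).
Hypothesis xs1 : forall x, \sum_j xs x j ^+ 2 = 1.
Variables (d : measure_display) (T : measurableType d) (P : probability T R)
  (A : 'I_m * 'I_N -> T -> R).
Hypothesis iA : iid_normal P A.
(** An abstract majorant for the exponential of [<g, x>], uniform in the point [x]. It is a product
    over coordinates so that its mean under independent variables factorizes. *)
Variable G : 'I_N -> R -> R.
Hypothesis mG : forall j, measurable_fun setT (G j).
Hypothesis GE : forall x (g : 'I_N -> R),
  expR (s * (\sum_j g j * xs x j) - kappa) <= \prod_j G j (g j).
Hypothesis G0 : forall j u, 0 <= G j u.

Definition net_image w (x : J) (i : 'I_m) : R := \sum_j A (i, j) w * xs x j.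

(** Since [rad] never falls below [zeta], this is applied at [r = 2 * zeta], where it contains the
    event that some point of the net has an image of norm at most [zeta]. *)
Definition near_kernel (r : R) : set T :=
  [set w | exists x, rad zeta (net_image w) x <= r].

Lemma measurable_near_kernel r : measurable (near_kernel r).
Proof.
have -> : near_kernel r = \bigcup_(x in [set: J])
    ((fun w => rad zeta (net_image w) x) @^-1` [set y | y <= r]).
  by apply/seteqP; split => [w [x h]|w [x _ h]]; exists x.
apply: fin_bigcup_measurable => [|x _]; first exact: finite_finset.
have mr : measurable_fun setT (fun w => rad zeta (net_image w) x).
  apply: measurable_sqrt; apply: measurable_funD => //.
  apply: measurable_sum => i; apply: measurable_funX; apply: measurable_sum => j.
  by apply: measurable_funM => //; exact: (iA.1 (i, j)).1.
rewrite -[X in measurable X]setTI; apply: mr => //.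
by rewrite (_ : [set y | y <= r] = [set` `]-oo, r]]).
Qed.

Let a := s / b.
Let a0 : 0 <= a. Proof. by rewrite divr_ge0// ltW. Qed.
Let ab : a * b = s. Proof. by rewrite /a divfK// gt_eqF. Qed.
Local Notation soft := (soft zeta a b).

Let soft_ge (V : J -> 'I_m -> R) w x : expR (s * (w x - rad zeta V x)) <= soft V w.
Proof.
rewrite /soft ler_expR -ab [a * b]mulrC -mulrA ler_pM2l//.
rewrite -[leLHS]expRK ler_ln ?posrE ?expR_gt0//; last exact: mass_gt0.
by rewrite /mass (bigD1 x)//= lerDl sumr_ge0// => y _; exact: expR_ge0.
Qed.

(** By [GE] each summand of [mass] is at most one common value. Summing multiplies it by [#|J|], and
    the power [b] reduces this factor to [expR (b * ln #|J|%:R)]. *)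
Let soft_le (V : J -> 'I_m -> R) (r : R) (g : 'I_N -> R) :
  (forall x, rad zeta V x = r) ->
  soft V (fun x => \sum_j g j * xs x j) <=
  expR (kappa + b * ln #|J|%:R) * (expR (- s * r) * \prod_j G j (g j)).
Proof.
move=> Vr; set w := fun x => _.
have /card_gt0P[x0 _] := J0.
have G1 : 0 < \prod_j G j (g j) by apply: lt_le_trans (GE x0 g); exact: expR_gt0.
have cJ : 0 < #|J|%:R :> R by rewrite ltr0n.
have -> : \prod_j G j (g j) = expR (ln (\prod_j G j (g j))) by rewrite lnK.
rewrite -!expRD ler_expR.
have -> : kappa + b * ln #|J|%:R + (- s * r + ln (\prod_j G j (g j))) =
    b * (ln #|J|%:R + ((ln (\prod_j G j (g j)) + kappa) / b - a * r)).
  by rewrite -ab; field; rewrite gt_eqF.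
rewrite ler_pM2l//.
rewrite -[X in _ <= _ + X]expRK -lnM ?posrE ?expR_gt0//.
rewrite ler_ln ?posrE ?mulr_gt0 ?expR_gt0//; last exact: mass_gt0.
have -> : #|J|%:R * expR ((ln (\prod_j G j (g j)) + kappa) / b - a * r) =
    \sum_(x in J) expR ((ln (\prod_j G j (g j)) + kappa) / b - a * r).
  by rewrite sumr_const mulr_natl.
apply: ler_sum => x _; rewrite /wgt Vr mulrBr ler_expR lerD2r.
rewrite /a mulrAC ler_pM2r ?invr_gt0//.
by rewrite -lerBlDr -ler_expR lnK ?posrE//; exact: GE.
Qed.

(** On [near_kernel r] the functional at angle zero is at least [expR (- s * r)]. The comparison
    moves its mean to the other end, where [soft_le] separates [h] from [g]. The term [- s ^+ 2 / 4]
    is [- s ^+ 2 / 2] from the comparison plus [s ^+ 2 / 4] from [chi_lower_mgf]. *)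
Lemma escape_bound r :
  (P (near_kernel r) * (expR (- s * r))%:E <=
   (expR (kappa + b * ln #|J|%:R - s ^+ 2 / 4 - Num.sqrt (m.-1)%:R * s))%:E *
   \prod_j \int[gauss]_u (G j u)%:E)%E.
Proof.
pose c : R := Num.sqrt (m.-1)%:R.
have exE : expR (kappa + b * ln #|J|%:R - s ^+ 2 / 4 - c * s) =
    (expR (s ^+ 2 / 2))^-1 * (expR (kappa + b * ln #|J|%:R) * expR (- c * s + s ^+ 2 / 4)).
  by rewrite -expRN -!expRD; congr expR; lra.
have combine (p l u hh q q' : \bar R) (c1 c2 c3 c4 : R) : 0 < c2 -> 0 <= c3 ->
    (p <= l)%E -> (c2%:E * l <= u)%E -> (u <= c3%:E * (hh * q))%E -> (hh <= c4%:E)%E ->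
    (0 <= q')%E -> q = q' -> c1 = c2^-1 * (c3 * c4) -> (p <= c1%:E * q')%E.
  move=> c20 c30 pl lu uh hc + qq ->; rewrite -qq => q0.
  apply: (le_trans pl); rewrite EFinM -muleA lee_pdivlMl//.
  apply: (le_trans lu); apply: (le_trans uh); rewrite EFinM -muleA.
  apply: lee_wpmul2l; first by rewrite lee_fin.
  exact: lee_wpmul2r.
(* The space of [A] may carry no further Gaussian variables, so [h] and [g] are built on spaces of
   their own and joined to [A] by a product. *)
have [dh [Th [Ph [h ih]]]] := @exists_iid R 'I_m.
have [dg [Tg [Pg [g ig]]]] := @exists_iid R 'I_N.
have iZ := iid_sum iA (iid_sum ih ig).
set Z := (X in iid_normal _ X) in iZ.
set PP := (P \x _)%E in iZ.
have b0' := ltW b0.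
have lu := @gordon_comparison R J m N zeta a b xs zeta0 a0 b0' b1 J0 xs1 _ _ PP Z iZ.
have n1 : `|1 : R| <= 1 by rewrite ger0_norm.
have n0 : `|0 : R| <= 1 by rewrite ger0_norm.
have i10 := integrable_gsoft zeta0 a0 b0' J0 xs1 iZ 1 n0.
have i01 := integrable_gsoft zeta0 a0 b0' J0 xs1 iZ 0 n1.
rewrite ab in lu.
have mB := measurable_near_kernel r.
have mPP : measurable_fun setT (fun w => (gsoft zeta a b xs 1 0 (Z ^~ w))%:E).
  exact (measurable_int PP i10).
have l_ge : (P (near_kernel r) * (expR (- s * r))%:E <=
    \int[PP]_w (gsoft zeta a b xs 1 0 (Z ^~ w))%:E)%E.
  have m1 : measurable_fun setT (\1_(near_kernel r) : T -> R) by exact: measurable_indic.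
  have m2 : measurable_fun setT (cst (expR (- s * r)) : Th * Tg -> R) by exact: measurable_cst.
  have e0 (w : Th * Tg) : 0 <= cst (expR (- s * r)) w by exact: expR_ge0.
  have i0 (w : T) : 0 <= \1_(near_kernel r) w :> R by rewrite indicE.
  have := ge0_integral_prod_sep P (Ph \x Pg)%E m1 m2 i0 e0.
  have eE : (\int[Ph \x Pg]_y (cst (expR (- s * r)) y)%:E = (expR (- s * r))%:E)%E.
    exact: integral_prob_cst.
  rewrite eE integral_indic// setIT.
  move=> <-; apply: ge0_le_integral => //.
  - by move=> w _; rewrite lee_fin mulr_ge0.
  - apply/measurable_EFinP; apply: measurable_funM => //.
    by apply: measurableT_comp; [exact: m1|exact: measurable_fst].
  - move=> w _; rewrite lee_fin.
    have [kw|nw] := pselect (near_kernel r w.1); last first.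
      by rewrite indicE memNset// mul0r expR_ge0.
    rewrite indicE mem_set// mul1r; have [x wx] := kw.
    apply: le_trans (soft_ge (gV xs 1 0 (Z ^~ w)) (gw xs 0 (Z ^~ w)) x).
    have -> : gV xs 1 0 (Z ^~ w) = net_image w.1.
      by apply/funext => y; apply/funext => i; rewrite /gV mul1r mul0r addr0.
    by rewrite /gw mul0r sub0r ler_expR mulrN mulNr lerN2 ler_wpM2l.
have mrho := measurable_smooth_norm zeta (m := m).
have mh : measurable_fun setT (fun w => expR (- s * smooth_norm zeta (h ^~ w))).
  apply: (measurableT_comp (@measurable_expR R)); apply: measurable_funM => //.
  by apply: (measurable_family_comp mrho) => i; exact: (ih.1 i).1.
have mg : measurable_fun setT (fun w => \prod_j G j (g j w)).
  apply: measurable_prod => j _; apply: measurableT_comp; first exact: mG.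
  exact: (ig.1 j).1.
have G1 y : 0 <= \prod_j G j (g j y) by exact: prodr_ge0.
have h1 y : 0 <= expR (- s * smooth_norm zeta (h ^~ y)) by exact: expR_ge0.
have hg := ge0_integral_prod_sep Ph Pg mh mg h1 G1.
have u_le : (\int[PP]_w (gsoft zeta a b xs 0 1 (Z ^~ w))%:E <=
   (expR (kappa + b * ln #|J|%:R))%:E * (\int[Ph]_w (expR (- s * smooth_norm zeta (h ^~ w)))%:E *
     \int[Pg]_w (\prod_j G j (g j w))%:E))%E.
  have m1 : measurable_fun setT (cst (1 : R) : T -> R) by exact: measurable_cst.
  pose F (y : Th * Tg) := expR (kappa + b * ln #|J|%:R) *
    (expR (- s * smooth_norm zeta (h ^~ y.1)) * \prod_j G j (g j y.2)).
  have F0 y : 0 <= F y by rewrite mulr_ge0 ?expR_ge0// mulr_ge0.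
  have mF' : measurable_fun setT (fun y : Th * Tg =>
      expR (- s * smooth_norm zeta (h ^~ y.1)) * \prod_j G j (g j y.2)).
    apply: measurable_funM.
      by apply: (measurableT_comp mh); exact: measurable_fst.
    by apply: (measurableT_comp mg); exact: measurable_snd.
  have mF : measurable_fun setT F by exact: measurable_funM.
  have i0 (w : T) : 0 <= cst (1 : R) w by exact: ler01.
  have E1 := ge0_integral_prod_sep P (Ph \x Pg)%E m1 mF i0 F0.
  have oneE : (\int[P]_y (cst (1 : R) y)%:E = 1%:E)%E by exact: integral_prob_cst.
  rewrite oneE mul1e in E1.
  have E2 : (\int[Ph \x Pg]_y (F y)%:E = (expR (kappa + b * ln #|J|%:R))%:E *
     (\int[Ph]_w (expR (- s * smooth_norm zeta (h ^~ w)))%:E *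
     \int[Pg]_w (\prod_j G j (g j w))%:E))%E.
    rewrite -hg -ge0_integralZl_EFin ?expR_ge0//.
    - by move=> y _; rewrite lee_fin mulr_ge0.
    - exact/measurable_EFinP.
  apply: (@le_trans _ _ (\int[PP]_z (cst (1 : R) z.1 * F z.2)%:E)%E); last first.
    by rewrite E1 E2.
  have mPP' : measurable_fun setT (fun w => (gsoft zeta a b xs 0 1 (Z ^~ w))%:E).
    exact (measurable_int PP i01).
  apply: ge0_le_integral.
  - exact: measurableT.
  - by move=> w _; rewrite lee_fin expR_ge0.
  - exact: mPP'.
  - apply/measurable_EFinP; apply: measurable_funM.
      by apply: (measurableT_comp m1); exact: measurable_fst.
    by apply: (measurableT_comp mF); exact: measurable_snd.
  - move=> w _; rewrite lee_fin mul1r.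
    have -> : gsoft zeta a b xs 0 1 (Z ^~ w) =
      soft (gV xs 0 1 (Z ^~ w)) (fun x => \sum_j g j w.2.2 * xs x j).
      by rewrite /gsoft /gw; congr soft; apply/funext => x; rewrite mul1r.
    apply: (soft_le (V := gV xs 0 1 (Z ^~ w)) (g ^~ w.2.2)) => x.
    rewrite /smooth_norm /rad; congr (Num.sqrt (_ + _)); apply: eq_bigr => i _.
    by rewrite /gV mul0r add0r mul1r.
have chi : (\int[Ph]_w (expR (- s * smooth_norm zeta (h ^~ w)))%:E <=
    (expR (- c * s + s ^+ 2 / 4))%:E)%E.
  have i := integrable_tilt zeta0 ih s.
  by rewrite -(EFin_Rintegral i) lee_fin; exact: chi_lower_mgf.
have PiE := iid_prod_expectation ig mG G0.
have Pi0 : (0 <= \prod_j \int[gauss]_u (G j u)%:E)%E.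
  by apply: prode_ge0 => j _; apply: integral_ge0 => u _; rewrite lee_fin.
have lift (a' l u : R) L U : l%:E = L -> u%:E = U -> a' * l <= u -> (a'%:E * L <= U)%E.
  by move=> <- <-; rewrite -EFinM lee_fin.
have lu2 := lift _ _ _ _ _ (EFin_Rintegral i10) (EFin_Rintegral i01) lu.
refine (combine _ _ _ _ _ _ _ _ _ _ (expR_gt0 _) (expR_ge0 _) l_ge lu2 u_le chi Pi0 PiE exE).
Qed.

End escape.

(** * Truncated Gaussian moments and the quantity [Delta_pm_ter] *)

Section threshold.
Context {R : realType}.
Notation gauss := (normal_prob (0 : R) 1).
Notation mu := (@lebesgue_measure R).
Notation pdf := (normal_pdf (0 : R) 1).

Lemma gauss_reflect (f : R -> \bar R) :
  measurable_fun setT f -> (forall x, 0 <= f x)%E ->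
  (\int[gauss]_x f (- x)%R = \int[gauss]_x f x)%E.
Proof.
move=> mf f0.
have mN : measurable_fun setT (-%R : R -> R) by exact: oppr_measurable.
have pdf0 x : 0 <= pdf x by exact: normal_pdf_ge0.
have mpdf : measurable_fun setT (fun x : R => (pdf x)%:E).
  by apply/measurable_EFinP; exact: measurable_normal_pdf.
rewrite (gauss_ge0_integral measurableT mf f0).
rewrite (gauss_ge0_integral measurableT (f := fun x => f (- x))); last 2 first.
- exact: measurableT_comp mf mN.
- by move=> x; exact: f0.
pose g x := (f x * (pdf x)%:E)%E.
have pdfN x : pdf (- x) = pdf x by rewrite gauss_pdfE sqrrN.
transitivity (\int[mu]_x (g \o (-%R : _ -> measurableTypeR R)) x)%E.
  by apply: eq_integral => x _; rewrite /g/= pdfN.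
have mg : measurable_fun setT g by exact: emeasurable_funM.
rewrite -[setT](preimage_setT (-%R : R -> measurableTypeR R)).
rewrite -ge0_integral_pushforward//; last by move=> x _; rewrite mule_ge0// lee_fin.
by apply: eq_measure_integral => //= A mA _; exact: lebesgue_measureN.
Qed.

(** The integral below [tau] in [Delta_pm_ter]; by symmetry of the Gaussian, the integral above
    [tau] is the same function at [- tau]. *)
Definition tail_moment (tau : R) : R := \int[gauss]_u (pospart (tau - u) ^+ 2).

Lemma tail_moment_ge0 tau : 0 <= tail_moment tau.
Proof. by apply: Rintegral_ge0 => u _; exact: sqr_ge0. Qed.

Let mp tau : measurable_fun [set: R] (fun u => pospart (tau - u) ^+ 2).
Proof.
apply: measurable_funX; apply: (measurableT_comp measurable_pospart).
by apply: measurable_funB => //; exact: measurable_id.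
Qed.

Lemma EFin_tail_moment tau :
  ((tail_moment tau)%:E = \int[gauss]_u (pospart (tau - u) ^+ 2)%:E)%E.
Proof.
have k4 : (1 : R) / 4 < 1 / 2 by lra.
have k0 : 0 <= (1 : R) / 4 by lra.
have k2 : 0 <= (1 : R) / 4 by lra.
apply: EFin_Rintegral.
have i : gauss.-integrable setT (EFin \o (fun u => 1 / 4 * pospart (tau - u) ^+ 2)).
  apply: (integrable_gauss_pospart_bound (s := tau) k0 k4) => [|u]; first exact: measurable_funM.
  rewrite ger0_norm; last by rewrite mulr_ge0// sqr_ge0.
  have h1 : 0 <= pospart (tau - u) := pospart_ge0 _.
  apply: le_trans (_ : expR (1 / 4 * pospart (tau - u) ^+ 2) <= _).
    by apply: le_trans (expR_ge1Dx _); rewrite lerDr.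
  by rewrite ler_peMl ?expR_ge0// lerDl.
have := integrableZl measurableT 4 i; apply: eq_integrable => // u _ /=.
by rewrite -EFinM; congr EFin; lra.
Qed.

Lemma phi_gauss_pdf (u : R) : phi u = pdf u.
Proof.
rewrite gauss_pdfE /phi /normal_peak expr1n mul1r; congr (_ * expR _).
by rewrite mulNr mulNr mulrC.
Qed.

Lemma tail_moment_le tau :
  (\int[mu]_(u in `]-oo, tau]) ((u - tau) ^+ 2 * phi u)%:E = (tail_moment tau)%:E)%E.
Proof.
rewrite EFin_tail_moment gauss_ge0_integral//; last 2 first.
- exact/measurable_EFinP.
- by move=> x; rewrite lee_fin sqr_ge0.
rewrite [in LHS]integral_mkcond; apply: eq_integral => u _.
rewrite patchE mem_setE in_itv/= phi_gauss_pdf -EFinM; case: leP => h.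
  by rewrite /pospart max_l ?subr_ge0// -sqrrN opprB.
by rewrite /pospart max_r ?expr0n ?mul0r// subr_le0 ltW.
Qed.

Lemma tail_moment_ge tau :
  (\int[mu]_(u in `[tau, +oo[) ((u - tau) ^+ 2 * phi u)%:E = (tail_moment (- tau))%:E)%E.
Proof.
rewrite EFin_tail_moment.
rewrite -(gauss_reflect (f := fun u => (pospart (- tau - u) ^+ 2)%:E)); last 2 first.
- exact/measurable_EFinP.
- by move=> x; rewrite lee_fin sqr_ge0.
rewrite gauss_ge0_integral//; last 2 first.
- apply/measurable_EFinP; apply: measurable_funX; apply: (measurableT_comp measurable_pospart).
  exact: measurable_funB.
- by move=> x; rewrite lee_fin sqr_ge0.
rewrite [in LHS]integral_mkcond; apply: eq_integral => u _.
rewrite patchE mem_setE in_itv/= andbT opprK [- tau + u]addrC phi_gauss_pdf -EFinM; case: leP => h.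
  by rewrite /pospart max_l ?subr_ge0.
by rewrite /pospart max_r ?expr0n ?mul0r// subr_le0 ltW.
Qed.

(** The slack [xi] replaces a proof that the infimum is attained. *)
Lemma Delta_threshold N k (d xi : R) : 0 < xi -> (Delta_pm_ter N k <= d%:E)%E ->
  exists tau, 0 <= tau /\
    k%:R * tail_moment tau + 2 * (N%:R - k%:R) * tail_moment (- tau) <= d + xi.
Proof.
move=> xi0 Dd.
have : (Delta_pm_ter N k < (d + xi)%:E)%E.
  by apply: le_lt_trans Dd _; rewrite lte_fin ltrDl.
move=> /ereal_inf_lt[_ [tau /= t0 <-]] h; exists tau; split.
  by move: t0; rewrite in_itv/= andbT.
by move: h; rewrite tail_moment_le tail_moment_ge -!EFinM -EFinD lte_fin => /ltW.
Qed.

Section mgf.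
Variable t : R.
Hypotheses (t0 : 0 <= t) (t2 : t < 1 / 2).
Let c := t / (1 - 2 * t).

Lemma tail_mgf tau : (\int[gauss]_u (expR (t * pospart (tau - u) ^+ 2))%:E <=
  (expR (c * tail_moment tau))%:E)%E.
Proof.
rewrite -(EFin_Rintegral (integrable_gauss_exp_pospart t0 t2 tau)) lee_fin.
exact: gauss_pospart_mgf.
Qed.

Lemma tail_mgf_opp tau : (\int[gauss]_u (expR (t * pospart (tau + u) ^+ 2))%:E <=
  (expR (c * tail_moment tau))%:E)%E.
Proof.
apply: le_trans (tail_mgf tau).
rewrite -(gauss_reflect (f := fun u => (expR (t * pospart (tau - u) ^+ 2))%:E)).
- by under [leRHS]eq_integral do rewrite opprK.
- apply/measurable_EFinP; apply: measurableT_comp => //; apply: measurable_funM => //.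
- by move=> x; rewrite lee_fin expR_ge0.
Qed.

(** For [tau >= 0] at most one of the two one-sided excesses is nonzero, so the two-sided
    exponential plus [1] is the sum of the one-sided ones. Its mean is [2 * M - 1 <= M ^+ 2], and
    the square produces the factor [2] in the exponent. *)
Lemma tail_mgf_two_sided (tau : R) : 0 <= tau ->
  (\int[gauss]_u (expR (t * pospart (`|u| - tau) ^+ 2))%:E <=
   (expR (c * (2 * tail_moment (- tau))))%:E)%E.
Proof.
move=> tau0; pose M := \int[gauss]_u expR (t * pospart (- tau - u) ^+ 2).
pose e1 u := expR (t * pospart (- tau - u) ^+ 2).
pose e2 u := e1 (- u).
pose e3 (u : R) := expR (t * pospart (`|u| - tau) ^+ 2).
have me1 : measurable_fun [set: R] e1.
  by apply: measurableT_comp => //; exact: measurable_funM.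
have me2 : measurable_fun [set: R] e2 by apply: (measurableT_comp me1); exact: oppr_measurable.
have me3 : measurable_fun [set: R] e3.
  apply: measurableT_comp => //; apply: measurable_funM => //; apply: measurable_funX.
  apply: (measurableT_comp measurable_pospart); exact: measurable_funB.
have ME : (\int[gauss]_u (e1 u)%:E = M%:E)%E.
  by rewrite -(EFin_Rintegral (integrable_gauss_exp_pospart t0 t2 (- tau))).
have ME2 : (\int[gauss]_u (e2 u)%:E = M%:E)%E.
  rewrite -ME -(gauss_reflect (f := fun u => (e1 u)%:E))//.
    exact/measurable_EFinP.
  by move=> x; rewrite lee_fin expR_ge0.
have sumE : (\int[gauss]_u (e3 u)%:E + 1%:E = M%:E + M%:E)%E.
  rewrite -{1}ME -ME2 -(integral_prob_cst gauss 1) -!ge0_integralD//.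
  - apply: eq_integral => u _; rewrite -!EFinD; congr EFin.
    rewrite /e3 /e2 /e1 /pospart opprK.
    case: (leP 0 u) => u0.
      rewrite ger0_norm// [X in _ = expR (t * X ^+ 2) + _]max_r; last by lra.
      by rewrite expr0n mulr0 expR0 addrC [u - tau]addrC.
    rewrite ltr0_norm// [X in _ = _ + expR (t * X ^+ 2)]max_r; last by lra.
    by rewrite expr0n mulr0 expR0 [- u - tau]addrC.
  - by move=> u _; rewrite lee_fin expR_ge0.
  - exact/measurable_EFinP.
  - by move=> u _; rewrite lee_fin expR_ge0.
  - exact/measurable_EFinP.
  - by move=> u _; rewrite lee_fin expR_ge0.
  - exact/measurable_EFinP.
have -> : (\int[gauss]_u (e3 u)%:E = (M + M - 1)%:E)%E.
  by rewrite EFinB EFinD -sumE addeK.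
rewrite lee_fin; have hM : M <= expR (c * tail_moment (- tau)).
  by have := tail_mgf (- tau); rewrite ME lee_fin.
have M0 : 0 <= M by apply: Rintegral_ge0 => u _; exact: expR_ge0.
apply: (@le_trans _ _ (M ^+ 2)).
  by have := sqr_ge0 (M - 1); rewrite sqrrB1 -mulr_natr; lra.
have -> : c * (2 * tail_moment (- tau)) = (c * tail_moment (- tau)) * 2%:R.
  by ring.
by rewrite expRM_natr ler_sqr ?nnegrE ?expR_ge0.
Qed.

End mgf.
End threshold.

(** * Almost sure invertibility of square Gaussian matrices *)

Section gaussian_determinant.
Context {R : realType}.
Notation gauss := (normal_prob (0 : R) 1).

Lemma gauss_set1 (x : R) : gauss [set x] = 0%E.
Proof.
have dom : gauss `<< (@lebesgue_measure R) by exact: normal_prob_dominates.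
move/null_content_dominatesP : dom; apply; first exact: measurable_set1.
exact: lebesgue_measure_set1.
Qed.

Definition rv_mx {T : Type} n (X : 'I_n * 'I_n -> T -> R) (w : T) : 'M[R]_n :=
  \matrix_(i, j) X (i, j) w.

Lemma measurable_det {d} {T : measurableType d} n (X : 'I_n * 'I_n -> T -> R) :
  (forall ij, measurable_fun setT (X ij)) ->
  measurable_fun setT (fun w => \det (rv_mx X w)).
Proof.
move=> mX; rewrite /determinant; apply: measurable_sum => s.
apply: measurable_funM => //; apply: measurable_prod => i _.
by under eq_fun do rewrite mxE; exact: mX.
Qed.

(** The determinant is affine in its top left entry, with the complementary minor as slope. Where
    that minor is nonzero, which is almost sure by induction, a single value of the resampled entry
    gives zero, and points have Gaussian measure zero. *)
Lemma gauss_det_neq0 {d} {T : measurableType d} (P : probability T R) n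
    (X : 'I_n * 'I_n -> T -> R) :
  iid_normal P X -> P [set w | \det (rv_mx X w) = 0] = 0%E.
Proof.
elim: n d T P X => [|n IH] d T P X iX.
  rewrite (_ : [set _ | _] = set0) ?measure0//.
  by apply/seteqP; split => // w /=; rewrite det_mx00 => /eqP; rewrite oner_eq0.
have iY := iid_resample (ord0, ord0) iX.
set Y := (X in iid_normal _ X) in iY.
pose S : set (#|{: 'I_n.+1 * 'I_n.+1}|.-tuple R) :=
  [set t | \det (rv_mx (fun ij => coord ij) t) = 0].
have mS : measurable S.
  rewrite -[S]setTI; have md := measurable_det (fun ij => @measurable_coord R _ ij) (n := n.+1).
  exact: md measurableT _ (measurable_set1 0).
have SE d' (T' : measurableType d') (X' : 'I_n.+1 * 'I_n.+1 -> T' -> R) :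
    [set w | \det (rv_mx X' w) = 0] = vec X' @^-1` S.
  apply/seteqP; split => w /=; rewrite /S/= (_ : rv_mx _ (vec X' w) = rv_mx X' w)//;
    by apply/matrixP => i j; rewrite !mxE coord_vec.
rewrite SE (law_unique iX iY mS) -SE.
have mY ij : measurable_fun setT (Y ij) by exact: (iY.1 ij).1.
have mX ij : measurable_fun setT (X ij) by exact: (iX.1 ij).1.
pose X' (ij : 'I_n * 'I_n) := X (lift ord0 ij.1, lift ord0 ij.2).
have iX' : iid_normal P X'.
  apply: (@iid_reindex _ _ _ P _ _ X (fun ij => (lift ord0 ij.1, lift ord0 ij.2))) => //.
  move=> [i j] [k l] e; have e1 := congr1 fst e; have e2 := congr1 snd e.
  by congr (_, _); [exact: lift_inj e1|exact: lift_inj e2].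
have minor w y : row' ord0 (col' ord0 (rv_mx Y (w, y))) = rv_mx X' w.
  by apply/matrixP => i j; rewrite !mxE /Y.
pose r w := \sum_(j < n) X (ord0, lift ord0 j) w * cofactor (rv_mx X w) ord0 (lift ord0 j).
have detY w y : \det (rv_mx Y (w, y)) = y * \det (rv_mx X' w) + r w.
  rewrite (expand_det_row _ ord0) big_ord_recl; congr (_ + _).
    by rewrite mxE /Y eqxx/= /cofactor minor expr0 mul1r.
  apply: eq_bigr => j _; rewrite mxE; congr (_ * _).
  rewrite /cofactor; congr (_ * \det _); apply/matrixP => i k.
  by rewrite !mxE /Y.
have mc : measurable_fun setT (fun w => \det (rv_mx X' w)).
  by apply: measurable_det => ij; exact: mX.
pose Z := [set w | \det (rv_mx X' w) = 0].
have mZ : measurable Z.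
  by rewrite -[Z]setTI; exact: mc measurableT _ (measurable_set1 0).
have mD : measurable [set w | \det (rv_mx Y w) = 0].
  rewrite -[X in measurable X]setTI.
  exact: (measurable_det mY) measurableT _ (measurable_set1 0).
apply/eqP; rewrite eq_le measure_ge0 andbT.
rewrite /product_measure1 -(IH _ _ P X' iX') -/Z.
rewrite -[X in (_ <= P X)%E]setIT -integral_indic//.
apply: ge0_le_integral => //.
- exact: measurable_fun_xsection.
- exact/measurable_EFinP/measurable_indic.
- move=> w _ /=; rewrite indicE.
  have [cw|cw] := pselect (Z w).
    rewrite mem_set//; apply: probability_le1; exact: measurable_xsection.
  rewrite memNset// (_ : xsection _ _ = [set - r w / \det (rv_mx X' w)]) ?gauss_set1//.
  apply/seteqP; split => y; rewrite /xsection/= inE/= detY.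
    by move/eqP; rewrite addr_eq0 => /eqP <-; rewrite mulfK//; exact/eqP.
  by move=> ->; rewrite divfK ?addNr//; exact/eqP.
Qed.

End gaussian_determinant.

Lemma lee_prod_ge0 {R : realDomainType} {I : Type} (r : seq I) (Q : pred I)
    (f g : I -> \bar R) :
  (forall i, Q i -> 0 <= f i <= g i)%E ->
  (\prod_(i <- r | Q i) f i <= \prod_(i <- r | Q i) g i)%E.
Proof.
move=> fg; suff /andP[] : (0 <= \prod_(i <- r | Q i) f i <=
    \prod_(i <- r | Q i) g i)%E by [].
apply: (big_ind2 (fun x y => (0 <= x <= y)%E)) => [|x1 x2 y1 y2|//].
  by rewrite lexx andbT lee_fin ler01.
by move=> /andP[x0 x12] /andP[y0 y12]; rewrite mule_ge0//= lee_pmul.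
Qed.

(** * The descent cone and the threshold bound on it *)

Section descent_cone.
Context {R : realType}.
Variables (N : nat) (K1 Km1 : {set 'I_N}).
Hypothesis disj : K1 :&: Km1 = finset.set0.

Definition sgn_pattern (j : 'I_N) : R := (j \in K1)%:R - (j \in Km1)%:R.
Local Notation sg := sgn_pattern.
Local Notation K := (K1 :|: Km1).

(** The sum is the directional derivative of the l1 norm at the sign pattern. Since [sg] vanishes
    off the support, the first condition encodes the box at the saturated coordinates. *)
Definition descent_cone (v : 'I_N -> R) : Prop :=
  (forall j, sg j * v j <= 0) /\
  \sum_j (if j \in K then sg j * v j else `|v j|) <= 0.

Lemma sgn_pattern_sqr j : j \in K -> sg j * sg j = 1.
Proof.
rewrite /sg finset.in_setU; have := congr1 (fun S : {set _} => j \in S) disj.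
rewrite /= finset.inE finset.in_set0.
by case: (j \in K1); case: (j \in Km1) => //= _ _; ring.
Qed.

Lemma sgn_pattern0 j : j \notin K -> sg j = 0.
Proof. by rewrite /sg finset.in_setU negb_or => /andP[/negbTE -> /negbTE ->]; rewrite subrr. Qed.

Lemma sgn_pattern_norm j : `|sg j| = (j \in K)%:R.
Proof.
have [jK|jK] := boolP (j \in K); last by rewrite sgn_pattern0// normr0.
by rewrite -sqrtr_sqr expr2 sgn_pattern_sqr// sqrtr1.
Qed.

Lemma sgn_pattern_le j (x : R) : `|x| <= 1 -> sg j * x <= sg j * sg j.
Proof.
move=> x1; have -> : sg j * sg j = `|sg j|.
  rewrite sgn_pattern_norm; have [jK|jK] := boolP (j \in K).
    by rewrite sgn_pattern_sqr.
  by rewrite sgn_pattern0// mul0r.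
by apply: le_trans (ler_norm _) _; rewrite normrM ler_piMr.
Qed.

(** Take a feasible [x] with [l1norm x <= l1norm x0] and put [v = x - x0]. On the support
    [|x j| >= sg j * x j = 1 + sg j * v j], and off it [|x j| = |v j|]. The cone sum is thus at most
    [l1norm x - l1norm x0]. *)
Lemma unique_solution_of_cone m (A : 'M[R]_(m, N)) (x0 := xpm1 (R:=R) K1 Km1) :
  (forall v : 'cV[R]_N, A *m v = 0 -> descent_cone (fun j => v j 0) -> v = 0) ->
  unique_l1_box_solution A (A *m x0) x0.
Proof.
move=> H; have x0E j : x0 j 0 = sg j by rewrite mxE.
split.
  split => // j; rewrite x0E -ler_norml sgn_pattern_norm.
  by case: (j \in K).
move=> x [Ax bx].
have [lt|le] := ltP (l1norm x0) (l1norm x).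
  by split; [exact: ltW|move=> e; rewrite e ltxx in lt].
suff -> : x = x0 by [].
apply/eqP; rewrite -subr_eq0; apply/eqP; apply: H.
  by rewrite mulmxBr Ax subrr.
have nx j : `|x j 0| <= 1 by rewrite ler_norml.
split => [j|].
  by rewrite !mxE -/(sg j) mulrBr subr_le0; exact: sgn_pattern_le.
apply: le_trans (_ : l1norm x - l1norm x0 <= 0); last by rewrite subr_le0.
rewrite /l1norm -sumrB; apply: ler_sum => j _; rewrite x0E !mxE -/(sg j) sgn_pattern_norm.
have [jK|jK] := boolP (j \in K); last first.
  by rewrite sgn_pattern0// !subr0.
rewrite mulrBr sgn_pattern_sqr// lerD2r.
by apply: le_trans (ler_norm _) _; rewrite normrM sgn_pattern_norm jK mul1r.
Qed.

Section threshold.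
Variables (tau t kappa s c : R).
Hypotheses (tau0 : 0 <= tau) (s0 : 0 <= s) (c0 : 0 < c).
Hypotheses (tE : t = s / (2 * c)) (kE : kappa = s * c / 2).

(** Distance from [u] to coordinate [j] of the slice of the polar cone with multiplier [tau]. That
    coordinate is [[tau, +oo[] on [K1], []-oo, - tau]] on [Km1] and [[- tau, tau]] elsewhere. *)
Definition threshold_fun (j : 'I_N) (u : R) : R :=
  if j \in K1 then pospart (tau - u) else
  if j \in Km1 then pospart (tau + u) else pospart (`|u| - tau).
Local Notation psi := threshold_fun.

Lemma threshold_fun_ge0 j u : 0 <= psi j u.
Proof. by rewrite /psi; case: ifP => _; [|case: ifP => _]; exact: pospart_ge0. Qed.

Lemma measurable_threshold_fun j : measurable_fun setT (psi j).
Proof.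
rewrite /psi; case: (j \in K1); [|case: (j \in Km1)];
  apply: (measurableT_comp measurable_pospart).
- by apply: measurable_funB => //; exact: measurable_id.
- by apply: measurable_funD => //; exact: measurable_id.
- by apply: measurable_funB => //; exact: normr_measurable.
Qed.

Let le_pospart (x : R) : x <= pospart x.
Proof. by rewrite /pospart le_max lexx. Qed.

(** Weak duality: subtracting [tau] times the nonpositive cone sum can only increase the left side,
    after which the inequality holds coordinate by coordinate. *)
Lemma cone_dot_le (v g : 'I_N -> R) : descent_cone v ->
  \sum_j g j * v j <= \sum_j psi j (g j) * `|v j|.
Proof.
move=> [v1 v2].
pose e j := if j \in K then sg j * v j else `|v j|.
apply: (@le_trans _ _ (\sum_j (g j * v j - tau * e j))).
  by rewrite sumrB -mulr_sumr lerBrDr gerDl mulr_ge0_le0.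
apply: ler_sum => j _; rewrite /e /psi finset.in_setU.
have := v1 j; rewrite /sg.
have [j1|j1] := boolP (j \in K1); have [j2|j2] := boolP (j \in Km1) => /=.
- have := congr1 (fun S : {set _} => j \in S) disj.
  by rewrite /= finset.inE finset.in_set0 j1 j2.
- rewrite subr0 mul1r => vj; rewrite ler0_norm//.
  have := ler_wpM2r (_ : 0 <= - v j) (le_pospart (tau - g j)); rewrite oppr_ge0 => /(_ vj).
  lra.
- rewrite sub0r mulN1r oppr_le0 => vj; rewrite ger0_norm//.
  have := ler_wpM2r vj (le_pospart (tau + g j)).
  lra.
- move=> _; apply: (@le_trans _ _ ((`|g j| - tau) * `|v j|)).
    by rewrite mulrBl lerD2r -normrM ler_norm.
  by apply: ler_wpM2r.
Qed.

(** Cauchy-Schwarz would couple the coordinates through a square root. Instead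
    [s * p * w <= t * p ^+ 2 + kappa * w ^+ 2] is used in each coordinate, with equality at
    [p = c * w], and [kappa] is paid only once because [v] is a unit vector. *)
Lemma cone_exp_le (v g : 'I_N -> R) : descent_cone v -> \sum_j v j ^+ 2 = 1 ->
  expR (s * (\sum_j g j * v j) - kappa) <= \prod_j expR (t * psi j (g j) ^+ 2).
Proof.
move=> Cv v1; rewrite -expR_sum ler_expR lerBlDr.
apply: le_trans (ler_wpM2l s0 (cone_dot_le g Cv)) _.
have -> : kappa = \sum_j kappa * v j ^+ 2 by rewrite -mulr_sumr v1 mulr1.
rewrite mulr_sumr -big_split/=; apply: ler_sum => j _.
rewrite -(real_normK (num_real (v j))); set p := psi _ _; set w := `|v j|.
rewrite -subr_ge0.
have -> : t * p ^+ 2 + kappa * w ^+ 2 - s * (p * w) = s / (2 * c) * (p - c * w) ^+ 2.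
  by rewrite tE kE; field; rewrite gt_eqF.
by rewrite mulr_ge0 ?sqr_ge0// divr_ge0// mulr_ge0// ltW.
Qed.

Lemma threshold_mgf_le (D : R) : 0 <= t -> t < 1 / 2 ->
  #|K|%:R * tail_moment tau + 2 * (N%:R - #|K|%:R) * tail_moment (- tau) <= D ->
  (\prod_j \int[normal_prob 0 1]_u (expR (t * psi j u ^+ 2))%:E <=
   (expR (t / (1 - 2 * t) * D))%:E)%E.
Proof.
move=> t0 t2 hD; set c' := t / _.
have c'0 : 0 <= c' by rewrite divr_ge0// subr_ge0; lra.
pose M j := if j \in K then tail_moment tau else 2 * tail_moment (- tau).
apply: (@le_trans _ _ (\prod_j (expR (c' * M j))%:E)%E).
  apply: lee_prod_ge0 => j _; apply/andP; split.
    by apply: integral_ge0 => u _; rewrite lee_fin expR_ge0.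
  rewrite /M /threshold_fun finset.in_setU.
  case: (j \in K1); first exact: (tail_mgf t0 t2 tau).
  case: (j \in Km1); first exact: (tail_mgf_opp t0 t2 tau).
  exact: (tail_mgf_two_sided t0 t2 tau0).
rewrite prodEFin lee_fin -expR_sum ler_expR -mulr_sumr ler_wpM2l//.
apply: le_trans hD; rewrite (bigID (fun j => j \in K))/=.
rewrite (eq_bigr (fun=> tail_moment tau)); last by move=> j jK; rewrite /M jK.
rewrite [X in _ + X](eq_bigr (fun=> 2 * tail_moment (- tau))); last first.
  by move=> j /negbTE jK; rewrite /M jK.
pose y := 2 * tail_moment (- tau); rewrite -/y sumr_const -[_ *+ #|K|]mulr_natl.
have : \sum_(j < N) y = #|K|%:R * y + \sum_(j | j \notin K) y.
  by rewrite (bigID (fun j => j \in K))/= sumr_const mulr_natl.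
rewrite sumr_const card_ord -mulr_natl => yE.
by move: yE; rewrite /y; lra.
Qed.

End threshold.
End descent_cone.

(** Coordinates shifted to [[0, 2]] are rounded down to multiples of [eta], and one point of [S] is
    kept in each inhabited cell, so that the net stays inside [S]. *)
Lemma finite_net {R : realType} (N : nat) (S : ('I_N -> R) -> Prop) (eta : R) :
  0 < eta -> (forall v, S v -> forall j, `|v j| <= 1) ->
  exists (J : finType) (xs : J -> 'I_N -> R), (forall x, S (xs x)) /\
    forall v, S v -> exists x, forall j, `|v j - xs x j| <= eta.
Proof.
move=> eta0 S1; pose L := Num.truncn (2 / eta).
pose cell (v : 'I_N -> R) : {ffun 'I_N -> 'I_L.+1} :=
  [ffun j => inord (Num.truncn ((v j + 1) / eta))].
pose Q (c : {ffun 'I_N -> 'I_L.+1}) := `[< exists v, S v /\ cell v = c >].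
have Qv (x : {c | Q c}) : exists v, S v /\ cell v = sval x.
  by have /asboolP := svalP x.
exists {c | Q c}, (fun x => projT1 (cid (Qv x))); split => [x|v Sv].
  by case: (projT2 (cid (Qv x))).
have Qc : Q (cell v) by apply/asboolP; exists v.
exists (exist Q _ Qc) => j; set x := exist Q _ _.
case: (projT2 (cid (Qv x))); set u := projT1 _ => Su /ffunP/(_ j).
rewrite !ffunE => /(congr1 val).
have pos w : S w -> 0 <= (w j + 1) / eta.
  move=> Sw; rewrite divr_ge0 ?(ltW eta0)//.
  by have := S1 w Sw j; rewrite ler_norml => /andP[+ _]; lra.
have bnd w : S w -> (Num.truncn ((w j + 1) / eta) < L.+1)%N.
  move=> Sw; rewrite ltnS /L truncn_ge_nat; last by rewrite divr_ge0// ltW.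
  have /andP[h _] := truncn_itv (pos w Sw); apply: le_trans h _.
  rewrite ler_pM2r ?invr_gt0//.
  by have := S1 w Sw j; rewrite ler_norml => /andP[_]; lra.
rewrite /= !inordK ?bnd// => e.
have /andP[] := truncn_itv (pos v Sv); have /andP[] := truncn_itv (pos u Su).
rewrite e -natr1; set n := _%:R => h1 h2 h3 h4.
have h5 : `|(v j + 1) / eta - (u j + 1) / eta| <= 1 by rewrite ler_norml; apply/andP; split; lra.
move: h5; rewrite -mulrBl normrM (gtr0_norm (_ : 0 < eta^-1)) ?invr_gt0//.
by rewrite ler_pdivrMr// mul1r (_ : v j + 1 - (u j + 1) = v j - u j)//; ring.
Qed.

Lemma tail_prob_le {R : realType} {d} {T : measurableType d} (P : probability T R)
    (F : T -> R) (delta : R) : 0 < delta -> (forall w, 0 <= F w) ->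
  P.-integrable setT (EFin \o F) ->
  exists B : R, 0 < B /\ (P [set w | (B < F w)%R] <= delta%:E)%E.
Proof.
move=> delta0 F0 iF; pose M := \int[P]_w F w.
have M0 : 0 <= M by exact: Rintegral_ge0.
have mF : measurable_fun setT (fun w => (F w)%:E) by exact: (measurable_int P iF).
(* Markov's inequality; the [+ 1] keeps the bound positive when the mean [M] is zero. *)
exists ((M + 1) / delta); have B0 : 0 < (M + 1) / delta by rewrite divr_gt0// ltr_wpDl.
split => //; set B := (M + 1) / delta in B0 *.
have mS : measurable [set w | B < F w].
  rewrite -[X in measurable X]setTI; move/measurable_EFinP : mF => mF.
  rewrite (_ : [set w | B < F w] = F @^-1` [set` `]B, +oo[]); first exact: mF.
  by apply/seteqP; split => w /=; rewrite in_itv/= andbT.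
have h : (B%:E * P [set w | (B < F w)%R] <= M%:E)%E.
  rewrite EFin_Rintegral// -[X in (_ * P X)%E]setIT -integral_indic//.
  rewrite -ge0_integralZl_EFin ?(ltW B0)//; last exact/measurable_EFinP/measurable_indic.
  apply: ge0_le_integral => //.
  - by move=> w _; rewrite -EFinM lee_fin mulr_ge0// ltW.
  - apply/measurable_EFinP; apply: measurable_funM => //; exact: measurable_indic.
  - move=> w _; rewrite -EFinM lee_fin indicE.
    have [wS|wS] := pselect (B < F w); first by rewrite mem_set// mulr1 ltW.
    by rewrite memNset// mulr0.
have -> : P [set w | (B < F w)%R] = (B^-1%:E * (B%:E * P [set w | (B < F w)%R]))%E.
  by rewrite muleA -EFinM mulVf ?mul1e// gt_eqF.
rewrite lee_pdivrMl//; apply: le_trans h _.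
by rewrite -EFinM lee_fin /B divfK ?gt_eqF// lerDl.
Qed.

(** * Numerical constants and the final exponent *)

Section constants.
Context {R : realType}.

(** [expR (- (6 / 5))] is the twelfth power of [expR (- (1 / 10)) >= 9 / 10], and the twelfth power
    of [9 / 10] exceeds [1 / 4]. *)
Lemma ln4_ge : 6 / 5 <= ln 4 :> R.
Proof.
rewrite -ler_expR lnK ?posrE//.
have h : (9 : R) / 10 <= expR (- (1 / 10)).
  by apply: le_trans (expR_ge1Dx _); lra.
rewrite -[6 / 5]opprK expRN -[leRHS]invrK lef_pV2 ?posrE ?expR_gt0 ?invr_gt0//.
have -> : - (6 / 5) = - (1 / 10) * 12%:R :> R by lra.
rewrite expRM_natr; apply: le_trans (_ : (9 / 10) ^+ 12 <= _); first by lra.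
by apply: lerXn2r; rewrite ?nnegrE ?expR_ge0//; lra.
Qed.

(* With [L >= 6/5] the exponent of the escape bound, [1/2 - 3 L / 2] up to the
   errors [u] and [v], is at most [- L]. *)
Lemma exponent_le (L s M n d0 xi u v : R) :
  6 / 5 <= L -> 0 < s -> s ^+ 2 = 2 * L -> 1 <= M -> M <= n -> 0 <= d0 ->
  d0 = M - 2 * s * Num.sqrt n -> 0 <= xi ->
  s * Num.sqrt xi <= 3 / 100 -> u <= 3 / 100 -> v <= 3 / 100 ->
  u + v + s ^+ 2 / 4 + s * Num.sqrt (d0 + xi) - s * Num.sqrt (M - 1) <= - L.
Proof.
move=> L1 s0 sL M1 Mn d00 d0E xi0 hxi hu hv.
have M0 : 0 <= M by lra.
have n0 : 0 <= n by lra.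
pose q := Num.sqrt M; pose e := Num.sqrt d0; pose k := Num.sqrt n.
have q1 : 1 <= q by rewrite -sqrtr1 ler_wsqrtr.
have e0 : 0 <= e := sqrtr_ge0 _.
have qk : q <= k by rewrite ler_wsqrtr.
have eq : e <= q.
  rewrite ler_wsqrtr// d0E gerBl mulr_ge0 ?sqrtr_ge0// mulr_ge0// ltW//.
have qE : q ^+ 2 = M by rewrite sqr_sqrtr.
have eE : e ^+ 2 = M - 2 * s * k by rewrite sqr_sqrtr// d0E.
(* Here [M <= n] enters: [q] and [e] are both at most [k]. If [q - e < s], then [(q - e) * (q + e)]
   would be smaller than [2 * s * k], its value by the choice of [d0]. *)
have gap : s <= q - e.
  rewrite leNgt; apply/negP => lt.
  have h1 : (q - e) * (q + e) = 2 * s * k by rewrite -subr_sqr qE eE; ring.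
  have h2 : (q - e) * (q + e) <= (q - e) * (2 * k) by rewrite ler_wpM2l ?subr_ge0//; lra.
  have h3 : (q - e) * (2 * k) < s * (2 * k) by rewrite ltr_pM2r//; lra.
  by move: h1 h2 h3; lra.
(* From [e ^+ 2 >= 0]. It bounds by [1 / 2] the cost [s / q] of having [M - 1] instead of [M] under
   the root. *)
have q2s : 2 * s <= q.
  have h1 : 2 * s * k <= q * k.
    have h := sqr_ge0 e; rewrite eE -qE in h.
    have h2 : q ^+ 2 <= q * k by rewrite expr2 ler_wpM2l//; lra.
    by lra.
  by move: h1; rewrite ler_pM2r//; lra.
have sq : s / q <= 1 / 2 by rewrite ler_pdivrMr; lra.
have root : q - q^-1 <= Num.sqrt (M - 1).
  have iq : q^-1 <= 1 by rewrite invf_le1//; lra.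
  have iq0 : 0 < q^-1 by rewrite invr_gt0; lra.
  have d : 0 <= q - q^-1 by lra.
  rewrite -(ger0_norm d) -sqrtr_sqr ler_wsqrtr//.
  have -> : (q - q^-1) ^+ 2 = M - 2 + q^-1 ^+ 2.
    by rewrite -qE; field; apply/eqP; lra.
  have : q^-1 ^+ 2 <= 1 by rewrite expr_le1//; lra.
  lra.
have rootD : Num.sqrt (d0 + xi) <= e + Num.sqrt xi.
  have x0 := sqrtr_ge0 xi.
  rewrite -[leRHS]ger0_norm ?addr_ge0// -sqrtr_sqr ler_wsqrtr// sqrrD !sqr_sqrtr//.
  by have := mulr_ge0 e0 x0; rewrite -mulr_natr /e; lra.
have h1 := ler_wpM2l (ltW s0) root.
have h2 := ler_wpM2l (ltW s0) rootD.
have h3 := ler_wpM2l (ltW s0) gap.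
rewrite mulrBr in h1; rewrite mulrDr in h2; rewrite mulrBr in h3.
rewrite -expr2 sL in h3; rewrite sL.
by lra.
Qed.

End constants.

(** With slack [- d / 2], a negative [d] would put a nonnegative combination of moments below
    [d / 2]. *)
Lemma Delta_bound_ge0 {R : realType} (N k : nat) (d : R) : k%:R <= N%:R :> R ->
  (Delta_pm_ter N k <= d%:E)%E -> 0 <= d.
Proof.
move=> kN hD; rewrite leNgt; apply/negP => lt.
have [|tau [_]] := Delta_threshold (xi := - d / 2) _ hD; first lra.
have h1 := tail_moment_ge0 tau; have h2 := tail_moment_ge0 (- tau).
have h3 : 0 <= k%:R * tail_moment tau by rewrite mulr_ge0.
have h4 : 0 <= 2 * (N%:R - k%:R) * tail_moment (- tau).
  by rewrite !mulr_ge0// subr_ge0.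
lra.
Qed.

(** Three errors, from the slack in the threshold, the smoothing [zeta] and the size of the net, are
    held to [3 / 100] each, as [exponent_le] allows. *)
Lemma near_kernel_small {R : realType} {d} {T : measurableType d} (P : probability T R)
    (m N : nat) (K1 Km1 : {set 'I_N}) (disj : K1 :&: Km1 = finset.set0)
    (A : 'I_m * 'I_N -> T -> R) (J : finType) (xs : J -> 'I_N -> R)
    (L s zeta : R) :
  iid_normal P A -> (0 < #|J|)%N ->
  (forall x, descent_cone (R := R) K1 Km1 (xs x)) -> (forall x, \sum_j xs x j ^+ 2 = 1) ->
  6 / 5 <= L -> 0 < s -> s ^+ 2 = 2 * L -> (0 < m)%N -> (m <= N)%N ->
  (Delta_pm_ter N #|K1 :|: Km1| <= (m%:R - 2 * s * Num.sqrt N%:R)%:E)%E ->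
  0 < zeta -> s * (2 * zeta) <= 3 / 100 ->
  (P (near_kernel zeta xs A (2 * zeta)) <= (expR (- L))%:E)%E.
Proof.
move=> iA J0 Cxs xs1 L1 s0 sL m0 mN hD zeta0 hz.
pose d0 : R := m%:R - 2 * s * Num.sqrt N%:R.
have kN : #|K1 :|: Km1|%:R <= N%:R :> R.
  by rewrite ler_nat -[X in (_ <= X)%N]card_ord; exact: max_card.
have thr (xi : R) : 0 < xi -> exists tau : R, 0 <= tau /\
    #|K1 :|: Km1|%:R * tail_moment tau +
    2 * (N%:R - #|K1 :|: Km1|%:R) * tail_moment (- tau) <= d0 + xi.
  by move=> xi0; exact: Delta_threshold.
have d00 : 0 <= d0 by exact: Delta_bound_ge0 kN hD.
pose xi := (3 / 100 / s) ^+ 2.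
have sx0 : 0 < 3 / 100 / s by rewrite divr_gt0//; lra.
have xi0 : 0 < xi by rewrite exprn_gt0.
have sxi : s * Num.sqrt xi <= 3 / 100.
  by rewrite sqrtr_sqr gtr0_norm// mulrC divfK// gt_eqF.
have [tau [tau0 htau]] := thr xi xi0.
(* This [c] minimizes [kappa + t / (1 - 2 * t) * D]: here [1 - 2 * t = r / c], so the second term is
   [s * r / 2] and the total is [s ^+ 2 / 2 + s * r]. *)
pose D := d0 + xi; pose r := Num.sqrt D; pose c := s + r.
have D0 : 0 < D by rewrite ltr_wpDl.
have r0 : 0 < r by rewrite sqrtr_gt0.
have rr : r * r = D by rewrite -expr2 sqr_sqrtr// ltW.
have c0 : 0 < c by rewrite addr_gt0.
pose t := s / (2 * c); pose kappa := s * c / 2.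
have t0 : 0 <= t by rewrite divr_ge0 ?(ltW s0)// mulr_ge0// ltW.
have t2 : t < 1 / 2.
  rewrite /t ltr_pdivrMr; last by rewrite mulr_gt0.
  by move: r0; rewrite /c; lra.
pose l := ln (#|J|%:R : R).
have l0 : 0 <= l by rewrite ln_ge0// ler1n.
(* Makes [b * l <= 3 / 100], and keeps [b <= 1] even for a one-point net, where [l = 0]. *)
pose b := 3 / 100 / (3 / 100 + l).
have bl0 : 0 < 3 / 100 + l by lra.
have b0 : 0 < b by rewrite divr_gt0//; lra.
have b1 : b <= 1 by rewrite ler_pdivrMr// mul1r; lra.
have bl : b * l <= 3 / 100.
  rewrite /b mulrAC ler_pdivrMr//.
  by rewrite ler_wpM2l//; lra.
pose G j u := expR (t * threshold_fun K1 Km1 tau j u ^+ 2).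
have mG j : measurable_fun setT (G j).
  apply: measurableT_comp => //; apply: measurable_funM => //.
  by apply: measurable_funX; exact: measurable_threshold_fun.
have GE x g : expR (s * (\sum_j g j * xs x j) - kappa) <= \prod_j G j (g j).
  exact: (cone_exp_le disj tau0 (ltW s0) c0 erefl erefl g (Cxs x) (xs1 x)).
have G0 j u : 0 <= G j u by exact: expR_ge0.
have := escape_bound zeta0 (ltW s0) b0 b1 J0 m0 xs1 iA mG GE G0 (2 * zeta).
have hP := threshold_mgf_le tau0 t0 t2 htau.
set Q := P _; set Pi := (\prod_j _)%E => esc.
have tc : t / (1 - 2 * t) * D = s * r / 2.
  have rn : r != 0 by rewrite gt_eqF.
  have cn : c != 0 by rewrite gt_eqF.
  have -> : 1 - 2 * t = r / c by apply: (mulIf cn); rewrite divfK// /t /c; field.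
  by rewrite -rr /t; field; rewrite rn cn.
have {hP} hPi : (Pi <= (expR (s * r / 2))%:E)%E by rewrite -tc.
have : (Q * (expR (- s * (2 * zeta)))%:E <=
   (expR (kappa + b * l - s ^+ 2 / 4 - Num.sqrt m.-1%:R * s))%:E * (expR (s * r / 2))%:E)%E.
  by apply: le_trans esc _; apply: lee_wpmul2l => //; rewrite lee_fin expR_ge0.
rewrite -EFinM -expRD mulNr (expRN (s * _)) lee_pdivrMr ?expR_gt0// -EFinM -expRD.
move=> /le_trans; apply; rewrite lee_fin ler_expR.
have m1 : 1 <= m%:R :> R by rewrite ler1n.
have mN' : m%:R <= N%:R :> R by rewrite ler_nat.
have := exponent_le L1 s0 sL m1 mN' d00 erefl (ltW xi0) sxi hz bl.
rewrite -/D -/r; have -> : m.-1%:R = m%:R - 1 :> R by rewrite -[in RHS](prednK m0) -natr1 addrK.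
by rewrite /kappa /c; lra.
Qed.

(** * Events of exact recovery, for tall and for wide matrices *)

Section recovery.
Context {R : realType} {d : measure_display} {T : measurableType d}.
Variables (P : probability T R) (m N : nat) (a : 'I_m * 'I_N -> T -> R).
Hypothesis ia : iid_normal P a.
Variables (K1 Km1 : {set 'I_N}).
Hypothesis disj : K1 :&: Km1 = finset.set0.
Local Notation success := [set w | unique_l1_box_solution (gauss_mx a w)
  (gauss_mx a w *m xpm1 (R:=R) K1 Km1) (xpm1 (R:=R) K1 Km1)].

Lemma gauss_mx_kernel w (v : 'cV[R]_N) i :
  gauss_mx a w *m v = 0 -> \sum_j a (i, j) w * v j 0 = 0.
Proof.
move=> /matrixP/(_ i 0); rewrite !mxE.
under eq_bigr do rewrite mxE -mulrA.
rewrite -mulr_sumr => /eqP; rewrite mulf_eq0 invr_eq0 sqrtr_eq0.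
(* The index [i] shows that [m] is positive, so the normalizing factor is nonzero and can be
   cancelled. *)
rewrite leNgt ltr0n (leq_ltn_trans _ (ltn_ord i))//= => /eqP.
exact.
Qed.

(** The first [N] rows form a square Gaussian matrix, and its invertibility already makes the kernel
    trivial. *)
Lemma recovery_tall : (N <= m)%N ->
  exists E : set T, [/\ measurable E, E `<=` success & P E = 1%E].
Proof.
move=> Nm.
pose X (ij : 'I_N * 'I_N) := a (widen_ord Nm ij.1, ij.2).
have iX : iid_normal P X.
  apply: (@iid_reindex _ _ _ P _ _ a (fun ij => (widen_ord Nm ij.1, ij.2))) => //.
  move=> [i j] [k l] e; have e1 := congr1 fst e; have e2 := congr1 snd e.
  congr (_, _); last exact: e2.
  by apply: val_inj; exact: (congr1 val e1).
pose Z := [set w | \det (rv_mx X w) = 0].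
have mZ : measurable Z.
  rewrite -[Z]setTI; have mX ij : measurable_fun setT (X ij) by exact: (iX.1 ij).1.
  exact: (measurable_det mX) measurableT _ (measurable_set1 0).
exists (~` Z); split; first exact: measurableC.
  move=> w /= dw; apply: unique_solution_of_cone => // v Av _.
  have uX : rv_mx X w \in unitmx by rewrite unitmxE unitfE; exact/eqP.
  rewrite -[v](mulKmx uX); suff -> : rv_mx X w *m v = 0 by rewrite mulmx0.
  apply/matrixP => i k; rewrite !mxE (ord1 k).
  rewrite -[RHS](gauss_mx_kernel (widen_ord Nm i) Av).
  by apply: eq_bigr => j _; rewrite mxE.
have Z0 : P Z = 0%E by exact: gauss_det_neq0 iX.
by rewrite probability_setC// Z0 sube0.
Qed.

Lemma sqr_sum_le (I : finType) (f : I -> R) : (forall i, 0 <= f i) ->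
  \sum_i f i ^+ 2 <= (\sum_i f i) ^+ 2.
Proof.
move=> f0; rewrite expr2 mulr_sumr; apply: ler_sum => i _.
by rewrite expr2 ler_wpM2r// (bigD1 i)//= lerDl sumr_ge0.
Qed.

(** A kernel vector in the cone, once normalized, is within [zeta / B] of a net point in each
    coordinate. If the entries sum to at most [B] in absolute value, that point has an image of norm
    at most [zeta]. The two exceptional events have total probability at most [eps / 2], which gives
    the strict inequality. *)
Lemma recovery_wide (eps : R) : 0 < eps -> eps <= 1 -> (0 < m)%N -> (m <= N)%N ->
  (Delta_pm_ter N #|K1 :|: Km1| + (Num.sqrt (8 * ln (4 / eps) * N%:R))%:E
    <= (m%:R)%:E)%E ->
  exists E : set T, [/\ measurable E, E `<=` success & ((1 - eps)%:E < P E)%E].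
Proof.
move=> eps0 eps1 m0 mN hm.
pose L := ln (4 / eps).
have L1 : 6 / 5 <= L.
  apply: le_trans ln4_ge _; rewrite ler_ln ?posrE ?divr_gt0//.
  by rewrite ler_pdivlMr// ler_piMr.
pose s := Num.sqrt (2 * L).
have s0 : 0 < s by rewrite sqrtr_gt0; lra.
have sL : s ^+ 2 = 2 * L by rewrite sqr_sqrtr//; lra.
have hD : (Delta_pm_ter N #|K1 :|: Km1| <= (m%:R - 2 * s * Num.sqrt N%:R)%:E)%E.
  rewrite EFinB leeBrDr//; apply: le_trans hm; rewrite leeD2l// lee_fin.
  rewrite -[leLHS]ger0_norm; last by rewrite !mulr_ge0 ?sqrtr_ge0// ltW.
  rewrite -sqrtr_sqr ler_wsqrtr//.
  by rewrite !exprMn sL sqr_sqrtr//; rewrite /L; lra.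
pose zeta := 3 / 200 / s.
have zeta0 : 0 < zeta by rewrite divr_gt0//; lra.
have hz : s * (2 * zeta) <= 3 / 100.
  by rewrite (_ : s * (2 * zeta) = 3 / 100)// /zeta; field; rewrite gt_eqF.
(* A crude substitute for an operator norm: changing every coordinate of a vector by at most [eta]
   moves its image by at most [eta * F w] in l1 norm. *)
pose F w := \sum_ij `|a ij w|.
have F0 w : 0 <= F w by exact: sumr_ge0.
have mF : measurable_family (fun z : 'I_m * 'I_N -> R => \sum_ij `|z ij|).
  apply: measurable_sum => ij.
  by apply: (measurableT_comp (@normr_measurable R setT)); exact: measurable_family_coord.
have iF : P.-integrable setT (EFin \o F).
  apply: (exp_bounded_integrable ia mF (C := 1) (K := 1)) => z.
  rewrite ger0_norm; last exact: sumr_ge0.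
  by rewrite !mul1r; apply: le_trans (expR_ge1Dx _); rewrite lerDr.
have e40 : 0 < eps / 4 by rewrite divr_gt0.
have [B [B0 PB]] := tail_prob_le e40 F0 iF.
pose S (v : 'I_N -> R) := descent_cone K1 Km1 v /\ \sum_j v j ^+ 2 = 1.
have S1 v : S v -> forall j, `|v j| <= 1.
  move=> [_ v1] j; rewrite -sqrtr_sqr -sqrtr1 ler_wsqrtr// -v1 (bigD1 j)//= lerDl.
  by apply: sumr_ge0 => i _; exact: sqr_ge0.
have eta0 : 0 < zeta / B by rewrite divr_gt0.
have [J [xs [Sxs net]]] := finite_net eta0 S1.
pose near := near_kernel zeta xs a (2 * zeta).
pose large := [set w | B < F w].
have mnear : measurable near := measurable_near_kernel zeta xs ia _.
have mlarge : measurable large.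
  rewrite -[large]setTI (_ : large = F @^-1` [set` `]B, +oo[]).
    have mF' : measurable_fun setT F by apply/measurable_EFinP; exact: (measurable_int P iF).
    exact: mF'.
  by apply/seteqP; split => w /=; rewrite in_itv/= andbT.
have Pnear : (P near <= (eps / 4)%:E)%E.
  (* An empty net means that the cone has no unit vector; the event [near] is then empty. *)
  have [J0|J0] := posnP #|J|.
    rewrite (_ : near = set0) ?measure0 ?lee_fin ?ltW//.
    by apply/seteqP; split => // w [x _]; have := card0_eq J0 x; rewrite inE.
  have -> : eps / 4 = expR (- L) by rewrite expRN lnK ?posrE ?divr_gt0// invf_div.
  apply: (near_kernel_small disj ia J0 _ _ L1 s0 sL m0 mN hD zeta0 hz) => x.
    exact: (Sxs x).1.
  exact: (Sxs x).2.
exists (~` (near `|` large)); split.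
- by apply: measurableC; exact: measurableU.
- move=> w /= /not_orP[wn wl]; apply: unique_solution_of_cone => // v Av Cv.
  apply: contrapT => v0; apply: wn.
  pose q := Num.sqrt (\sum_j v j 0 ^+ 2).
  have q2 : 0 < \sum_j v j 0 ^+ 2.
    rewrite lt_neqAle sumr_ge0 ?andbT; last by move=> j _; exact: sqr_ge0.
    apply/eqP => /esym/eqP; rewrite psumr_eq0; last by move=> j _; exact: sqr_ge0.
    move=> /allP h; apply: v0; apply/matrixP => j k; rewrite (ord1 k) mxE.
    by have := h j (mem_index_enum _); rewrite sqrf_eq0 => /eqP.
  have q0 : 0 < q by rewrite sqrtr_gt0.
  pose u j := v j 0 / q.
  have Su : S u.
    split; first split.
    + by move=> j; rewrite /u mulrA mulr_le0_ge0 ?invr_ge0 ?(ltW q0)//; exact: Cv.1.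
    + rewrite (eq_bigr (fun j => (if j \in K1 :|: Km1 then sgn_pattern K1 Km1 j * v j 0
         else `|v j 0|) / q)); last first.
        move=> j _; rewrite /u; case: ifP => _; first by rewrite mulrA.
        by rewrite normrM normfV (gtr0_norm q0).
      by rewrite -mulr_suml mulr_le0_ge0 ?invr_ge0 ?(ltW q0)//; exact: Cv.2.
    + rewrite /u; under eq_bigr do rewrite expr_div_n.
      by rewrite -mulr_suml sqr_sqrtr ?(ltW q2)// divff// gt_eqF.
  have [x hx] := net u Su; exists x.
  have Fw : F w <= B by rewrite leNgt; apply/negP.
  (* Subtracting the kernel equation of [v], divided by [q], leaves only the deviation of the net
     point from [u]. *)
  have row i : `|net_image xs a w x i| <= zeta / B * \sum_j `|a (i, j) w|.
    have -> : net_image xs a w x i = \sum_j a (i, j) w * (xs x j - u j).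
      transitivity (net_image xs a w x i - (\sum_j a (i, j) w * v j 0) / q).
        by rewrite (gauss_mx_kernel i Av) mul0r subr0.
      by rewrite mulr_suml -sumrB; apply: eq_bigr => j _; rewrite mulrBr mulrA.
    apply: le_trans (ler_norm_sum _ _ _) _; rewrite mulr_sumr; apply: ler_sum => j _.
    by rewrite normrM mulrC ler_wpM2r// distrC.
  have sumrow : \sum_i `|net_image xs a w x i| <= zeta.
    apply: le_trans (ler_sum _ (fun i _ => row i)) _.
    rewrite -mulr_sumr pair_big/= -[leRHS](divfK (lt0r_neq0 B0)) ler_wpM2l ?(ltW eta0)//.
    apply: le_trans Fw; rewrite le_eqVlt; apply/orP; left; apply/eqP.
    by apply: eq_bigr => -[i j] _.
  have r0 : 0 <= 2 * zeta by rewrite mulr_ge0// ltW.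
  rewrite /rad -(ger0_norm r0) -sqrtr_sqr ler_wsqrtr//.
  have h : \sum_i net_image xs a w x i ^+ 2 <= zeta ^+ 2.
    apply: (@le_trans _ _ ((\sum_i `|net_image xs a w x i|) ^+ 2)).
      apply: le_trans (sqr_sum_le (f := fun i => `|net_image xs a w x i|) _) => //.
      by apply: ler_sum => i _; rewrite real_normK ?num_real.
    by rewrite ler_sqr ?nnegrE ?sumr_ge0// ltW.
  have -> : (2 * zeta) ^+ 2 = zeta ^+ 2 + 3 * zeta ^+ 2 by ring.
  by rewrite lerD2l (le_trans h)// ler_peMl ?sqr_ge0//; lra.
rewrite probability_setC; last exact: measurableU.
have PU : (P (near `|` large) <= (eps / 2)%:E)%E.
  apply: le_trans (measureU2 _ _ _) _ => //.
  rewrite (_ : (eps / 2)%:E = (eps / 4)%:E + (eps / 4)%:E)%E; first exact: leeD.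
  by rewrite -EFinD; congr EFin; lra.
have fU : P (near `|` large) \is a fin_num by apply: fin_num_measure; exact: measurableU.
move: PU; rewrite -(fineK fU) -EFinB lee_fin lte_fin => PU.
by rewrite ltrD2l ltrN2 (le_lt_trans PU)// ltr_pdivrMr// ltr_pMr// ltr1n.
Qed.

End recovery.

Unset Implicit Arguments.

Theorem theorem3p3 (R : realType) (eps : R) (heps : 0 < eps) (m N : nat)
  (K1 Km1 : {set 'I_N}) (hdisj : (K1 :&: Km1 = finset.set0))
  (d : measure_display) (T : measurableType d) (P : probability T R)
  (a : 'I_m * 'I_N -> T -> R)
  (ha_law : forall ij, std_normal_rv P (a ij))
  (ha_indep : mutually_independent P a)
  (hm : (Delta_pm_ter N #|K1 :|: Km1| + (Num.sqrt (8 * ln (4 / eps) * N%:R))%:E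
          <= (m%:R)%:E)%E) :
  exists E : set T, measurable E /\
    E `<=` [set w | unique_l1_box_solution (gauss_mx a w)
                      (gauss_mx a w *m xpm1 (R:=R) K1 Km1) (xpm1 (R:=R) K1 Km1)] /\
    ((1 - eps)%:E < P E)%E.
Proof.
have ia : iid_normal P a by split.
(* For [eps > 1] the bound [1 - eps] is negative and the empty event will do. For [eps <= 1] the
   logarithm is at least [ln 4], as the choice of constants requires. *)
have [eps1|eps1] := ltP 1 eps.
  exists set0; split => //; split; first exact: sub0set.
  by rewrite measure0 lte_fin subr_lt0.
have le1 E : P E = 1%E -> ((1 - eps)%:E < P E)%E.
  by move=> ->; rewrite lte_fin gtrBl.
have [Nm|mN] := leqP N m.
  have [E [mE sE PE]] := recovery_tall ia hdisj Nm.
  by exists E; split => //; split => //; exact: le1.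
(* With [m = 0 < N] and [4 / eps > 1], the hypothesis would bound [Delta_pm_ter] by a negative
   number. *)
have m0 : (0 < m)%N.
  rewrite lt0n; apply/eqP => m0; subst m.
  have kN : #|K1 :|: Km1|%:R <= N%:R :> R.
    by rewrite ler_nat -[X in (_ <= X)%N]card_ord; exact: max_card.
  have x0 : 0 < Num.sqrt (8 * ln (4 / eps) * N%:R).
    rewrite sqrtr_gt0 mulr_gt0 ?ltr0n// mulr_gt0// ln_gt0//.
    by rewrite ltr_pdivlMr// mul1r (le_lt_trans eps1)// ltr1n.
  have : (Delta_pm_ter N #|K1 :|: Km1| <= (- Num.sqrt (8 * ln (4 / eps) * N%:R))%:E)%E.
    by rewrite EFinN -[leRHS]sub0e leeBrDr.
  by move/(Delta_bound_ge0 kN); rewrite oppr_ge0 leNgt x0.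
have [E [mE sE PE]] := recovery_wide ia hdisj heps eps1 m0 (ltnW mN) hm.
by exists E.
Qed.
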